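(* Let $s\ge p>2$ be integers. The spherical model with mixture $\xi(x)=\lambda x^p+(1-\lambda)x^s$ is 1-RSB at zero temperature for all $\lambda\in[0,1]$ if and only if one of the following two conditions is satisfied: (i) $\Delta\le 0$; (ii) $\Delta>0$ and $\Psi(\lambda_1^* )<0$.
   Context: Parisi measure at zero temperature. The spherical model with mixture $\xi$ is the centered Gaussian field $H_N$ on $S_N=\{\sigma\in\mathbb R^N:\sum_i\sigma_i^2=N\}$ with covariance $\mathbb E H_N(\sigma^1)H_N(\sigma^2)=N\xi\big(\tfrac1N\sum_i\sigma^1_i\sigma^2_i\big)$. Let $\mathcal K$ be the set of measures on $[0,1]$ of the form $\nu(dx)=\mathbf 1_{[0,1)}(x)\gamma(x)\,dx+\Delta_0\,\delta_{\{1\}}(dx)$, with $\gamma$ nonnegative, right-continuous and nondecreasing on $[0,1)$ and $\Delta_0>0$. For $\nu\in\mathcal K$ put $$\mathcal Q(\nu)=\frac12\Big(\int_0^1\xi'(x)\,\nu(dx)+\int_0^1\frac{dx}{\nu((x,1])}\Big).$$ The functional $\mathcal Q$ has a unique minimizer $\nu_P(dx)=\gamma_P(x)\mathbf 1_{[0,1)}(x)dx+\Delta_P\delta_{\{1\}}(dx)$ in $\mathcal K$, called the Parisi measure at zero temperature. Let $\rho_P$ be the measure on $[0,1)$ with $\rho_P([0,x])=\gamma_P(x)$ for $x\in[0,1)$. For $k\ge0$ the model is $k$-RSB at zero temperature if the support of $\rho_P$ consists of exactly $k$ points of $[0,1)$ (so together with the point $1$ there are $k+1$ points). Quantities. For $\xi(x)=\lambda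 x^p+(1-\lambda)x^s$ (derivatives in $x$) set $$\Psi(\lambda)=-\frac{\xi'(1)-1}{\xi''(1)}-\log\Big(\frac{\xi''(1)}{\xi'(1)}\Big)+1-\frac{2}{\xi'(1)}+\frac{\xi''(1)}{\xi'(1)^2},$$ $$Q(\lambda)=(s-p)^2(s^2-3s+2+p^2+3ps-3p)\lambda^2-s(s-p)(2s^2-6s+4-p^2+3ps-3p)\lambda+s^2(s-1)(s-2),$$ $$\Delta=s^2-6(p-1)s+(p-1)(p+7).$$ If $\Delta>0$, the quadratic polynomial $Q$ has two real roots, denoted $\lambda_1^*<\lambda_2^*$. *)

(* Defs.v *)
From HB Require Import structures.
From mathcomp Require Import all_boot all_order all_algebra.
From mathcomp Require Import all_classical all_reals all_analysis.
Set Implicit Arguments.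
Unset Strict Implicit.
Unset Printing Implicit Defensive.
Import Order.TTheory GRing.Theory Num.Theory.
Import numFieldNormedType.Exports.
Local Open Scope classical_set_scope.
Local Open Scope ring_scope.

(* Measures on [0,1] or [0,1) are Borel measures on R giving no mass to the
   complement; densities are total functions, read on [0,1) only. *)
Definition density_on01 (R : realType) (gamma : R -> R) : Prop :=
  [/\ {in `[0, 1[, forall x, 0 <= gamma x},
      {in `[0, 1[ &, {homo gamma : x y / x <= y}} &
      {in `[0, 1[, forall x, gamma y @[y --> x^'+] --> gamma x}].

(* nu(dx) = 1_{[0,1)}(x) gamma(x) dx + Delta0 delta_1(dx) *)
Definition decomposes (R : realType)
    (nu : {measure set (measurableTypeR R) -> \bar R}) (gamma : R -> R) (Delta0 : R) : Prop :=
  [/\ density_on01 gamma, 0 < Delta0 &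
      forall A : set R, measurable (A : set (measurableTypeR R)) ->
        nu A = (\int[@lebesgue_measure R]_(x in A `&` `[0%R, 1%R[) (gamma x)%:E
                + Delta0%:E * \d_(1%R : R) A)%E].

Definition classK (R : realType)
    (nu : {measure set (measurableTypeR R) -> \bar R}) : Prop :=
  exists (gamma : R -> R) (Delta0 : R), decomposes nu gamma Delta0.

(* nu need not be finite, so the functional takes values in \bar R, with
   (+oo)^-1 = 0.  At the endpoint x = 1, which is Lebesgue-null, the second
   integrand is 0^-1 = +oo. *)
Definition Qfun (R : realType) (xi : R -> R)
    (nu : {measure set (measurableTypeR R) -> \bar R}) : \bar R :=
  ((2^-1)%:E * (\int[nu]_(x in `[0%R, 1%R]) (derive1 xi x)%:E
    + \int[@lebesgue_measure R]_(x in `[0%R, 1%R]) (nu `](x : R), 1%R]%classic)^-1))%E.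

Definition is_parisi_measure (R : realType) (xi : R -> R)
    (nu : {measure set (measurableTypeR R) -> \bar R}) : Prop :=
  classK nu /\
  forall mu : {measure set (measurableTypeR R) -> \bar R},
    classK mu -> (Qfun xi nu <= Qfun xi mu)%E.

Definition has_cdf01 (R : realType)
    (rho : {measure set (measurableTypeR R) -> \bar R}) (gamma : R -> R) : Prop :=
  rho (~` `[0, 1[) = 0%E /\
  {in `[0, 1[, forall x, rho `[0, x]%classic = (gamma x)%:E}.

(* Topological support in [0,1) of a measure carried by [0,1): the point 1 is
   excluded even when mass accumulates there. *)
Definition support01 (R : realType)
    (rho : {measure set (measurableTypeR R) -> \bar R}) : set R :=
  [set x : R | (x \in `[0, 1[) /\
               forall U : set R, open U -> U x -> (0 < rho U)%E].

(* The Hamiltonian enters only through its covariance xi. *)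
Definition is_kRSB (R : realType) (xi : R -> R) (k : nat) : Prop :=
  exists (nu : {measure set (measurableTypeR R) -> \bar R})
         (gamma : R -> R) (Delta0 : R)
         (rho : {measure set (measurableTypeR R) -> \bar R}),
    [/\ is_parisi_measure xi nu, decomposes nu gamma Delta0,
        has_cdf01 rho gamma & (support01 rho #= `I_k)%card].

Definition mixture (R : realType) (p s : nat) (lambda : R) : R -> R :=
  fun x => lambda * x ^+ p + (1 - lambda) * x ^+ s.

Definition Psi (R : realType) (p s : nat) (lambda : R) : R :=
  let xi1 := derive1 (mixture p s lambda) 1 in
  let xi2 := derive1n 2 (mixture p s lambda) 1 in
  - ((xi1 - 1) / xi2) - ln (xi2 / xi1) + 1 - 2 / xi1 + xi2 / xi1 ^+ 2.

Definition Qpoly (R : realType) (p s : nat) (lambda : R) : R :=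
  let p' : R := p%:R in
  let s' : R := s%:R in
  (s' - p') ^+ 2
    * (s' ^+ 2 - 3 * s' + 2 + p' ^+ 2 + 3 * p' * s' - 3 * p') * lambda ^+ 2
  - s' * (s' - p')
    * (2 * s' ^+ 2 - 6 * s' + 4 - p' ^+ 2 + 3 * p' * s' - 3 * p') * lambda
  + s' ^+ 2 * (s' - 1) * (s' - 2).

Definition Delta (R : realType) (p s : nat) : R :=
  let p' : R := p%:R in
  let s' : R := s%:R in
  s' ^+ 2 - 6 * (p' - 1) * s' + (p' - 1) * (p' + 7).

(* l1 < l2 are the two real roots of Qpoly.  For s > p >= 3, Qpoly is a genuine
   quadratic, so the pair is unique; for s = p it is a nonzero constant. *)
Definition ordered_roots (R : realType) (p s : nat) (l1 l2 : R) : Prop :=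
  [/\ l1 < l2, Qpoly p s l1 = 0 & Qpoly p s l2 = 0].

(* Main.v *)
From HB Require Import structures.
Require Import Defs.
From mathcomp Require Import all_boot all_order all_algebra.
From mathcomp Require Import all_classical all_reals all_analysis measurable_realfun.
From mathcomp Require Import ring lra zify.
Set Implicit Arguments.
Unset Strict Implicit.
Unset Printing Implicit Defensive.
Import Order.TTheory GRing.Theory Num.Theory.
Import numFieldNormedType.Exports.
Local Open Scope classical_set_scope.
Local Open Scope ring_scope.

(** Write A = xi'(1), B = xi''(1), and let Q be the quadratic polynomial in lambda.

    Minimality.  The functional depends on a measure nu through its tail h, the
    function x |-> nu((x, 1]), and it is convex.  Let K be the primitive of h^-2
    that vanishes at 0.  If K and xi' have the same integral against nu, and K has
    no larger integral than xi' against every member of the class, then nu is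
    a minimizer ([optimality]).  Conversely, perturbing a minimizer gives such
    relations between K and xi' ([first_variation], [stationary]).

    Shape.  If rho is supported at one point x0, the density is m on [x0, 1) and 0
    before x0 ([step_of_support]).  Stationarity excludes x0 > 0 because both
    degrees exceed 2 ([jump_at0]).  So h(x) = D (1 + z (1 - x)) with z = m / D and
    K(x) = A x / (1 + z (1 - x)), and stationarity amounts to A * pmass z = 1,
    where pmass z is the integral of x / (1 + z (1 - x)) over [0, 1].

    Role of Psi.  The numbers Psi and 1 - A * pmass (B / A - 1) have the same sign
    ([PsiAB_pmass]), and pmass decreases.  If Psi > 0, then z < B / A - 1; hence
    xi' - K, which vanishes at 1, is negative on the left of 1, and moving mass
    there lowers the functional: a 1-RSB model has Psi <= 0 ([Psi_le0_of_kRSB1]).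
    If Psi < 0 on all of [0, 1], every model is 1-RSB: the required inequality is
    xi(u) <= the integral of K over [0, u], which comes from a comparison of
    x / xi'(x) with the linear function x / K(x) ([line_comparison],
    [one_step_certificate]).  There the convexity of x / xi'(x) is ruled by the sign
    of Q, and the values of Psi at other parameters enter since the rescaled
    function t |-> xi(x t) is proportional to a mixture of another parameter.

    Conditions (i) and (ii).  As a function of lambda, Psi has a derivative with the
    sign of Q, and Psi(1) < 0.  If Delta <= 0 then Q >= 0 and Psi increases; if
    Delta > 0 the roots of Q lie in (0, 1) and Psi has its local maximum at the
    first one.  So (i) or (ii) implies Psi < 0 on [0, 1] ([psi_lt0]).

    The boundary case.  If every model is 1-RSB and Delta > 0, then Psi <= 0 at the
    first root, and equality has to be excluded.  The root, and with it A and B, lies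
    in the field of the square root of Delta, so Psi = 0 would put ln (B / A) in that
    field together with B / A; but the exponential of a positive quadratic irrational
    or rational number is never quadratic or rational ([Psi_neq0_at_root],
    [expR_quadratic_irrational]).  The latter is proved with linear forms in 1,
    exp (x/2), exp x that have integer coefficients in divided powers and vanish to
    high order at 0 ([expform_exists]). *)

Lemma derive_continuous_within {R : realType} (f df : R -> R) (A : set R) :
  (forall x : R, is_derive x 1 f (df x)) -> {within A, continuous f}.
Proof.
move=> d; apply: continuous_subspaceT => y.
by apply/differentiable_continuous/derivable1_diffP; case: (d y).
Qed.

(** * Integer linear forms in 1, exp (x/2), exp x vanishing to high order at 0 *)

Section ExpPoly.
Context {R : realType}.
Implicit Types (x : R) (s : seq int).

(** With the divided powers x^i / i! as basis, differentiation is the shift of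
    the coefficient sequence, so integrality is never lost. *)
Fixpoint egf (i : nat) s x : R :=
  if s is c :: s' then c%:~R * (x ^+ i / i`!%:R) + egf i.+1 s' x else 0.

Lemma factR_neq0 i : (i`!%:R : R) != 0.
Proof. by rewrite pnatr_eq0 -lt0n fact_gt0. Qed.

Lemma is_derive_egfS i s x : is_derive x 1 (egf i.+1 s) (egf i s x).
Proof.
elim: s i => [|c s IH] i /=; first exact: is_derive_cst.
have -> : (fun y : R => c%:~R * (y ^+ i.+1 / i.+1`!%:R) + egf i.+2 s y) =
  (c%:~R * (i.+1`!%:R)^-1) \*: ((id : R -> R) ^+ i.+1) + egf i.+2 s.
  by apply/funext => y; rewrite /= fctE /= exprfctE /=  /GRing.scale /=; ring.
apply: is_derive_eq.
congr (_ + _); rewrite /GRing.scale /= mulr1 /= factS natrM -mulr_natl.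
have : (i.+1%:R : R) != 0 by rewrite pnatr_eq0.
move: (factR_neq0 i); move: (i.+1%:R : R) (i`!%:R : R) => u v v0 u0.
by field; rewrite u0 v0.
Qed.

Lemma is_derive_egf s x : is_derive x 1 (egf 0 s) (egf 0 (behead s) x).
Proof.
case: s => [|c s] /=; first exact: is_derive_cst.
have -> : (fun y : R => c%:~R * (y ^+ 0 / 0`!%:R) + egf 1 s y) =
  cst c%:~R + egf 1 s.
  by apply/funext => y; rewrite /= fctE expr0 fact0 divr1 mulr1.
have := is_derive_egfS 0 s x => ?.
by apply: is_derive_eq; rewrite add0r.
Qed.

Lemma egf_at0 s : egf 0 s (0 : R) = (head 0 s)%:~R.
Proof.
have E i s' : egf i.+1 s' (0 : R) = 0.
  by elim: s' i => //= c s' IH i; rewrite IH exprS !mul0r mulr0 addr0.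
by case: s => //= c s; rewrite E addr0 fact0 expr0 divr1 mulr1.
Qed.

(** Back substitution for k * r + r' = s on coefficient sequences, e standing
    for 1 / k: when 1 / k is an integer, the solution has integer entries. *)
Fixpoint solve (e : int) s : seq int :=
  if s is c :: s' then let r := solve e s' in e * (c - head 0 r) :: r else [::].

Lemma size_solve e s : size (solve e s) = size s.
Proof. by elim: s => //= c s ->. Qed.

Lemma egf_solve (k : R) e i s x : e%:~R * k = 1 ->
  k * egf i (solve e s) x + egf i (behead (solve e s)) x = egf i s x.
Proof.
move=> ek; elim: s i => [|c s IH] i /=; first by rewrite mulr0 addr0.
rewrite -(IH i.+1).
have -> : egf i (solve e s) x = (head 0 (solve e s))%:~R * (x ^+ i / i`!%:R)
   + egf i.+1 (behead (solve e s)) x.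
  by case: (solve e s) => //=; rewrite mul0r addr0.
rewrite intrM intrB mulrDr addrA.
set h := (head _ _)%:~R; set X := _ / _.
transitivity ((e%:~R * k) * (c%:~R - h) * X + k * egf i.+1 (solve e s) x +
   h * X + egf i.+1 (behead (solve e s)) x); first by ring.
by rewrite ek; ring.
Qed.

(** The entry of index i has weight 4^i, which is what makes each use of
    [solve] cost a constant factor, whatever the length of the sequence. *)
Fixpoint wnorm s : nat := if s is c :: s' then (`|c| + 4 * wnorm s')%N else 0%N.

Lemma wnorm_solve e s : (`|e| <= 2)%N ->
  (wnorm (solve e s) + `|head 0%R (solve e s)| <= 4 * wnorm s)%N.
Proof.
move=> e2; elim: s => //= c s IH.
set h := head 0 _ in IH *; set w := wnorm _ in IH *.
have : (`|(e * (c - h))%R| <= 2 * (`|c| + `|h|))%N.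
  by rewrite abszM leq_mul // (leq_trans (leqD_dist c 0 h)) // !(subr0, sub0r) abszN.
move: (absz _) => q; move: IH; move: (absz c) (absz h) (wnorm s) => ch hh ws.
lia.
Qed.

Lemma shift_ode_solution s (k : R) e : (`|e| <= 2)%N -> e%:~R * k = 1 ->
  exists r : seq int, [/\ size r = size s,
    (wnorm r + `|head 0%R r| <= 4 * wnorm s)%N &
    forall x, k * egf 0 r x + egf 0 (behead r) x = egf 0 s x].
Proof.
move=> e2 ek; exists (solve e s); split; first exact: size_solve.
  exact: wnorm_solve.
by move=> x; exact: egf_solve.
Qed.

Lemma egf_bound i s x Y : 1 <= Y -> `|x| <= Y ->
  `|egf i s x| <= (wnorm s)%:R * Y ^+ (i + size s).
Proof.
move=> Y1 xY; elim: s i => [|c s IH] i /=; first by rewrite normr0 mul0r.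
apply: (le_trans (ler_normD _ _)).
rewrite natrD mulrDl; apply: lerD.
  rewrite normrM -intr_norm -abszE -pmulrn ler_wpM2l //.
  rewrite normrM normrX; apply: (@le_trans _ _ (Y ^+ i * 1)).
    apply: ler_pM => //.
      by rewrite lerXn2r // ?nnegrE // (le_trans _ Y1).
    by rewrite normfV normr_nat invf_le1 ?ltr0n ?fact_gt0 // ler1n fact_gt0.
  by rewrite mulr1 ler_weXn2l // leq_addr.
apply: (le_trans (IH _)); rewrite addSnnS natrM -mulrA.
rewrite -{1}(mul1r (_ * Y ^+ _)) ler_wpM2r ?ler1n //.
by rewrite mulr_ge0 // exprn_ge0 // (le_trans _ Y1).
Qed.

Definition expform s0 s1 s2 x : R :=
  egf 0 s0 x + egf 0 s1 x * expR (x / 2) + egf 0 s2 x * expR x.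

Lemma is_derive_expform s0 s1 s2 x :
  is_derive x 1 (expform s0 s1 s2)
   (egf 0 (behead s0) x + (egf 0 (behead s1) x + 2^-1 * egf 0 s1 x) * expR (x / 2)
    + (egf 0 (behead s2) x + egf 0 s2 x) * expR x).
Proof.
have d0 := is_derive_egf s0 x; have d1 := is_derive_egf s1 x.
have d2 := is_derive_egf s2 x.
have d : is_derive x 1 (fun y : R => expR (y / 2)) (expR (x / 2) * 2^-1).
  have -> : (fun y : R => expR (y / 2)) = expR \o (2^-1 \*: (id : R -> R)).
    by apply/funext => y /=; rewrite /GRing.scale /= mulrC.
  apply: is_derive_eq; rewrite /= /GRing.scale /= mulr1.
  by rewrite [2^-1 * x]mulrC mulrC.
have -> : expform s0 s1 s2 = egf 0 s0 + egf 0 s1 * (fun y : R => expR (y / 2))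
    + egf 0 s2 * (expR : R -> R) by [].
apply: (is_derive_eq (is_deriveD (is_deriveD d0 (is_deriveM d1 d))
  (is_deriveM d2 (is_derive_expR x)))).
rewrite /GRing.scale /=; move: (expR x) (expR _) (egf _ s1 x) (egf _ s2 x).
move: (egf _ _ x) (egf _ _ x) (egf _ _ x) => *.
ring.
Qed.

Lemma expform_at0 s0 s1 s2 :
  expform s0 s1 s2 0 = (head 0 s0 + head 0 s1 + head 0 s2)%:~R.
Proof. by rewrite /expform !egf_at0 mul0r expR0 !mulr1 !intrD. Qed.

(** Solving G' = a G + F with G(0) = 0 raises the order of vanishing at 0 by one
    and preserves positivity: compare G with the bound after multiplication of
    both by exp (- a x). *)
Lemma growth_step (F G : R -> R) (a : R) m : 0 <= a <= 1 ->
  (forall x : R, is_derive x 1 G (a * G x + F x)) -> G 0 = 0 ->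
  (forall x, 0 < x -> 0 < F x <= x ^+ m / m`!%:R * expR x) ->
  forall x, 0 < x -> 0 < G x <= x ^+ m.+1 / m.+1`!%:R * expR x.
Proof.
move=> /andP[a0 a1] dG G0 HF x x0.
have de (y : R) : is_derive y 1 (fun y : R => expR (- a * y)) (- a * expR (- a * y)).
  have -> : (fun y : R => expR (- a * y)) = expR \o ((- a) \*: (id : R -> R)) by [].
  apply: is_derive_eq; rewrite /= /GRing.scale /=; ring.
pose g := G * (fun y : R => expR (- a * y)).
have dg (y : R) : is_derive y 1 g (F y * expR (- a * y)).
  have ? := dG y; have ? := de y.
  by apply: is_derive_eq; rewrite /GRing.scale /=; ring.
pose h := (fun y : R => y ^+ m.+1 / m.+1`!%:R * expR (y - a * y)) - g.
pose h' (y : R) := ((y ^+ m / m`!%:R + (1 - a) * (y ^+ m.+1 / m.+1`!%:R)) * expR (y - a * y)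
     - F y * expR (- a * y)).
have dh (y : R) : is_derive y 1 h (h' y).
  have dp : is_derive y 1 (fun y : R => y ^+ m.+1 / m.+1`!%:R) (y ^+ m / m`!%:R).
    have := is_derive_egfS m [:: 1] y; rewrite /= mul1r addr0.
    have -> // : (fun y : R => 1%:~R * (y ^+ m.+1 / m.+1`!%:R) + 0) =
      (fun y : R => y ^+ m.+1 / m.+1`!%:R).
    by apply/funext => z; rewrite mul1r addr0.
  have dee : is_derive y 1 (fun y : R => expR (y - a * y)) ((1 - a) * expR (y - a * y)).
    have -> : (fun y : R => expR (y - a * y)) = expR \o ((1 - a) \*: (id : R -> R)).
      by apply/funext => z /=; rewrite /GRing.scale /= mulrBl mul1r.
    apply: is_derive_eq; rewrite /= /GRing.scale /= mulr1 mulrC.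
    by congr (_ * expR _); rewrite mulrBl mul1r.
  have ? := dg y.
  have -> : h = (fun y : R => y ^+ m.+1 / m.+1`!%:R) * (fun y : R => expR (y - a * y)) - g by [].
  by apply: is_derive_eq; rewrite /h' /GRing.scale /=; ring.
have gE y : g y = G y * expR (- a * y) by [].
have hE y : h y = y ^+ m.+1 / m.+1`!%:R * expR (y - a * y) - g y by [].
have g0 : g 0 = 0 by rewrite gE G0 mul0r.
have h0 : h 0 = 0 by rewrite hE g0 exprS !mul0r subr0.
have gx : 0 < g x.
  have [c /[!in_itv]/= /andP[c0 cx] E] : exists2 c, c \in `]0, x[%R &
      g x - g 0 = F c * expR (- a * c) * (x - 0).
    by apply: (MVT x0) => //; exact: derive_continuous_within dg.
  move: E; rewrite g0 !subr0 => ->; rewrite !mulr_gt0 ?expR_gt0 //.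
  by case/andP: (HF c c0).
have hx : 0 <= h x.
  have [c /[!in_itv]/= /andP[c0 cx] E] : exists2 c, c \in `]0, x[%R &
      h x - h 0 = h' c * (x - 0).
    by apply: (MVT x0) => //; exact: derive_continuous_within dh.
  move: E; rewrite h0 !subr0 => ->; rewrite /h' mulr_ge0 ?(ltW x0) //.
  case/andP: (HF c c0) => _ Fc.
  have -> : expR (c - a * c) = expR c * expR (- a * c) by rewrite -expRD mulNr.
  rewrite mulrA -mulrBl mulr_ge0 ?expR_ge0 // mulrDl addrAC addr_ge0 ?subr_ge0 //.
  by rewrite !mulr_ge0 ?subr_ge0 ?expR_ge0 ?invr_ge0 ?ler0n ?exprn_ge0 ?(ltW c0).
apply/andP; split.
  by move: gx; rewrite gE pmulr_lgt0 // expR_gt0.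
move: hx; rewrite hE gE subr_ge0.
by rewrite expRD -mulNr mulrA ler_pM2r // expR_gt0.
Qed.

(** Each round solves three such equations, with a = 1/2, 1, 0: the coefficient
    of exp (a x) is integrated, hence longer by one term, and the two others
    are solutions of k * r + r' = s with k a difference of two of the exponents
    0, 1/2, 1.  These exponents are chosen because the inverses of their
    differences are the integers 1, -1, 2, -2, so no denominators appear. *)
Lemma expform_exists n : exists s0 s1 s2 : seq int,
  [/\ [/\ (size s0 <= n.+1)%N, (size s1 <= n.+1)%N & (size s2 <= n.+1)%N],
      (wnorm s0 + wnorm s1 + wnorm s2 <= 64 ^ n)%N &
      forall x, 0 < x ->
        0 < expform s0 s1 s2 x <= x ^+ (3 * n) / (3 * n)`!%:R * expR x].
Proof.
elim: n => [|n [s0 [s1 [s2 [[z0 z1 z2] W P]]]]].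
  exists [:: 1], [::], [::]; split=> // x x0.
  rewrite /expform /= fact0 expr0 !mul0r !addr0 !divr1 !mul1r ltr01 /=.
  by rewrite -expR0 ler_expR ltW.
have [a0 [sa0 wa0 ea0]] := @shift_ode_solution s0 (- 2^-1) (-2) erefl ltac:(lra).
have [a2 [sa2 wa2 ea2]] := @shift_ode_solution s2 2^-1 2 erefl ltac:(lra).
pose a1 := - (head 0 a0 + head 0 a2) :: s1.
have Pa : forall x, 0 < x ->
  0 < expform a0 a1 a2 x <= x ^+ (3 * n).+1 / (3 * n).+1`!%:R * expR x.
  apply: (@growth_step (expform s0 s1 s2) (expform a0 a1 a2) (2^-1) (3 * n)); last by exact: P.
  - by apply/andP; split; lra.
  - move=> x; apply: is_derive_eq (is_derive_expform _ _ _ x) _.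
    rewrite /expform -ea0 -ea2 [behead a1]/=.
    by move: (egf _ a0 x) (egf _ a1 x) (egf _ a2 x) (egf _ (behead a0) x)
      (egf _ (s1) x) (egf _ (behead a2) x) (expR x) (expR _) => *; field.
  - rewrite expform_at0; apply: (_ : forall u v : int, (u + - (u + v) + v)%:~R = 0) => u v.
    by have -> : u + - (u + v) + v = 0 by ring.
have [b0 [sb0 wb0 eb0]] := @shift_ode_solution a0 (- 1) (-1) erefl ltac:(lra).
have [b1 [sb1 wb1 eb1]] := @shift_ode_solution a1 (- 2^-1) (-2) erefl ltac:(lra).
pose b2 := - (head 0 b0 + head 0 b1) :: a2.
have Pb : forall x, 0 < x ->
  0 < expform b0 b1 b2 x <= x ^+ (3 * n).+2 / (3 * n).+2`!%:R * expR x.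
  apply: (@growth_step (expform a0 a1 a2) (expform b0 b1 b2) (1) (3 * n).+1); last by exact: Pa.
  - by rewrite ler01 lexx.
  - move=> x; apply: is_derive_eq (is_derive_expform _ _ _ x) _.
    rewrite /expform -eb0 -eb1 [behead b2]/=.
    by move: (egf _ b0 x) (egf _ b1 x) (egf _ b2 x) (egf _ (behead b0) x)
      (egf _ (behead b1) x) (egf _ (a2) x) (expR x) (expR _) => *; field.
  - rewrite expform_at0; apply: (_ : forall u v : int, (u + v + - (u + v))%:~R = 0) => u v.
    by have -> : u + v + - (u + v) = 0 by ring.
have [c1 [sc1 wc1 ec1]] := @shift_ode_solution b1 2^-1 2 erefl ltac:(lra).
have [c2 [sc2 wc2 ec2]] := @shift_ode_solution b2 1 1 erefl ltac:(lra).
pose c0 := - (head 0 c1 + head 0 c2) :: b0.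
have Pc : forall x, 0 < x ->
  0 < expform c0 c1 c2 x <= x ^+ (3 * n).+3 / (3 * n).+3`!%:R * expR x.
  apply: (@growth_step (expform b0 b1 b2) (expform c0 c1 c2) (0) (3 * n).+2); last by exact: Pb.
  - by rewrite ler01 lexx.
  - move=> x; apply: is_derive_eq (is_derive_expform _ _ _ x) _.
    rewrite /expform -ec1 -ec2 [behead c0]/=.
    by move: (egf _ c0 x) (egf _ c1 x) (egf _ c2 x) (egf _ (b0) x)
      (egf _ (behead c1) x) (egf _ (behead c2) x) (expR x) (expR _) => *; field.
  - rewrite expform_at0; apply: (_ : forall u v : int, (- (u + v) + u + v)%:~R = 0) => u v.
    by have -> : - (u + v) + u + v = 0 by ring.
exists c0, c1, c2; split.
- by rewrite /= sc1 sc2 sb0 sb1 /= sa0 sa2 !ltnS z0 z1 z2.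
- have tri (u v : int) : (`|(- (u + v))%R| <= `|u| + `|v|)%N.
    lia.
  have wa1 : (wnorm a1 <= `|head 0%R a0| + `|head 0%R a2| + 4 * wnorm s1)%N.
    by rewrite /a1 /= leq_add2r tri.
  have wb2 : (wnorm b2 <= `|head 0%R b0| + `|head 0%R b1| + 4 * wnorm a2)%N.
    by rewrite /b2 /= leq_add2r tri.
  have wc0 : (wnorm c0 <= `|head 0%R c1| + `|head 0%R c2| + 4 * wnorm b0)%N.
    by rewrite /c0 /= leq_add2r tri.
  have : (wnorm c0 + wnorm c1 + wnorm c2 <= 64 * (wnorm s0 + wnorm s1 + wnorm s2))%N.
    move: wa0 wa1 wa2 wb0 wb1 wb2 wc0 wc1 wc2.
    lia.
  by move/leq_trans; apply; rewrite expnS leq_mul.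
- by move=> x x0; rewrite mulnSr addn3; exact: Pc.
Qed.

End ExpPoly.

(** * The exponential of a positive quadratic irrational *)

Section ExpQuadratic.
Context {R : realType} (D : int) (r : R).
Hypothesis rD : r * r = D%:~R.

(** Two conjugate elements of Z[r], r being a square root of the integer D.  The
    coordinates are kept existential because they are not unique when D is a
    perfect square. *)
Definition zconj (x x' : R) : Prop :=
  exists u v : int, x = u%:~R + v%:~R * r /\ x' = u%:~R - v%:~R * r.

Lemma zconj_int (c : int) : zconj c%:~R c%:~R.
Proof. by exists c, 0; rewrite mul0r addr0 subr0. Qed.

Lemma zconjD x x' y y' : zconj x x' -> zconj y y' -> zconj (x + y) (x' + y').
Proof.
move=> [u [v [-> ->]]] [u1 [v1 [-> ->]]]; exists (u + u1), (v + v1).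
by rewrite !intrD; split; ring.
Qed.

Lemma zconjM x x' y y' : zconj x x' -> zconj y y' -> zconj (x * y) (x' * y').
Proof.
move=> [u [v [-> ->]]] [u1 [v1 [-> ->]]].
exists (u * u1 + v * v1 * D), (u * v1 + v * u1).
by rewrite !intrD !intrM -rD; split; ring.
Qed.

Lemma zconjX n x x' : zconj x x' -> zconj (x ^+ n) (x' ^+ n).
Proof.
move=> h; elim: n => [|n IH]; first by rewrite !expr0; exact: (zconj_int 1).
by rewrite !exprS; exact: zconjM.
Qed.

(** The norm x x' is an integer.  It can vanish for x nonzero when D is a perfect
    square; then x itself is an integer. *)
Lemma zconj_norm x x' : zconj x x' -> x != 0 -> 1 <= `|x| \/ 1 <= `|x| * `|x'|.
Proof.
move=> [u [v [xE x'E]]] x0.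
have int1 (n : int) : n != 0 -> 1 <= `|n%:~R : R|.
  by move=> n0; rewrite -intr_norm ler1z; lia.
have [x'0|x'0] := eqVneq x' 0.
  left; have xu : x = (u * 2)%:~R.
    by rewrite intrM; move: x'0; rewrite x'E xE => h; lra.
  by rewrite xu; apply: int1; apply: contraNneq x0; rewrite xu => ->.
right; have xx' : x * x' = (u * u - v * v * D)%:~R.
  by rewrite intrB !intrM -rD xE x'E; ring.
rewrite -normrM xx'; apply: int1; apply/eqP => h.
by move: xx'; rewrite h => /eqP; rewrite mulf_eq0 (negbTE x0) (negbTE x'0).
Qed.

Lemma zconj_egf (d m i : nat) (s : seq int) (t t' : R) : (0 < d)%N ->
  (i + size s <= m.+1)%N -> zconj t t' ->
  zconj (m`!%:R * d%:R ^+ m * egf i s (t / d%:R))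
        (m`!%:R * d%:R ^+ m * egf i s (t' / d%:R)).
Proof.
move=> d0 + tt'; elim: s i => [|c s IH] i /= hs.
  by rewrite !mulr0; exact: (zconj_int 0).
have im : (i <= m)%N by lia.
rewrite !(mulrDr (m`!%:R * _)); apply: zconjD; last by apply: IH; lia.
have dn0 : (d%:R : R) != 0 by rewrite pnatr_eq0 -lt0n.
have E (z : R) : m`!%:R * d%:R ^+ m * (c%:~R * ((z / d%:R) ^+ i / i`!%:R)) =
  (c * (m ^_ (m - i) * d ^ (m - i))%N%:Z)%:~R * z ^+ i.
  have mf : (m ^_ (m - i) * i`!)%N = m`!.
    by rewrite -{2}(subKn im) ffact_fact // leq_subr.
  have dm : (d%:R : R) ^+ m = d%:R ^+ (m - i) * d%:R ^+ i by rewrite -exprD subnK.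
  rewrite intrM -pmulrn -mf !natrM natrX expr_div_n dm.
  have f0 := @factR_neq0 R i; have g0 : (d%:R : R) ^+ i != 0 by rewrite expf_neq0.
  by field; rewrite f0 g0.
by rewrite !E; apply: zconjM; [exact: zconj_int|exact: zconjX].
Qed.

Lemma fact3n n : (n`! ^ 3 <= (3 * n)`!)%N.
Proof.
have h m k : (m`! * k`! <= (m + k)`!)%N.
  by rewrite -(bin_fact (leq_addr k m)) addKn leq_pmull // bin_gt0 leq_addr.
rewrite !expnS expn0 muln1.
have -> : (3 * n = n + (n + n))%N by lia.
by apply: leq_trans (h _ _); rewrite leq_mul // h.
Qed.

Lemma fact_dominates (K : R) : 0 < K -> exists n, K ^+ n.+1 < n`!%:R.
Proof.
move=> K0.
have /cvgrPdist_lt/(_ K^-1) := cvg_series_cvg_0 (is_cvg_series_exp_coeff K).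
rewrite invr_gt0 => /(_ K0)[N _ HN].
exists N; have := HN N (leqnn N); rewrite /exp_coeff /= sub0r normrN ger0_norm; last first.
  by rewrite mulr_ge0 ?exprn_ge0 ?invr_ge0 ?ltW.
rewrite ltr_pdivrMr ?ltr0n ?fact_gt0 // mulrC ltr_pdivlMr //.
by rewrite exprSr.
Qed.

(** If exp (y/2) were quadratic, the form [expform] at y, cleared of denominators,
    would be a nonzero element J of Z[r].  It is at most n! K^n / (3 n)!, and its
    conjugate, which is the same form at conjugate arguments and has no reason
    to be small, is at most n! K^n.  The product of the two tends to 0, against
    [zconj_norm]. *)
Lemma expR_quadratic_irrational (d : nat) (t t' b b' : R) : (0 < d)%N -> 0 < t ->
  zconj t t' -> zconj b b' -> expR (t / d%:R / 2) != b / d%:R.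
Proof.
move=> d0 t0 tt' bb'; apply/eqP => E.
have ar2 m : (m + 2 <= 2 * m.+1)%N by lia.
have ar3 m : (m.+1 <= 3 * m.+1)%N by lia.
have dR0 : 0 < (d%:R : R) by rewrite ltr0n.
have d1 : 1 <= (d%:R : R) by rewrite ler1n.
pose y := t / d%:R; pose y' := t' / d%:R.
pose be := b / d%:R; pose be' := b' / d%:R.
have y0 : 0 < y by rewrite divr_gt0.
pose Y := 1 + `|y| + `|y'|; pose B := 1 + `|be'|.
have Y1 : 1 <= Y by rewrite /Y -addrA lerDl addr_ge0.
have yY : y <= Y by rewrite /Y (le_trans (ler_norm y)) // addrAC lerDr addr_ge0.
have y'Y : `|y'| <= Y by rewrite /Y lerDr addr_ge0.
have B1 : 1 <= B by rewrite /B lerDl.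
have e1 : 1 <= expR y by rewrite -expR0 ler_expR ltW.
pose K := d%:R ^+ 2 * Y ^+ 3 * expR y * 64 * B ^+ 2.
have K0 : 0 < K.
  by rewrite !mulr_gt0 ?exprn_gt0 ?expR_gt0 // ?(lt_le_trans ltr01 Y1) // (lt_le_trans ltr01 B1).
have [n Kn] := fact_dominates (mulr_gt0 K0 K0).
have [s0 [s1 [s2 [[z0 z1 z2] W P]]]] := @expform_exists R n.
pose J := fun (x c : R) => (n`!%:R * d%:R ^+ n) * d%:R ^+ 2 *
   (egf 0 s0 x + egf 0 s1 x * c + egf 0 s2 x * c ^+ 2).
have JJ : zconj (J y be) (J y' be').
  have JE x c : J x (c / d%:R) = (n`!%:R * d%:R ^+ n * egf 0 s0 x) * d%:~R ^+ 2
    + (n`!%:R * d%:R ^+ n * egf 0 s1 x) * (d%:~R * c)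
    + (n`!%:R * d%:R ^+ n * egf 0 s2 x) * c ^+ 2.
    by rewrite /J -pmulrn; field; rewrite gt_eqF.
  rewrite !JE; do !apply: zconjD; apply: zconjM; do ?exact: zconj_egf.
  - exact/zconjX/zconj_int.
  - by apply: zconjM => //; exact: zconj_int.
  - exact: zconjX.
have JF : J y be = n`!%:R * d%:R ^+ n * d%:R ^+ 2 * expform s0 s1 s2 y.
  rewrite /J /expform -[be]/(b / d%:R) -E; congr (_ * (_ + _ * _)).
  by rewrite -expRM_natl -/y; congr expR; field.
have /andP[F0 Fle] := P _ y0.
have nf0 : 0 < (n`!%:R : R) by rewrite ltr0n fact_gt0.
have Jgt0 : 0 < J y be by rewrite JF !mulr_gt0 // exprn_gt0.
have dK : d%:R ^+ n * d%:R ^+ 2 <= (d%:R ^+ 2 : R) ^+ n.+1.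
  by rewrite -exprD -exprM ler_weXn2l // ar2.
have XS (x : R) m : 1 <= x -> x ^+ m <= x ^+ m.+1 by move=> ?; rewrite ler_weXn2l.
have X1 (x : R) m : 1 <= x -> x <= x ^+ m.+1 by move=> x1; rewrite -{1}(expr1 x) ler_weXn2l.
have ge0 (x : R) : 1 <= x -> 0 <= x by apply: le_trans.
have YS : 1 <= Y ^+ 3 by rewrite exprn_ege1.
have BS : 1 <= B ^+ 2 by rewrite exprn_ege1.
have powM (a c e u v : R) : (a * c * e * u * v) ^+ n.+1 =
  a ^+ n.+1 * c ^+ n.+1 * e ^+ n.+1 * u ^+ n.+1 * v ^+ n.+1 by rewrite !exprMn.
have Jle : J y be <= n`!%:R / (3 * n)`!%:R * K ^+ n.+1.
  rewrite JF -!(mulrA n`!%:R) ler_pM2l // [leRHS]mulrC.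
  apply: (@le_trans _ _ ((d%:R ^+ 2) ^+ n.+1 * (Y ^+ (3 * n) / (3 * n)`!%:R * expR y))).
    apply: ler_pM => //; first exact: ltW.
    apply: (le_trans Fle); rewrite ler_pM2r ?expR_gt0 // ler_pM2r ?invr_gt0 ?ltr0n ?fact_gt0 //.
    by rewrite lerXn2r // nnegrE; [exact: ltW|exact: ge0].
  rewrite /K powM.
  have perm (a c u e : R) : a * (c * u * e) = u * (a * c * e) by ring.
  rewrite perm.
  rewrite [leRHS]mulrC ler_pM2l ?invr_gt0 ?ltr0n ?fact_gt0 //.
  have perm2 (a c e u v : R) : a * c * e * u * v = a * (c * e * (u * v)) by ring.
  rewrite perm2 -mulrA ler_pM2l ?exprn_gt0 // -[leLHS]mulr1.
  apply: ler_pM => //.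
  - by rewrite mulr_ge0 ?expR_ge0 // exprn_ge0 // ge0.
  - apply: ler_pM; [exact/exprn_ge0/ge0|exact: expR_ge0| |exact: X1].
    by rewrite exprM; exact: XS.
  - by rewrite mulr_ege1 // exprn_ege1 // ler1n.
have J'le : `|J y' be'| <= n`!%:R * K ^+ n.+1.
  rewrite /J -!(mulrA n`!%:R) normrM (ger0_norm (ltW nf0)) ler_pM2l //.
  rewrite normrM (@ger0_norm _ (_ * _)); last by rewrite mulr_ge0 ?exprn_ge0 ?ltW.
  have eb s : (size s <= n.+1)%N -> `|egf 0 s y'| <= (wnorm s)%:R * Y ^+ n.+1.
    move=> zs; apply: (le_trans (egf_bound 0 s Y1 y'Y)).
    by rewrite add0n ler_wpM2l ?ler0n // ler_weXn2l.
  have b'B : `|be'| <= B by rewrite /B lerDr.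
  have B0 := ge0 _ B1.
  have Sum : `|egf 0 s0 y' + egf 0 s1 y' * be' + egf 0 s2 y' * be' ^+ 2| <=
    64 ^+ n * Y ^+ n.+1 * B ^+ 2.
    apply: (@le_trans _ _ (((wnorm s0)%:R + (wnorm s1)%:R + (wnorm s2)%:R) * Y ^+ n.+1 * B ^+ 2)).
      rewrite !mulrDl; apply: (le_trans (ler_normD _ _)); apply: lerD.
        apply: (le_trans (ler_normD _ _)); apply: lerD.
          rewrite -[leLHS]mulr1; apply: ler_pM => //; exact: eb.
        rewrite normrM; apply: ler_pM => //; first exact: eb.
        by apply: (le_trans b'B); rewrite expr2 ler_peMr.
      rewrite normrM normrX; apply: ler_pM => //; first
        exact: eb.
      by rewrite lerXn2r // nnegrE.
    rewrite ler_pM2r ?exprn_gt0 // ?(lt_le_trans ltr01 B1) //.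
    rewrite ler_pM2r ?exprn_gt0 // ?(lt_le_trans ltr01 Y1) //.
    by rewrite -!natrD -natrX ler_nat.
  rewrite /K powM.
  apply: (@le_trans _ _ ((d%:R ^+ 2) ^+ n.+1 * (64 ^+ n.+1 * (Y ^+ 3) ^+ n.+1 * (B ^+ 2) ^+ n.+1))).
    apply: ler_pM => //.
    apply: (le_trans Sum).
    apply: ler_pM => //; [by rewrite mulr_ge0 ?exprn_ge0 // ge0|exact: exprn_ge0| |exact: X1].
    apply: ler_pM; rewrite ?exprn_ge0 ?XS ?ler1n ?ge0 //.
      by rewrite ler1n.
    by rewrite -exprM ler_weXn2l // ar3.
  have perm (a c e u v : R) : a * c * e * u * v = e * (a * (u * c * v)) by ring.
  rewrite perm.
  rewrite ler_peMl //; last exact: exprn_ege1.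
  by do ?apply: mulr_ge0; do ?apply: exprn_ge0 => //; exact: ge0.
have key : 1 <= n`!%:R / (3 * n)`!%:R * (n`!%:R * (K * K) ^+ n.+1).
  have K1 : 1 <= n`!%:R * K ^+ n.+1.
    rewrite mulr_ege1 ?ler1n ?fact_gt0 // exprn_ege1 //.
    by rewrite !mulr_ege1 // ?exprn_ege1 // ler1n.
  have -> : n`!%:R / (3 * n)`!%:R * (n`!%:R * (K * K) ^+ n.+1) =
     (n`!%:R / (3 * n)`!%:R * K ^+ n.+1) * (n`!%:R * K ^+ n.+1) by rewrite exprMn; ring.
  have q0 : 0 <= n`!%:R / (3 * n)`!%:R * K ^+ n.+1 by exact: le_trans (ltW Jgt0) Jle.
  have [] := zconj_norm JJ (lt0r_neq0 Jgt0); rewrite (gtr0_norm Jgt0) => h.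
    by rewrite mulr_ege1 // (le_trans h Jle).
  by apply: (le_trans h); apply: ler_pM => //; exact: ltW.
have f30 : 0 < ((3 * n)`!%:R : R) by rewrite ltr0n fact_gt0.
move: key; rewrite leNgt => /negP; apply.
rewrite mulrAC ltr_pdivrMr // mul1r.
apply: (@lt_le_trans _ _ (n`!%:R ^+ 3)); last by rewrite -natrX ler_nat fact3n.
have -> : (n`!%:R : R) ^+ 3 = n`!%:R * (n`!%:R * n`!%:R) by rewrite !exprS expr0 mulr1.
by rewrite ltr_pM2l // ltr_pM2l.
Qed.

End ExpQuadratic.

(** * A comparison between a function and its chords *)

Section Calculus.
Context {R : realType}.
Implicit Types (a b x : R) (f df : R -> R).

Lemma derive_ge0_le f df a b : a <= b ->
  (forall x, a < x < b -> is_derive x 1 f (df x)) ->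
  (forall x, a < x < b -> 0 <= df x) ->
  {within `[a, b], continuous f} -> f a <= f b.
Proof.
rewrite le_eqVlt => /orP[/eqP-> //|ab] d d0 fc.
have [x /[!in_itv]/= xab E] := MVT ab (fun x (xab : x \in `]a, b[%R) => d x xab) fc.
by rewrite -subr_ge0 E mulr_ge0 ?d0 // subr_ge0 ltW.
Qed.

Lemma derive_le0_ge f df a b : a <= b ->
  (forall x, a < x < b -> is_derive x 1 f (df x)) ->
  (forall x, a < x < b -> df x <= 0) ->
  {within `[a, b], continuous f} -> f b <= f a.
Proof.
move=> ab d d0 fc; rewrite -lerN2.
apply: (derive_ge0_le ab (f := - f) (df := - df)).
- by move=> x xab; have dx := d x xab; exact: is_deriveN.
- by move=> x xab; rewrite oppr_ge0 d0.
- by move=> x; apply: continuousN; exact: fc.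
Qed.

Lemma within_of_derive f df a b :
  (forall x, a <= x <= b -> is_derive x 1 f (df x)) -> {within `[a, b], continuous f}.
Proof.
move=> d; apply: derivable_within_continuous => x; rewrite in_itv /= => xab.
by case: (d x xab).
Qed.

Lemma derive_gt0_lt f df a b : a < b ->
  (forall x, a <= x <= b -> is_derive x 1 f (df x)) ->
  (forall x, a < x < b -> 0 < df x) -> f a < f b.
Proof.
move=> ab d d0.
have d' (x : R) : x \in `]a, b[%R -> is_derive x 1 f (df x).
  by rewrite in_itv /= => /andP[ax xb]; apply: d; rewrite !ltW.
have [x /[!in_itv]/= xab E] := MVT ab d' (within_of_derive d).
by rewrite -subr_gt0 E mulr_gt0 ?d0 // subr_gt0.
Qed.

Lemma chord_le f df a x b : a < x < b ->
  (forall y, a <= y <= b -> is_derive y 1 f (df y)) ->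
  (forall y z, a <= y -> y <= z -> z <= b -> df y <= df z) ->
  (f x - f a) * (b - x) <= (f b - f x) * (x - a).
Proof.
move=> /andP[ax xb] d m.
have ct u v : a <= u -> v <= b -> {within `[u, v], continuous f}.
  move=> au vb; apply: (within_of_derive (df := df)) => y /andP[uy yv].
  by apply: d; rewrite (le_trans au uy) (le_trans yv vb).
have [y /[!in_itv]/= /andP[ay yx] ->] : exists2 y, y \in `]a, x[%R & f x - f a = df y * (x - a).
  apply: MVT => //; last by apply: ct; rewrite ?lexx ?ltW.
  move=> y; rewrite in_itv /= => /andP[ay yx]; apply: d.
  by rewrite ltW //= ltW // (lt_trans yx).
have [z /[!in_itv]/= /andP[xz zb] ->] : exists2 z, z \in `]x, b[%R & f b - f x = df z * (b - x).
  apply: MVT => //; last by apply: ct; rewrite ?lexx ?ltW.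
  move=> z; rewrite in_itv /= => /andP[xz zb]; apply: d.
  by rewrite !ltW // (lt_trans ax).
rewrite mulrAC -!mulrA; apply: ler_wpM2r.
  by rewrite mulr_ge0 // subr_ge0 ltW.
by apply: m; rewrite ltW // (lt_trans yx).
Qed.

Lemma convex_below_line f df (c0 c1 : R) a x b : a <= x <= b ->
  (forall y, a <= y <= b -> is_derive y 1 f (df y)) ->
  (forall y z, a <= y -> y <= z -> z <= b -> df y <= df z) ->
  f a <= c0 + c1 * a -> f b <= c0 + c1 * b -> f x <= c0 + c1 * x.
Proof.
move=> /andP[ax xb] d m fa fb.
have [->//|nax] := eqVneq x a; have [->//|nxb] := eqVneq x b.
have {nax}ax : a < x by rewrite lt_neqAle eq_sym nax.
have {nxb}xb : x < b by rewrite lt_neqAle nxb.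
have := @chord_le f df a x b; rewrite ax xb => /(_ isT d m) H.
have ab : 0 < b - a by rewrite subr_gt0 (lt_trans ax).
rewrite -(ler_pM2r ab) -subr_ge0; rewrite -subr_ge0 in H.
have -> : (c0 + c1 * x) * (b - a) - f x * (b - a) =
  ((f b - f x) * (x - a) - (f x - f a) * (b - x)) +
  ((c0 + c1 * a) - f a) * (b - x) + ((c0 + c1 * b) - f b) * (x - a) by ring.
by apply: addr_ge0; first apply: addr_ge0 => //; apply: mulr_ge0; rewrite subr_ge0 // ltW.
Qed.

Lemma tangent_below f df a b x0 x : a <= x0 <= b -> a <= x <= b ->
  (forall y, a <= y <= b -> is_derive y 1 f (df y)) ->
  (forall y z, a <= y -> y <= z -> z <= b -> df y <= df z) ->
  f x0 + df x0 * (x - x0) <= f x.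
Proof.
move=> /andP[ax0 x0b] /andP[ax xb] d m.
have ct u v : a <= u -> v <= b -> {within `[u, v], continuous f}.
  move=> au vb; apply: (within_of_derive (df := df)) => y /andP[uy yv].
  by apply: d; rewrite (le_trans au uy) (le_trans yv vb).
have [xx0|x0x] := leP x x0.
  have [y /[!in_itv]/= /andP[xy yx0] E] : exists2 y, y \in `[x, x0]%R & f x0 - f x = df y * (x0 - x).
    apply: MVT_segment => //; last exact: ct.
    move=> y; rewrite in_itv /= => /andP[xy yx0]; apply: d.
    by rewrite (le_trans ax (ltW xy)) (le_trans (ltW yx0)).
  rewrite -subr_ge0 (_ : _ - _ = (df x0 - df y) * (x0 - x)); last first.
    by rewrite mulrBl -E; ring.
  by rewrite mulr_ge0 // subr_ge0 // m // (le_trans ax).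
have [y /[!in_itv]/= /andP[xy yx0] E] : exists2 y, y \in `]x0, x[%R & f x - f x0 = df y * (x - x0).
  apply: MVT => //; last exact: ct.
  move=> y; rewrite in_itv /= => /andP[xy yx0]; apply: d.
  by rewrite (le_trans ax0 (ltW xy)) (le_trans (ltW yx0)).
rewrite -subr_ge0 (_ : _ - _ = (df y - df x0) * (x - x0)); last first.
  by rewrite mulrBl -E; ring.
by rewrite mulr_ge0 // subr_ge0 ?m // ?ltW // (lt_le_trans yx0).
Qed.

(** Let L(x) = f 1 + k (1 - x), let T be the tangent line of f at b, and let EL, ET
    be the integrals of x / f - x / L and x / f - x / T.  The function f is
    convex on (0, a], concave on [a, b] and convex on [b, 1].
    Suppose that EL is positive at its maximum c.  There f = L, and since EL
    returns to 0 at 1, f exceeds L somewhere on the right of c.  By convexity on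
    the outer intervals it then does so at a point x of [a, b] with x >= c, where
    f <= T; so T > L at x, while T <= f = L at 1.  Two lines cross once: L < T on
    the left of x.  Hence ET >= EL > 0 at c.  Moreover f <= T on [c, b], so ET
    grows until b, where it should be nonpositive. *)
Lemma line_comparison f df (EL ET : R -> R) a b k :
  0 < a -> a <= b -> b <= 1 ->
  (forall x, 0 < x -> 0 < f x) ->
  (forall x, 0 < x -> is_derive x 1 f (df x)) ->
  (forall x y, 0 < x -> x <= y -> y <= a -> df x <= df y) ->
  (forall x y, a <= x -> x <= y -> y <= b -> df y <= df x) ->
  (forall x y, b <= x -> x <= y -> y <= 1 -> df x <= df y) ->
  0 <= k -> df b <= 0 ->
  (forall x, 0 < x < 1 -> is_derive x 1 EL (x / f x - x / (f 1 + k * (1 - x)))) ->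
  {within `[0, 1], continuous EL} -> EL 0 = 0 -> EL 1 = 0 ->
  (forall x, 0 < x < b -> is_derive x 1 ET (x / f x - x / (f b + df b * (x - b)))) ->
  {within `[0, b], continuous ET} -> ET 0 = 0 -> ET b <= 0 ->
  forall u, 0 <= u <= 1 -> EL u <= 0.
Proof.
move=> a0 ab b1 fpos df1 conv1 conc conv2 k0 dfb dEL cEL EL0 EL1 dET cET ET0 ETb u u01.
rewrite leNgt; apply/negP => ELu.
pose L x := f 1 + k * (1 - x); pose T x := f b + df b * (x - b).
have b0 : 0 < b by exact: lt_le_trans ab.
have Lpos x : x <= 1 -> 0 < L x.
  by move=> x1; rewrite /L ltr_wpDr ?fpos // mulr_ge0 // subr_ge0.
have [c c01 cmax] := EVT_max ler01 cEL.
have ELc : 0 < EL c by apply: (lt_le_trans ELu); apply: cmax; rewrite in_itv.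
have [c0 c1] : 0 < c /\ c < 1.
  move: c01; rewrite in_itv /= !le_eqVlt => /andP[/orP[/eqP c0|->] /orP[/eqP c1|->]] //;
  by move: ELc; rewrite -?c0 ?c1 ?EL0 ?EL1 ltxx.
have fc : f c = L c.
  have d0 : is_derive c 1 EL 0.
    apply: (@derive1_at_max _ EL 0 1) => //.
    - by move=> t; rewrite in_itv /= => /dEL[].
    - by rewrite in_itv /= c0 c1.
    - move=> t; rewrite in_itv /= => /andP[t0 t1]; apply: cmax.
      by rewrite in_itv /= !ltW.
  have dc := dEL c; rewrite c0 c1 in dc.
  have E : c / f c - c / L c = 0.
    by case: d0 => _ <-; case: (dc isT) => _ <-.
  have fc0 := fpos _ c0; have Lc0 := Lpos _ (ltW c1).
  move/eqP: E; rewrite subr_eq0 => /eqP /(mulfI (lt0r_neq0 c0)) /(congr1 GRing.inv).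
  by rewrite !invrK.
have [v /andP[cv v1] Fv] : exists2 v, c < v < 1 & L v < f v.
  apply: contrapT => no; move: ELc; apply/negP; rewrite -leNgt -EL1.
  apply: (derive_ge0_le (ltW c1) (df := fun x => x / f x - x / L x)).
  - by move=> x /andP[cx x1]; apply: dEL; rewrite x1 (lt_trans c0).
  - move=> x /andP[cx x1]; rewrite subr_ge0.
    have x0 := lt_trans c0 cx; rewrite ler_pM2l // lef_pV2 ?posrE ?fpos ?Lpos ?(ltW x1) //.
    by rewrite leNgt; apply/negP => h; apply: no; exists x; rewrite ?cx.
  - by apply: continuous_subspaceW cEL; apply: subset_itvr; rewrite bnd_simp ltW.
have LE y : L y = (f 1 + k) + (- k) * y by rewrite /L; ring.
have TE y : T y = (f b - df b * b) + df b * y by rewrite /T; ring.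
have [x [cx ax xb Fx]] : exists x, [/\ c <= x, a <= x, x <= b & L x < f x].
  have [va|av] := ltP v a.
    exists a; split=> //; first by rewrite ltW // (lt_trans cv).
    rewrite ltNge; apply/negP => fa; move: Fv; apply/negP; rewrite -leNgt LE.
    apply: (@convex_below_line f df _ _ c v a); rewrite -?LE ?fc ?(ltW cv) ?(ltW va) //.
      by move=> y /andP[cy _]; exact/df1/(lt_le_trans c0).
    by move=> y z cy; apply: conv1; exact: lt_le_trans cy.
  have [vb|bv] := leP v b; first by exists v; split=> //; exact: ltW.
  have L1 : L 1 = f 1 by rewrite /L subrr mulr0 addr0.
  have back w : c <= w -> b <= w -> w < v -> L w < f w.
    move=> cw bw wv.
    rewrite ltNge; apply/negP => fw; move: Fv; apply/negP; rewrite -leNgt LE.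
    apply: (@convex_below_line f df _ _ w v 1); rewrite -?LE ?L1 ?(ltW wv) ?(ltW v1) //.
      by move=> y /andP[wy _]; exact/df1/(lt_le_trans b0)/(le_trans bw).
    by move=> y z wy; apply: conv2; exact: le_trans wy.
  have [cb|bc] := leP c b; first by exists b; split => //; exact: back.
  by have := back c (lexx _) (ltW bc) cv; rewrite fc ltxx.
have Tab y : a <= y -> y <= b -> f y <= T y.
  move=> ay yb.
  have := @tangent_below (fun z => - f z) (fun z => - df z) a b b y.
  rewrite ab lexx ay yb => /(_ isT isT) H.
  have {H} : - f b + - df b * (y - b) <= - f y.
    apply: H => [z /andP[az _]|z w az zw wb].
      by have := df1 z (lt_le_trans a0 az) => dz; exact: is_deriveN.
    by rewrite lerN2; exact: conc.
  by rewrite /T; lra.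
have T1 : T 1 <= f 1.
  apply: (@tangent_below f df b 1 b 1); rewrite ?lexx ?b1 //.
  move=> y /andP[bry _]; exact/df1/(lt_le_trans b0).
have LTx : L x < T x by exact: lt_le_trans Fx (Tab _ ax xb).
have LT y : y <= x -> L y < T y.
  move=> yx; have x1 : x <= 1 := le_trans xb b1.
  have E : (L y - T y) = (L x - T x) - (- k - df b) * (x - y) by rewrite /L /T; ring.
  have E1 : (L 1 - T 1) = (L x - T x) + (- k - df b) * (1 - x) by rewrite /L /T; ring.
  have P : 0 < (- k - df b) * (1 - x).
    have L1 : L 1 = f 1 by rewrite /L subrr mulr0 addr0.
    move: T1 LTx E1; rewrite L1; move: (L x) (T x) (T 1) (f 1) (_ * (1 - x)) => *.
    lra.
  have : 0 < - k - df b.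
    move: P; rewrite pmulr_lgt0 // subr_gt0 lt_neqAle x1 andbT; apply/eqP => xE.
    by move: LTx; rewrite xE ltNge; apply/negP; rewrite negbK /L subrr mulr0 addr0.
  move=> /ltW P2.
  have : 0 <= (- k - df b) * (x - y) by rewrite mulr_ge0 // subr_ge0.
  move: E LTx; move: (L x) (T x) (L y) (T y) (_ * (x - y)) => *.
  lra.
have cb : c <= b := le_trans cx xb.
have ETc : EL c <= ET c.
  rewrite -subr_ge0; have -> : 0 = ET 0 - EL 0 by rewrite ET0 EL0 subrr.
  apply: (derive_ge0_le (f := ET - EL) (ltW c0) (df := fun y =>
     (y / f y - y / T y) - (y / f y - y / L y))).
  - move=> y /andP[y0 yc]; apply: is_deriveB; [apply: dET|apply: dEL].
      by rewrite y0 (lt_le_trans yc).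
    by rewrite y0 (lt_trans yc).
  - move=> y /andP[y0 yc]; rewrite opprB addrC addrA subrK subr_ge0.
    have yx := le_trans (ltW yc) cx; have y1 := le_trans yx (le_trans xb b1).
    rewrite ler_pM2l // lef_pV2 ?posrE ?Lpos //; first exact/ltW/LT.
    exact: lt_trans (Lpos _ y1) (LT _ yx).
  - apply: within_continuousB.
      by apply: continuous_subspaceW cET; apply: subset_itvl; rewrite bnd_simp.
    by apply: continuous_subspaceW cEL; apply: subset_itvl; rewrite bnd_simp ltW.
have fT y : c < y -> y < b -> f y <= T y.
  move=> cy yb; have [ya|ay] := ltP y a; last exact/Tab/ltW.
  rewrite TE; apply: (@convex_below_line f df _ _ c y a); rewrite -?TE ?(ltW cy) ?(ltW ya) //.
  - by move=> z /andP[cz _]; exact/df1/(lt_le_trans c0).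
  - by move=> z w cz; apply: conv1; exact: lt_le_trans cz.
  - by rewrite fc ltW // LT.
  - exact: Tab.
have : ET c <= ET b.
  apply: (derive_ge0_le cb (df := fun y => y / f y - y / T y)).
  - by move=> y /andP[cy yb]; apply: dET; rewrite yb (lt_trans c0).
  - move=> y /andP[cy yb]; rewrite subr_ge0.
    have y0 := lt_trans c0 cy; have fy := fpos _ y0.
    rewrite ler_pM2l // lef_pV2 ?posrE ?fT //.
    exact: lt_le_trans fy (fT _ cy yb).
  - by apply: continuous_subspaceW cET; apply: subset_itvr; rewrite bnd_simp ltW.
move=> h; have := lt_le_trans ELc (le_trans ETc (le_trans h ETb)).
by rewrite ltxx.
Qed.

End Calculus.

(** * The mixture and the function Psi *)

Section Slopes.
Context {R : realType}.
Implicit Types (x l z : R).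

Lemma is_derive_monomial (c : R) n x :
  is_derive x 1 (fun y : R => c * y ^+ n) (c * (n%:R * x ^+ n.-1)).
Proof.
have -> : (fun y : R => c * y ^+ n) = c \*: ((id : R -> R) ^+ n).
  by apply/funext => y; rewrite /= exprfctE.
by apply: is_derive_eq; rewrite /GRing.scale /= mulr1; case: n => [|n] /=;
  rewrite ?mul0r // mulrA.
Qed.

Lemma is_derive_affine (c0 c1 x : R) : is_derive x 1 (fun y : R => c0 + c1 * y) c1.
Proof.
have := is_deriveD (is_derive_cst c0 x 1) (is_deriveZ c1 (is_derive_id x 1)).
by rewrite add0r /GRing.scale /= mulr1.
Qed.

Definition dmixture p s l x : R :=
  l * (p%:R * x ^+ p.-1) + (1 - l) * (s%:R * x ^+ s.-1).

Definition ddmixture p s l x : R :=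
  l * p%:R * (p.-1%:R * x ^+ p.-1.-1) + (1 - l) * s%:R * (s.-1%:R * x ^+ s.-1.-1).

(** Closed forms of xi'(1) and xi''(1). *)
Definition slope1 (p s : nat) l : R := l * p%:R + (1 - l) * s%:R.
Definition slope2 (p s : nat) l : R :=
  l * (p%:R * (p%:R - 1)) + (1 - l) * (s%:R * (s%:R - 1)).

Lemma is_derive_mixture p s l x : is_derive x 1 (mixture p s l) (dmixture p s l x).
Proof. exact: is_deriveD (is_derive_monomial l p x) (is_derive_monomial (1 - l) s x). Qed.

Lemma derive1_mixture p s l : derive1 (mixture p s l) =1 dmixture p s l.
Proof. by move=> x; rewrite derive1E; case: (is_derive_mixture p s l x). Qed.

Lemma is_derive_dmixture p s l x : is_derive x 1 (dmixture p s l) (ddmixture p s l x).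
Proof.
have -> : dmixture p s l =
    (fun y : R => (l * p%:R) * y ^+ p.-1) + (fun y : R => ((1 - l) * s%:R) * y ^+ s.-1).
  by apply/funext => y; rewrite /dmixture !mulrA.
exact: is_deriveD (is_derive_monomial (l * p%:R) p.-1 x)
  (is_derive_monomial ((1 - l) * s%:R) s.-1 x).
Qed.

Lemma derivable_ddmixture p s l x : derivable (ddmixture p s l) x 1.
Proof.
have -> : ddmixture p s l = (fun y : R => (l * p%:R * p.-1%:R) * y ^+ p.-1.-1) +
    (fun y : R => ((1 - l) * s%:R * s.-1%:R) * y ^+ s.-1.-1).
  by apply/funext => y; rewrite /ddmixture !mulrA.
by case: (is_deriveD (is_derive_monomial (l * p%:R * p.-1%:R) p.-1.-1 x)
  (is_derive_monomial ((1 - l) * s%:R * s.-1%:R) s.-1.-1 x)).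
Qed.

Lemma mixture0 p s l : (0 < p)%N -> (0 < s)%N -> mixture p s l 0 = 0.
Proof. by case: p s => [//|p] [//|s] _ _; rewrite /mixture !exprS !mul0r !mulr0 addr0. Qed.

Lemma mixture1 p s l : mixture p s l 1 = 1.
Proof. by rewrite /mixture !expr1n !mulr1 addrC subrK. Qed.

Lemma dmixture1 p s l : dmixture p s l 1 = slope1 p s l.
Proof. by rewrite /dmixture !expr1n !mulr1. Qed.

Lemma ddmixture1 p s l : (0 < p)%N -> (0 < s)%N -> ddmixture p s l 1 = slope2 p s l.
Proof.
by move=> p0 s0; rewrite /ddmixture !expr1n /slope2 -!subn1 !natrB //; ring.
Qed.

Lemma dmixture_ge0 p s l x : 0 <= l <= 1 -> 0 <= x -> 0 <= dmixture p s l x.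
Proof. by move=> /andP[l0 l1] x0; rewrite addr_ge0 ?mulr_ge0 ?subr_ge0 ?exprn_ge0. Qed.

Definition PsiAB (A B : R) : R := - ((A - 1) / B) - ln (B / A) + 1 - 2 / A + B / A ^+ 2.

Lemma PsiE p s l : (0 < p)%N -> (0 < s)%N ->
  Psi p s l = PsiAB (slope1 p s l) (slope2 p s l).
Proof.
move=> p0 s0; rewrite /Psi /derive1n /=.
have -> : derive1 (mixture p s l) = dmixture p s l by apply/funext/derive1_mixture.
rewrite derive1E; case: (is_derive_dmixture p s l 1) => _ ->.
by rewrite dmixture1 ddmixture1.
Qed.

Section Params.
Variables (p s : nat) (hp : (2 < p)%N) (hps : (p <= s)%N).
Let P : R := p%:R.
Let S : R := s%:R.

Lemma p_ge3 : 3 <= P. Proof. by rewrite ler_nat. Qed.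
Lemma s_gep : P <= S. Proof. by rewrite ler_nat. Qed.

Lemma p_gt0 : (0 < p)%N. Proof. exact: ltnW (ltnW hp). Qed.
Lemma s_gt0 : (0 < s)%N. Proof. exact: leq_trans p_gt0 hps. Qed.

Lemma slope1_ge3 l : 0 <= l <= 1 -> 3 <= slope1 p s l.
Proof.
move=> /andP[l0 l1]; have := p_ge3; have := s_gep; rewrite /slope1 -/P -/S => h1 h2.
have : 0 <= l * (P - 3) by rewrite mulr_ge0; lra.
have : 0 <= (1 - l) * (S - 3) by rewrite mulr_ge0; lra.
lra.
Qed.

Lemma slope2_ge l : 0 <= l <= 1 -> 2 * slope1 p s l <= slope2 p s l.
Proof.
move=> /andP[l0 l1]; have := p_ge3; have := s_gep; rewrite /slope1 /slope2 -/P -/S => h1 h2.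
have : 0 <= l * (P * (P - 3)) by rewrite !mulr_ge0; lra.
have : 0 <= (1 - l) * (S * (S - 3)) by rewrite !mulr_ge0; lra.
lra.
Qed.

(** The sign of [Qpoly] rules both the variation of [Psi] in lambda and the
    convexity of x / xi'(x) in x; a quadratic form displays the second role,
    because lambda and x then enter through the ratio of X and Y only. *)
Definition qform (X Y : R) : R :=
  (P - 2) * (P - 1) * X ^+ 2 + (S - 2) * (S - 1) * Y ^+ 2 +
  (4 * (P - 2) * (S - 2) - (P - 2) ^+ 2 - (S - 2) ^+ 2 + (P - 2) + (S - 2)) * X * Y.

Lemma QpolyE l : Qpoly p s l = qform (P * l) (S * (1 - l)).
Proof. by rewrite /Qpoly /qform -/P -/S; ring. Qed.

Lemma is_derive_PsiAB l : 0 <= l <= 1 ->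
  is_derive l 1 (fun l => PsiAB (slope1 p s l) (slope2 p s l))
   ((S - P) * (slope2 p s l - slope1 p s l) /
     (slope1 p s l ^+ 3 * slope2 p s l ^+ 2) * Qpoly p s l).
Proof.
move=> l01; have A3 := slope1_ge3 l01; have B2 := slope2_ge l01.
have A0 : slope1 p s l != 0 by lra.
have B0 : slope2 p s l != 0 by lra.
have BA : 0 < slope2 p s l / slope1 p s l by rewrite divr_gt0; lra.
have dA : is_derive l 1 (slope1 p s) (P - S).
  have -> : slope1 p s = (fun y => S + (P - S) * y).
    by apply/funext => x; rewrite /slope1 -/P -/S; ring.
  exact: is_derive_affine.
have dB : is_derive l 1 (slope2 p s) (P * (P - 1) - S * (S - 1)).
  have -> : slope2 p s = (fun y => S * (S - 1) + (P * (P - 1) - S * (S - 1)) * y).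
    by apply/funext => x; rewrite /slope2 -/P -/S; ring.
  exact: is_derive_affine.
pose A := slope1 p s; pose B := slope2 p s.
have dA' : is_derive l 1 (fun y : R => (A y)^-1) (- (A l) ^- 2 * (P - S)).
  exact: (is_deriveV A0 dA).
have dB' : is_derive l 1 (fun y : R => (B y)^-1) (- (B l) ^- 2 * (P * (P - 1) - S * (S - 1))).
  exact: (is_deriveV B0 dB).
have dq : is_derive l 1 (fun y : R => B y / A y)
    (B l * (- (A l) ^- 2 * (P - S)) + (A l)^-1 * (P * (P - 1) - S * (S - 1))).
  exact: (is_deriveM dB dA').
have dln : is_derive l 1 (fun y : R => ln (B y / A y))
    ((B l / A l)^-1 * (B l * (- (A l) ^- 2 * (P - S)) + (A l)^-1 * (P * (P - 1) - S * (S - 1)))).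
  have dl := is_derive1_ln BA.
  exact: (@is_derive1_comp _ (@ln R) (fun y : R => B y / A y) _ _ _ dl dq).
have d1 := is_deriveM (is_deriveB dA (is_derive_cst (1 : R) l 1)) dB'.
have d2 := is_deriveM dB (is_deriveM dA' dA').
have d3 := is_deriveZ 2 dA'.
have -> : (fun l => PsiAB (slope1 p s l) (slope2 p s l)) =
  - ((A - cst 1) * (fun y => (B y)^-1))
  - (fun y => ln (B y / A y)) + cst 1
  - 2 \*: (fun y => (A y)^-1)
  + B * ((fun y => (A y)^-1) * (fun y => (A y)^-1)).
  by apply/funext => x; rewrite /PsiAB expr2 invfM.
apply: (is_derive_eq (is_deriveD (is_deriveB (is_deriveD (is_deriveB
  (is_deriveN d1) dln) (is_derive_cst (1 : R) l 1)) d3) d2)).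
have -> : Qpoly p s l = S * P * slope1 p s l ^+ 2 - (S + P - 1) * slope1 p s l ^+ 2
   - (S + P - 1) * slope1 p s l * slope2 p s l + 2 * slope2 p s l ^+ 2.
  by rewrite /Qpoly /slope1 /slope2 -/P -/S; ring.
have BE : B l = (S + P - 1) * A l - S * P.
  by rewrite /A /B /slope1 /slope2 -/P -/S; ring.
change ((slope1 p s - cst 1) l) with (A l - 1); rewrite /GRing.scale /=.
change (((fun y => (A y)^-1) * (fun y => (A y)^-1)) l) with ((A l)^-1 * (A l)^-1).
rewrite -/(A l) -/(B l) in A0 B0 *.
have -> : P * (P - 1) - S * (S - 1) = (P - S) * (S + P - 1) by ring.
move: (A l) (B l) A0 B0 BE => a' b' A0 B0 BE.
apply/eqP; rewrite -subr_eq0; apply/eqP.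
transitivity ((b' - a') * (P - S) / (a' * b' ^+ 2) * (b' - ((S + P - 1) * a' - S * P))).
  by field; rewrite A0 B0.
by rewrite [X in _ * (X - _)]BE subrr mulr0.
Qed.

End Params.
End Slopes.

(** * The sign of Psi and the roots of Q *)

Section PsiSign.
Context {R : realType}.
Implicit Types (x l z : R).

(** The difference of the two sides has derivative (w - 1)^2 / (w (w + 1)^2). *)
Lemma ln_lower_bound (w : R) : 1 < w -> 2 * (w - 1) / (w + 1) < ln w.
Proof.
move=> w1.
pose g (x : R) := ln x + (-2 + 4 * (1 + 1 * x)^-1).
pose dg (x : R) := x^-1 + 4 * (- (1 + 1 * x) ^- 2 * 1).
have gE (x : R) : 1 <= x -> is_derive x 1 g (dg x).
  move=> x1; have x0 : 0 < x by lra.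
  have nz : (1 : R) + 1 * x != 0 by lra.
  have d := is_deriveV (f := fun y : R => 1 + 1 * y) nz (is_derive_affine 1 1 x).
  have d4 := is_deriveD (is_derive_cst (-2 : R) x 1) (is_deriveZ 4 d).
  by have := is_deriveD (is_derive1_ln x0) d4; rewrite add0r.
have gc : {within `[1, w], continuous g}.
  apply: derivable_within_continuous => x; rewrite in_itv /= => /andP[x1 _].
  by case: (gE x x1).
have [c /[!in_itv]/= /andP[c1 cw] E] : exists2 c, c \in `]1, w[%R & g w - g 1 = dg c * (w - 1).
  by apply: MVT => // x; rewrite in_itv /= => /andP[x1 _]; exact/gE/ltW.
have dgc : 0 < dg c.
  have c0 : c != 0 by lra.
  have c2 : 1 + c != 0 by lra.
  have -> : dg c = (c - 1) ^+ 2 / (c * (1 + 1 * c) ^+ 2).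
    by rewrite /dg; field; rewrite c0 c2.
  apply: divr_gt0; [apply: exprn_gt0|apply: mulr_gt0; last apply: exprn_gt0]; lra.
have : 0 < g w - g 1 by rewrite E mulr_gt0 // subr_gt0.
rewrite /g ln1 subr_gt0 => H.
have w2 : w + 1 != 0 by lra.
have -> : 2 * (w - 1) / (w + 1) = 2 - 4 * (1 + 1 * w)^-1.
  by rewrite mul1r [1 + w]addrC; field.
have E4 : 4 * (1 + 1 * 1)^-1 = 2 :> R by field.
rewrite E4 in H; move: H; move: (ln w) ((1 + 1 * w)^-1) => *; lra.
Qed.

(** The integral over [0, 1] of x / (1 + z (1 - x)). *)
Definition pmass z : R := ((1 + z) * ln (1 + z) - z) / z ^+ 2.

(** The meaning of [Psi]: its sign tells on which side of 1 the number A * pmass y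
    lies, y = B / A - 1 being the logarithmic derivative of x |-> xi'(x) / x at
    1. *)
Lemma PsiAB_pmass (A B : R) : 0 < A -> A < B ->
  PsiAB A B = (1 - A * pmass (B / A - 1)) * ((B / A - 1) ^+ 2 / (A * (B / A))).
Proof.
move=> A0 AB; rewrite /PsiAB /pmass; have -> : 1 + (B / A - 1) = B / A by ring.
move: (ln _) => L; have B0 : B != 0 by lra.
have BA : B - A != 0 by lra.
have An : A != 0 by lra.
have E : B / A - 1 = (B - A) / A by field.
by rewrite E; field; rewrite An B0 BA.
Qed.

Section Params.
Variables (p s : nat) (hp : (2 < p)%N) (hps : (p <= s)%N).
Let P : R := p%:R.
Let S : R := s%:R.
Let P3 : 3 <= P. Proof. exact: p_ge3. Qed.
Let PS : P <= S. Proof. exact: s_gep. Qed.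
Let Q := Qpoly p s : R -> R.
Let psi l : R := PsiAB (slope1 p s l) (slope2 p s l).

Definition lead_Q : R := (S - P) ^+ 2 * (S ^+ 2 - 3 * S + 2 + P ^+ 2 + 3 * P * S - 3 * P).

Lemma lead_Q_gt0 : P < S -> 0 < lead_Q.
Proof.
have p3 := P3; have ps := PS.
move=> lt; rewrite /lead_Q.
have -> : S ^+ 2 - 3 * S + 2 + P ^+ 2 + 3 * P * S - 3 * P =
  (S - 1) * (S - 2) + (P * P + 3 * P * (S - 1)) by ring.
apply: mulr_gt0; first by rewrite exprn_gt0 // subr_gt0.
have ? : 0 < (S - 1) * (S - 2) by rewrite mulr_gt0; lra.
have ? : 0 < P * P by rewrite mulr_gt0; lra.
have ? : 0 < 3 * P * (S - 1) by rewrite !mulr_gt0; lra.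
by rewrite !addr_gt0.
Qed.

Lemma Delta_gt0_lt : 0 < Delta R p s -> P < S.
Proof.
have p3 := P3; have ps := PS.
move=> D0; rewrite lt_neqAle ps andbT; apply/eqP => E; move: D0.
have ? : 0 <= P * (P - 3) by rewrite mulr_ge0; lra.
by rewrite /Delta -/P -/S -E; lra.
Qed.

(** Completing the square: the discriminant is Delta times a square, so that the
    roots lie in the quadratic field of the square root of Delta. *)
Lemma Qpoly_discr l : 4 * lead_Q * Q l =
  (2 * lead_Q * l - S * (S - P) * (2 * S ^+ 2 - 6 * S + 4 - P ^+ 2 + 3 * P * S - 3 * P)) ^+ 2
  - (S * P * (S - P)) ^+ 2 * Delta R p s.
Proof. by rewrite /lead_Q /Q /Qpoly /Delta -/P -/S; ring. Qed.

Lemma Qpoly_ge0 l : Delta R p s <= 0 -> 0 <= Q l.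
Proof.
have p3 := P3; have ps := PS.
move=> D0; move: (PS); rewrite le_eqVlt => /orP[/eqP E|lt].
  have -> : Q l = S ^+ 2 * (S - 1) * (S - 2) by rewrite /Q /Qpoly -/P -/S E; ring.
  by rewrite !mulr_ge0 ?exprn_ge0; lra.
have a0 := lead_Q_gt0 lt.
have : 0 <= 4 * lead_Q * Q l.
  rewrite Qpoly_discr addr_ge0 ?sqr_ge0 // oppr_ge0 mulr_ge0_le0 //; exact: sqr_ge0.
by rewrite pmulr_rge0 // mulr_gt0.
Qed.

Section Roots.
Variables (l1 l2 : R) (hroots : ordered_roots p s l1 l2) (D0 : 0 < Delta R p s).

Lemma Qpoly_factor l : Q l = lead_Q * (l - l1) * (l - l2).
Proof.
have p3 := P3; have ps := PS.
have [l12 Q1 Q2] := hroots.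
have [c0 [c1 E]] : exists c0 c1 : R, forall x, Q x = lead_Q * x ^+ 2 + c1 * x + c0.
  exists (S ^+ 2 * (S - 1) * (S - 2)).
  exists (- (S * (S - P) * (2 * S ^+ 2 - 6 * S + 4 - P ^+ 2 + 3 * P * S - 3 * P))).
  by move=> x; rewrite /lead_Q /Q /Qpoly -/P -/S; ring.
move: Q1 Q2; rewrite -!/(Q _) !E => Q1 Q2.
have c1E : c1 = - lead_Q * (l1 + l2).
  apply: (mulIf (_ : l2 - l1 != 0)); first by rewrite subr_eq0 gt_eqF.
  apply/eqP; rewrite -subr_eq0; apply/eqP.
  transitivity ((lead_Q * l2 ^+ 2 + c1 * l2 + c0) - (lead_Q * l1 ^+ 2 + c1 * l1 + c0)); first by ring.
  by rewrite Q1 Q2 subrr.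
have c0E : c0 = - lead_Q * l1 ^+ 2 - c1 * l1 by rewrite -[LHS]subr0 -Q1; ring.
by rewrite c0E c1E; ring.
Qed.

(** When Delta > 0 the coefficient of X Y in [qform] is negative, and the two others
    are positive; hence X Y > 0 at a root. *)
Lemma root_in01 l : Q l = 0 -> 0 < l < 1.
Proof.
have p3 := P3; have ps := PS.
rewrite /Q QpolyE // /qform -/P -/S => Ql.
have Dl : 0 < Delta R p s := D0; rewrite /Delta -/P -/S in Dl.
set K := (4 * _ * _ - _ - _ + _ + _) in Ql.
have K0 : K < 0.
  have ? : 0 <= (P - 3) * (S - 3) by rewrite mulr_ge0; lra.
  rewrite /K; lra.
have a0 : 0 < (P - 2) * (P - 1) by rewrite mulr_gt0; lra.
have b0 : 0 < (S - 2) * (S - 1) by rewrite mulr_gt0; lra.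
set X := P * l in Ql *; set Y := S * (1 - l) in Ql *.
have hX : 0 <= (P - 2) * (P - 1) * X ^+ 2 by rewrite mulr_ge0 ?sqr_ge0 ?ltW.
have hY : 0 <= (S - 2) * (S - 1) * Y ^+ 2 by rewrite mulr_ge0 ?sqr_ge0 ?ltW.
have XY : 0 < X * Y.
  rewrite ltNge; apply/negP => XY.
  have h : 0 <= K * X * Y by rewrite -mulrA mulr_le0 // ltW.
  have X0 : (P - 2) * (P - 1) * X ^+ 2 = 0.
    move: hX hY h Ql; move: (_ * X ^+ 2) (_ * Y ^+ 2) (K * X * Y) => *; lra.
  have Y0 : (S - 2) * (S - 1) * Y ^+ 2 = 0.
    move: hX hY h Ql; move: (_ * X ^+ 2) (_ * Y ^+ 2) (K * X * Y) => *; lra.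
  have {}X0 : P * l = 0.
    by apply/eqP; move/eqP: X0; rewrite mulf_eq0 gt_eqF //= sqrf_eq0.
  have {}Y0 : S * (1 - l) = 0.
    by apply/eqP; move/eqP: Y0; rewrite mulf_eq0 gt_eqF //= sqrf_eq0.
  move/eqP: X0; rewrite mulf_eq0 => /orP[/eqP|/eqP] h1; first by lra.
  move/eqP: Y0; rewrite mulf_eq0 => /orP[/eqP|/eqP] h2; lra.
have : 0 < l * (1 - l).
  have PS0 : 0 < P * S by rewrite mulr_gt0; lra.
  by rewrite -(pmulr_rgt0 _ PS0); move: XY; rewrite /X /Y mulrACA.
have [l0|l0] := ltP 0 l; first by rewrite pmulr_rgt0 // subr_gt0.
by rewrite ltNge mulr_le0_ge0 //; lra.
Qed.
End Roots.

Let dpsi l : R := (S - P) * (slope2 p s l - slope1 p s l) /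
  (slope1 p s l ^+ 3 * slope2 p s l ^+ 2) * Q l.

Let dpsi_sign l : 0 <= l <= 1 -> (0 <= Q l -> 0 <= dpsi l) /\ (Q l <= 0 -> dpsi l <= 0).
Proof.
have p3 := P3; have ps := PS => l01.
have A3 := slope1_ge3 hp hps l01; have B2 := slope2_ge hp hps l01.
have c0 : 0 <= (S - P) * (slope2 p s l - slope1 p s l) /
    (slope1 p s l ^+ 3 * slope2 p s l ^+ 2).
  rewrite divr_ge0 //; first by rewrite mulr_ge0; lra.
  by rewrite mulr_ge0 // exprn_ge0; lra.
by split=> Ql; [exact: mulr_ge0|exact: mulr_ge0_le0].
Qed.

Lemma psi_ndecr u v : 0 <= u -> u <= v -> v <= 1 ->
  (forall x, u < x < v -> 0 <= Q x) -> psi u <= psi v.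
Proof.
move=> u0 uv v1 Qp.
have in01 x : u <= x <= v -> 0 <= x <= 1.
  by move=> /andP[ux xv]; rewrite (le_trans u0 ux) (le_trans xv v1).
have d x : u <= x <= v -> is_derive x 1 psi (dpsi x).
  by move=> /in01; exact: is_derive_PsiAB.
apply: (derive_ge0_le uv (df := dpsi)); last exact: within_of_derive d.
- by move=> x /andP[ux xv]; apply: d; rewrite !ltW.
- move=> x uxv; apply: (dpsi_sign (in01 x _)).1; last exact: Qp.
  by case/andP: uxv => ? ?; rewrite !ltW.
Qed.

Lemma psi_nincr u v : 0 <= u -> u <= v -> v <= 1 ->
  (forall x, u < x < v -> Q x <= 0) -> psi v <= psi u.
Proof.
move=> u0 uv v1 Qn.
have in01 x : u <= x <= v -> 0 <= x <= 1.
  by move=> /andP[ux xv]; rewrite (le_trans u0 ux) (le_trans xv v1).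
have d x : u <= x <= v -> is_derive x 1 psi (dpsi x).
  by move=> /in01; exact: is_derive_PsiAB.
apply: (derive_le0_ge uv (df := dpsi)); last exact: within_of_derive d.
- by move=> x /andP[ux xv]; apply: d; rewrite !ltW.
- move=> x uxv; apply: (dpsi_sign (in01 x _)).2; last exact: Qn.
  by case/andP: uxv => ? ?; rewrite !ltW.
Qed.

(** At lambda = 1, that is for the pure p-spin model, the claim is the logarithmic
    inequality at p - 1. *)
Lemma psi1_lt0 : psi 1 < 0.
Proof.
have p3 := P3; have ps := PS.
have P1 : 1 < P - 1 by lra.
have := ln_lower_bound P1; rewrite /psi /PsiAB /slope1 /slope2 -/P -/S.
rewrite subrr !mul0r !addr0 !mul1r.
have P0 : P != 0 by lra.
have P10 : P - 1 != 0 by lra.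
have -> : P * (P - 1) / P = P - 1 by field.
have -> : P * (P - 1) / P ^+ 2 = (P - 1) / P by field.
have -> : (P - 1) / (P * (P - 1)) = P^-1 by field; rewrite P0 P10.
have -> : 2 * (P - 1 - 1) / (P - 1 + 1) = 2 - 4 / P by field.
have -> : (P - 1) / P = 1 - P^-1 by field.
move: (ln _) (P^-1) => *; lra.
Qed.

(** [Psi] increases where Q >= 0 and decreases between the roots of Q, so its values
    on [0, 1] lie below its value at the first root or below its value at 1. *)
Lemma psi_lt0 l : 0 <= l <= 1 ->
  (Delta R p s <= 0 \/ (0 < Delta R p s /\
    exists l1 l2 : R, ordered_roots p s l1 l2 /\ Psi p s l1 < 0)) ->
  psi l < 0.
Proof.
have p3 := P3; have ps := PS.
move=> /andP[l0 l1] [D|[D [r1 [r2 [rs Pr]]]]].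
  apply: le_lt_trans psi1_lt0; apply: psi_ndecr => // x _; exact: Qpoly_ge0.
have a0 := lead_Q_gt0 (Delta_gt0_lt D).
have [r12 Q1 Q2] := rs.
have /andP[r10 r11] := root_in01 D Q1; have /andP[r20 r21] := root_in01 D Q2.
rewrite PsiE ?(p_gt0 hp) ?(s_gt0 hp hps) // in Pr.
have [lr|rl] := leP l r1.
  apply: le_lt_trans Pr; apply: psi_ndecr => //; rewrite ?(ltW r11) // => x /andP[lx xr].
  rewrite (Qpoly_factor rs) -mulrA mulr_ge0 ?(ltW a0) // mulr_le0 // subr_le0 ltW //.
  exact: lt_trans r12.
have [lr2|rl2] := leP l r2.
  apply: le_lt_trans Pr; apply: psi_nincr => //; rewrite ?(ltW rl) ?(ltW r10) // => x /andP[lx xr].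
  rewrite (Qpoly_factor rs) mulr_ge0_le0 //.
    by rewrite mulr_ge0 ?(ltW a0) // subr_ge0 ltW // (lt_trans rl).
  by rewrite subr_le0 (ltW (lt_le_trans xr lr2)).
apply: le_lt_trans psi1_lt0; apply: psi_ndecr => //.
move=> x /andP[lx xr].
have r2x := lt_trans rl2 lx; have r1x := lt_trans r12 r2x.
rewrite (Qpoly_factor rs). by apply: mulr_ge0; first apply: mulr_ge0; rewrite ?subr_ge0 ltW.
Qed.

End Params.
End PsiSign.

Lemma exists_ordered_roots (R : realType) (p s : nat) : (2 < p)%N -> (p <= s)%N ->
  0 < Delta R p s -> exists l1 l2 : R, ordered_roots p s l1 l2.
Proof.
move=> hp hps D0; have PS := Delta_gt0_lt hp hps D0.
have L0 := lead_Q_gt0 hp hps PS.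
have P0 : 0 < p%:R :> R by rewrite ltr0n (p_gt0 hp).
have S0 := lt_trans P0 PS.
pose S : R := s%:R; pose P : R := p%:R; pose q := Num.sqrt (Delta R p s).
have q0 : 0 < q by rewrite sqrtr_gt0.
have q2 : q ^+ 2 = Delta R p s by rewrite sqr_sqrtr // ltW.
pose c := S * (S - P) * (2 * S ^+ 2 - 6 * S + 4 - P ^+ 2 + 3 * P * S - 3 * P).
pose e := S * P * (S - P) * q.
have e0 : 0 < e by rewrite !mulr_gt0 // subr_gt0.
have root t : t ^+ 2 = e ^+ 2 -> Qpoly p s ((c + t) / (2 * lead_Q p s)) = 0.
  move=> te; have := Qpoly_discr p s ((c + t) / (2 * lead_Q p s)).
  have -> : 2 * lead_Q p s * ((c + t) / (2 * lead_Q p s)) = c + t.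
    by field; rewrite gt_eqF.
  rewrite -/S -/P -/c (addrC c) addrK te -q2 /e [in X in _ = X]exprMn subrr => /eqP.
  have n0 : 4 * lead_Q p s != 0 :> R by rewrite gt_eqF // mulr_gt0.
  by rewrite mulf_eq0 (negbTE n0) /= => /eqP.
exists ((c + - e) / (2 * lead_Q p s)), ((c + e) / (2 * lead_Q p s)); split.
- have n0 : 0 < (2 * lead_Q p s : R)^-1 by rewrite invr_gt0 mulr_gt0.
  by rewrite (ltr_pM2r n0) (ltrD2l c) gtrN.
- by apply: root; rewrite sqrrN.
- exact: root.
Qed.

(** * Profiles of one-step measures *)

Section OneStep.
Context {R : realType}.
Implicit Types (x z : R).

(** A primitive of x / (1 + z (1 - x)). *)
Definition pprim z x : R := - (x / z) - (1 + z) / z ^+ 2 * ln (1 + z * (1 - x)).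

Lemma pprim_pmass z : z != 0 -> pprim z 1 - pprim z 0 = pmass z.
Proof.
move=> z0; rewrite /pprim /pmass subrr mulr0 addr0 ln1 subr0 mulr1.
by move: (ln _) => L; field.
Qed.

Lemma is_derive_pprim z x : z != 0 -> 0 < 1 + z * (1 - x) ->
  is_derive x 1 (pprim z) (x / (1 + z * (1 - x))).
Proof.
move=> z0 h.
have d0 := is_derive_affine (1 + z) (- z) x.
have h' : 0 < 1 + z + - z * x by move: h; rewrite mulrBr mulr1 addrA mulNr.
have dl := @is_derive1_comp _ (@ln R) (fun y => 1 + z + - z * y) x _ _ (is_derive1_ln h') d0.
have d1 := is_derive_affine 0 (- z^-1) x.
have d2 := is_deriveB d1 (is_deriveZ ((1 + z) / z ^+ 2) dl).
have -> : pprim z = (fun y => 0 + - z^-1 * y) -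
    ((1 + z) / z ^+ 2) \*: (@ln R \o (fun y => 1 + z + - z * y)).
  apply/funext => y.
  change (pprim z y = (0 + - z^-1 * y) - ((1 + z) / z ^+ 2) * ln (1 + z + - z * y)).
  rewrite /pprim.
  have -> : 1 + z * (1 - y) = 1 + z + - z * y by ring.
  by congr (_ - _); ring.
apply: (is_derive_eq d2); rewrite /GRing.scale /=.
have h0 : 1 + z + - z * x != 0 by rewrite gt_eqF.
have -> : 1 + z * (1 - x) = 1 + z + - z * x by ring.
set D := 1 + z + - z * x in h0 *.
have -> : x = (1 + z - D) / z by rewrite /D; field.
by clearbody D; field; rewrite z0 h0.
Qed.

Lemma den_gt0 z x : 0 <= z -> 0 <= x <= 1 -> 0 < 1 + z * (1 - x).
Proof. by move=> z0 /andP[_ x1]; rewrite ltr_wpDr // mulr_ge0 // subr_ge0. Qed.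

Lemma pmass_anti (y z : R) : 0 < y -> y <= z -> pmass z <= pmass y.
Proof.
move=> y0 yz; have z0 := lt_le_trans y0 yz.
rewrite -!pprim_pmass ?gt_eqF //.
have d (x : R) : 0 <= x <= 1 -> is_derive x 1 (pprim y - pprim z)
    (x / (1 + y * (1 - x)) - x / (1 + z * (1 - x))).
  move=> x01; apply: is_deriveB; apply: is_derive_pprim; rewrite ?gt_eqF //;
    by apply: den_gt0 => //; exact: ltW.
have : (pprim y - pprim z) 0 <= (pprim y - pprim z) 1.
  apply: (derive_ge0_le ler01 (df := fun x => x / (1 + y * (1 - x)) - x / (1 + z * (1 - x)))).
  - by move=> x /andP[x0 x1]; apply: d; rewrite !ltW.
  - move=> x /andP[x0 x1]; have x01 : 0 <= x <= 1 by rewrite !ltW.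
    rewrite subr_ge0 ler_pM2l // lef_pV2 ?posrE ?den_gt0 ?(ltW y0) ?(ltW z0) //.
    by rewrite lerD2l ler_wpM2r // subr_ge0 ltW.
  - exact: within_of_derive d.
change (pprim y 0 - pprim z 0 <= pprim y 1 - pprim z 1 ->
  pprim z 1 - pprim z 0 <= pprim y 1 - pprim y 0).
move: (pprim y 0) (pprim z 0) (pprim y 1) (pprim z 1) => a b c e; lra.
Qed.

(** [pmass] tends to 0 fast enough for K pmass z to be at most 1 at a z that is
    polynomial in K; z + 1 is taken as a square q^2, so that the bound
    ln q < q suffices. *)
Lemma pmass_small (K : R) : 0 < K -> exists2 z, K <= z & K * pmass z <= 1.
Proof.
move=> K0; pose q := 8 * K + 2; have q2 : 2 <= q by rewrite /q; lra.
exists (q ^+ 2 - 1).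
  have : 0 <= q * (q - 2) by rewrite mulr_ge0; lra.
  by rewrite /q expr2; lra.
rewrite /pmass; have -> : 1 + (q ^+ 2 - 1) = q ^+ 2 by ring.
have q0 : 0 < q by lra.
have lq := ln_sublinear q0.
have l0 : 0 <= ln q by apply: ln_ge0; lra.
rewrite lnXn // -mulr_natl.
have qq : 2 * q <= q ^+ 2 by rewrite expr2 ler_pM2r.
have z0 : 0 < q ^+ 2 - 1 by lra.
rewrite mulrA ler_pdivrMr ?exprn_gt0 // mul1r.
apply: (@le_trans _ _ (K * (q ^+ 2 * (2 * q)))).
  rewrite ler_pM2l // lerBlDr; apply: (@le_trans _ _ (q ^+ 2 * (2 * q))); last by lra.
  by rewrite ler_pM2l ?exprn_gt0 // ler_pM2l // ltW.
apply: (@le_trans _ _ ((q ^+ 2 / 2) ^+ 2)); last first.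
  by apply: lerXn2r; rewrite ?nnegrE; lra.
have -> : (q ^+ 2 / 2) ^+ 2 = q ^+ 2 * (q * (q / 4)) by field.
rewrite mulrCA ler_pM2l ?exprn_gt0 //.
have -> : K * (2 * q) = q * (2 * K) by ring.
by rewrite ler_pM2l // /q; lra.
Qed.

Lemma pmass_continuous (u v : R) : 0 < u -> {within `[u, v], continuous (pmass : R -> R)}.
Proof.
move=> u0; apply: derivable_within_continuous => z; rewrite in_itv /= => /andP[uz _].
have z0 : 0 < z := lt_le_trans u0 uz.
have d0 := is_derive_affine 1 1 z.
have h' : 0 < 1 + 1 * z by lra.
have dl := @is_derive1_comp _ (@ln R) (fun y => 1 + 1 * y) z _ _ (is_derive1_ln h') d0.
have dn := is_deriveB (is_deriveM d0 dl) (is_derive_id z 1).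
have zn : (id * id : R -> R) z != 0 by rewrite mulf_neq0 // gt_eqF.
have dd := is_deriveV zn (is_deriveM (is_derive_id z 1) (is_derive_id z 1)).
have -> : pmass = ((fun y => 1 + 1 * y) * (@ln R \o (fun y => 1 + 1 * y)) - id) *
    (fun y => ((id * id : R -> R) y)^-1).
  apply/funext => y.
  change (pmass y = ((1 + 1 * y) * ln (1 + 1 * y) - y) * (y * y)^-1).
  by rewrite /pmass expr2 mul1r.
by case: (is_deriveM dn dd).
Qed.

Lemma pmass_onto (A y : R) : 0 < A -> 0 < y -> 1 < A * pmass y ->
  exists2 z, 0 < z & A * pmass z = 1.
Proof.
move=> A0 y0 Ay; have [z1 zK pmass1] := pmass_small (addr_gt0 A0 y0).
have yz1 : y <= z1 by apply: le_trans zK; rewrite lerDr ltW.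
have Az1 : A * pmass z1 <= 1.
  have [f0|f0] := leP 0 (pmass z1).
    by apply: le_trans pmass1; rewrite ler_wpM2r // lerDl ltW.
  by apply: le_trans ler01; rewrite mulr_ge0_le0 // ltW.
have [z zyz E] : exists2 z, z \in `[y, z1]%R & pmass z = A^-1.
  apply: IVT => //; first exact: pmass_continuous.
  have h1 : A^-1 <= pmass y by rewrite -div1r ler_pdivrMr // mulrC ltW.
  have h2 : pmass z1 <= A^-1 by rewrite -[leRHS]div1r ler_pdivlMr // mulrC.
  by rewrite ge_min h2 orbT le_max h1.
exists z; last by rewrite E divff // gt_eqF.
by move: zyz; rewrite in_itv /= => /andP[yz _]; exact: lt_le_trans yz.
Qed.

Lemma root_exists (v : R) r : (0 < r)%N -> 0 < v <= 1 -> exists2 x, 0 < x <= 1 & x ^+ r = v.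
Proof.
move=> r0 /andP[v0 v1]; exists (v `^ r%:R^-1).
  rewrite powR_gt0 //=.
  have r0' : 0 <= (r%:R : R)^-1 by rewrite invr_ge0.
  have := ge0_ler_powR r0' (x := v) (y := 1); rewrite !nnegrE (ltW v0) ler01 => /(_ isT isT v1).
  by rewrite powR1.
by rewrite -powR_mulrn ?powR_ge0 // -powRrM mulVf ?powRr1 // ?(ltW v0) // pnatr_eq0 -lt0n.
Qed.
End OneStep.

(** * The primal-dual certificate when Psi is negative *)

Section Certificate.
Context {R : realType}.
Implicit Types x : R.
Variables (p s : nat) (hp : (2 < p)%N) (hps : (p <= s)%N).
Let P : R := p%:R.
Let S : R := s%:R.
Variables (l : R) (l01 : 0 <= l <= 1).

(* xi'(x) = x w(x); f = 1 / w is compared with its chords; its second derivative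
   has the sign of [qform] at (X, Y). *)
Let m := (p - 2)%N.
Let n := (s - 2)%N.
Let r := (s - p)%N.
Let X (x : R) := l * P * x ^+ m.
Let Y (x : R) := (1 - l) * S * x ^+ n.
Let w (x : R) := X x + Y x.
Let V (x : R) := (P - 2) * X x + (S - 2) * Y x.
Let xi : R -> R := mixture p s l.
Let A := slope1 p s l.

Let mE : m%:R = P - 2. Proof. by rewrite /m natrB // ltnW. Qed.
Let nE : n%:R = S - 2. Proof. by rewrite /n natrB // (leq_trans _ hps) // ltnW. Qed.

Let is_derive_power (c : R) k (x : R) : x != 0 ->
  is_derive x 1 (fun y : R => c * y ^+ k) (k%:R * (c * x ^+ k) / x).
Proof.
move=> x0; apply: is_derive_eq (is_derive_monomial c k x) _.
case: k => [|k] /=; first by rewrite mulr0n !mul0r mulr0.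
by rewrite exprS; move: (k.+1%:R : R) (x ^+ k) => u v; field.
Qed.

Let is_derive_w x : x != 0 -> is_derive x 1 w (V x / x).
Proof.
move=> x0; have d := is_deriveD (is_derive_power (l * P) m x0) (is_derive_power ((1 - l) * S) n x0).
by apply: (is_derive_eq d); rewrite mE nE -mulrDl.
Qed.

Let X0 x : 0 <= x -> 0 <= X x.
Proof.
case/andP: l01 => l0 l1 x0; have p3 : 3 <= P := p_ge3 hp.
by rewrite /X !mulr_ge0 ?exprn_ge0 //; lra.
Qed.
Let Y0 x : 0 <= x -> 0 <= Y x.
Proof.
case/andP: l01 => l0 l1 x0; have p3 : 3 <= P := p_ge3 hp; have ps : P <= S := s_gep hps.
by rewrite /Y !mulr_ge0 ?exprn_ge0 //; lra.
Qed.

Let w_gt0 x : 0 < x -> 0 < w x.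
Proof.
case/andP: l01 => l0 l1 x0; have p3 : 3 <= P := p_ge3 hp; have ps : P <= S := s_gep hps.
have [l1'|l1'] := ltP l 1.
  by rewrite /w ltr_wpDl ?X0 ?(ltW x0) // /Y !mulr_gt0 ?exprn_gt0 //; lra.
by rewrite /w ltr_wpDr ?Y0 ?(ltW x0) // /X !mulr_gt0 ?exprn_gt0 //; lra.
Qed.

Let V_ge0 x : 0 <= x -> 0 <= V x.
Proof.
have p3 : 3 <= P := p_ge3 hp; have ps : P <= S := s_gep hps.
by move=> x0; rewrite addr_ge0 // mulr_ge0 ?X0 ?Y0 //; lra.
Qed.

Let f (x : R) := (w x)^-1.
Let df (x : R) := - (V x / x) / w x ^+ 2.

Let is_derive_f x : 0 < x -> is_derive x 1 f (df x).
Proof.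
move=> x0; have xn : x != 0 by rewrite gt_eqF.
have wn : w x != 0 by rewrite gt_eqF // w_gt0.
apply: (is_derive_eq (is_deriveV wn (is_derive_w xn))).
by rewrite /GRing.scale /= /df mulrC mulNr mulrN.
Qed.

Let is_derive_df x : 0 < x ->
  is_derive x 1 df (qform p s (X x) (Y x) / (x ^+ 2 * w x ^+ 3)).
Proof.
move=> x0; have xn : x != 0 by rewrite gt_eqF.
have wn : w x != 0 by rewrite gt_eqF // w_gt0.
have dV : is_derive x 1 V (((P - 2) ^+ 2 * X x + (S - 2) ^+ 2 * Y x) / x).
  have d := is_deriveD (is_deriveZ (P - 2) (is_derive_power (l * P) m xn))
     (is_deriveZ (S - 2) (is_derive_power ((1 - l) * S) n xn)).
  by apply: (is_derive_eq d); rewrite /GRing.scale /= mE nE /X /Y; ring.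
have dw := is_derive_w xn.
have du := is_deriveM (is_derive_id x 1) (is_deriveM dw dw).
have un : (id * (w * w) : R -> R) x != 0 by rewrite !mulf_neq0.
have d := is_deriveN (is_deriveM dV (is_deriveV un du)).
have -> : df = - (V * (fun y => ((id * (w * w) : R -> R) y)^-1)).
  apply/funext => y; change (df y = - (V y * (y * (w y * w y))^-1)).
  by rewrite /df expr2 mulNr [in RHS]invfM mulrA.
apply: (is_derive_eq d); rewrite /GRing.scale /= /qform -/P -/S.
change ((id * (w * w) : R -> R) x) with (x * (w x * w x)).
change ((w * w : R -> R) x) with (w x * w x).
have -> : V x = (P - 2) * X x + (S - 2) * Y x by [].
move: wn; rewrite /w; move: (X x) (Y x) => a b wn.
by field; rewrite xn wn.
Qed.

Let df_ndecr u v : 0 < u -> u <= v ->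
  (forall x, u < x < v -> 0 <= qform p s (X x) (Y x)) -> df u <= df v.
Proof.
move=> u0 uv q0; have h x : u <= x -> 0 < x by exact: lt_le_trans.
apply: (derive_ge0_le uv (df := fun x => qform p s (X x) (Y x) / (x ^+ 2 * w x ^+ 3))).
- by move=> x /andP[ux _]; exact/is_derive_df/h/ltW.
- move=> x /[dup] uxv /andP[ux _]; have x0 := h _ (ltW ux).
  by rewrite divr_ge0 ?q0 // mulr_ge0 ?exprn_ge0 ?(ltW x0) // ltW // w_gt0.
- apply: derivable_within_continuous => x; rewrite in_itv /= => /andP[ux _].
  by case: (is_derive_df (h _ ux)).
Qed.

Let df_nincr u v : 0 < u -> u <= v ->
  (forall x, u < x < v -> qform p s (X x) (Y x) <= 0) -> df v <= df u.
Proof.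
move=> u0 uv q0; have h x : u <= x -> 0 < x by exact: lt_le_trans.
apply: (derive_le0_ge uv (df := fun x => qform p s (X x) (Y x) / (x ^+ 2 * w x ^+ 3))).
- by move=> x /andP[ux _]; exact/is_derive_df/h/ltW.
- move=> x /[dup] uxv /andP[ux _]; have x0 := h _ (ltW ux).
  rewrite mulr_le0_ge0 ?q0 // invr_ge0 mulr_ge0 ?exprn_ge0 ?(ltW x0) //.
  exact/ltW/w_gt0.
- apply: derivable_within_continuous => x; rewrite in_itv /= => /andP[ux _].
  by case: (is_derive_df (h _ ux)).
Qed.

(* The rescaled function t |-> xi (x t) is a multiple of the mixture of parameter
   lam x, so every inequality at x is one at 1 for another parameter. *)
Let den x : R := l + (1 - l) * x ^+ r.
Let lam x : R := l / den x.

Let den_pos x : 0 < x -> 0 < den x.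
Proof.
case/andP: l01 => l0 l1 x0; rewrite /den.
have [l1'|l1'] := ltP l 1; first by rewrite ltr_wpDl // mulr_gt0 ?exprn_gt0 // subr_gt0.
by rewrite ltr_wpDr ?mulr_ge0 ?exprn_ge0 ?subr_ge0 ?(ltW x0) // (lt_le_trans ltr01).
Qed.

Let lam01 x : 0 < x -> 0 <= lam x <= 1.
Proof.
move=> x0; case/andP: l01 => l0 l1; have d0 := den_pos x0.
rewrite /lam divr_ge0 ?(ltW d0) //= ler_pdivrMr // mul1r /den lerDl.
by rewrite mulr_ge0 ?exprn_ge0 ?subr_ge0 ?(ltW x0).
Qed.

Let XE x : 0 < x -> X x = (den x * x ^+ m) * (P * lam x).
Proof. by move=> x0; have := den_pos x0 => d0; rewrite /X /lam; field; rewrite gt_eqF. Qed.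

Let YE x : 0 < x -> Y x = (den x * x ^+ m) * (S * (1 - lam x)).
Proof.
move=> x0; have d0 := den_pos x0.
have -> : 1 - lam x = (1 - l) * x ^+ r / den x.
  by rewrite /lam -[1 in LHS](divff (lt0r_neq0 d0)) -mulrBl /den addrC addKr.
have -> : Y x = (1 - l) * S * (x ^+ r * x ^+ m).
  rewrite /Y -exprD; congr (_ * _ ^+ _); rewrite /n /r /m; lia.
by field; rewrite gt_eqF.
Qed.

Let qform_lam x : 0 < x ->
  qform p s (X x) (Y x) = (den x * x ^+ m) ^+ 2 * Qpoly p s (lam x).
Proof.
move=> x0; rewrite XE // YE // QpolyE // /qform -/P -/S.
by move: (den x * _) => t; ring.
Qed.

Let lam_le t x : 0 < x -> (lam x <= t) = (l * (1 - t) <= t * (1 - l) * x ^+ r).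
Proof.
move=> x0; rewrite /lam ler_pdivrMr ?den_pos // -[LHS]subr_ge0.
have -> : t * den x - l = t * (1 - l) * x ^+ r - l * (1 - t) by rewrite /den; ring.
by rewrite subr_ge0.
Qed.

Let lam_ge t x : 0 < x -> (t <= lam x) = (t * (1 - l) * x ^+ r <= l * (1 - t)).
Proof.
move=> x0; rewrite /lam ler_pdivlMr ?den_pos // -[LHS]subr_ge0.
have -> : l - t * den x = l * (1 - t) - t * (1 - l) * x ^+ r by rewrite /den; ring.
by rewrite subr_ge0.
Qed.

Hypothesis cond : Delta R p s <= 0 \/ (0 < Delta R p s /\
    exists l1 l2 : R, ordered_roots p s l1 l2 /\ Psi p s l1 < 0).

Let inflections := exists a b : R,
  [/\ 0 < a, a <= b & b <= 1] /\
  [/\ forall x, 0 < x -> x <= a -> 0 <= qform p s (X x) (Y x),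
      forall x, a < x -> x < b -> qform p s (X x) (Y x) <= 0 &
      forall x, b < x -> x < 1 -> 0 <= qform p s (X x) (Y x)].

(** As x increases, [lam x] decreases, so it crosses the region Q <= 0 between the
    two roots at most once. *)
Lemma inflection_points : inflections.
Proof.
case/andP: (l01) => l0 l1.
have sq x : 0 <= (den x * x ^+ m) ^+ 2 by exact: sqr_ge0.
have noinfl : (forall x, 0 < x -> x <= 1 -> 0 <= Qpoly p s (lam x)) -> inflections.
  move=> Q0; exists 1, 1; split; first by rewrite ltr01 lexx.
  split=> [x x0 x1|x x0|x x0].
  - by rewrite qform_lam // mulr_ge0 // Q0.
  - by rewrite ltNge (ltW x0).
  - by rewrite ltNge (ltW x0).
case: cond => [D|[D [r1 [r2 [rs _]]]]].
  by apply: noinfl => x x0 x1; exact: Qpoly_ge0.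
have a0 := lead_Q_gt0 hp hps (Delta_gt0_lt hp hps D).
have [r12 Q1 Q2] := rs.
have /andP[r10 r11] := root_in01 hp hps D Q1; have /andP[r20 r21] := root_in01 hp hps D Q2.
have QF := Qpoly_factor hp hps rs.
have Qlow x : x <= r1 -> 0 <= Qpoly p s x.
  move=> xr; rewrite QF -mulrA mulr_ge0 ?(ltW a0) // mulr_le0 // subr_le0 //.
  exact: le_trans xr (ltW r12).
have Qmid x : r1 <= x -> x <= r2 -> Qpoly p s x <= 0.
  move=> xr xr2; rewrite QF mulr_ge0_le0 ?subr_le0 //.
  by rewrite mulr_ge0 ?(ltW a0) // subr_ge0.
have Qhigh x : r2 <= x -> 0 <= Qpoly p s x.
  move=> xr; have xr1 := le_trans (ltW r12) xr.
  by rewrite QF; apply: mulr_ge0; first apply: mulr_ge0; rewrite ?subr_ge0 // ltW.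
have [l00|ln0] := eqVneq l 0.
  by apply: noinfl => x x0 x1; apply: Qlow; rewrite /lam l00 mul0r ltW.
have {ln0}lp : 0 < l by rewrite lt_neqAle eq_sym ln0.
have rgt0 : (0 < r)%N.
  by have := Delta_gt0_lt hp hps D; rewrite ltr_nat /r subn_gt0.
have Xr (x y : R) : 0 < x -> x <= y -> x ^+ r <= y ^+ r.
  by move=> x0 xy; apply: lerXn2r => //; rewrite nnegrE ltW // (lt_le_trans x0).
have [r2l|lr2] := leP r2 l.
  apply: noinfl => x x0 x1; apply: Qhigh; rewrite lam_ge //.
  apply: (@le_trans _ _ (r2 * (1 - l) * 1)).
    rewrite ler_wpM2l // ?mulr_ge0 ?subr_ge0 ?(ltW r20) //.
    by rewrite exprn_ile1 // ltW.
  by rewrite -subr_ge0; (have -> : l * (1 - r2) - r2 * (1 - l) * 1 = l - r2 by ring); rewrite subr_ge0.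
have l1' : 0 < 1 - l by rewrite subr_gt0 (lt_trans lr2).
pose v t := l * (1 - t) / (t * (1 - l)).
have v0 t : 0 < t -> t < 1 -> 0 < v t.
  by move=> t0 t1; rewrite /v divr_gt0 ?mulr_gt0 // subr_gt0.
have vle t : 0 < t -> l <= t -> v t <= 1.
  move=> t0 lt; rewrite /v ler_pdivrMr ?mulr_gt0 // mul1r -subr_ge0.
  by (have -> : t * (1 - l) - l * (1 - t) = t - l by ring); rewrite subr_ge0.
have lamle t x y : 0 < t -> 0 < y -> y ^+ r = v t -> y <= x -> lam x <= t.
  move=> t0 y0 yE yx; rewrite lam_le ?(lt_le_trans y0) //.
  rewrite -ler_pdivrMl ?mulr_gt0 // mulrC -/(v t) -yE; exact: Xr.
have lamge t x y : 0 < t -> 0 < x -> y ^+ r = v t -> x <= y -> t <= lam x.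
  move=> t0 x0 yE yx; rewrite lam_ge //.
  rewrite -ler_pdivlMl ?mulr_gt0 // mulrC -/(v t) -yE; exact: Xr.
have [a /andP[a00 a1] aE] := root_exists rgt0 (introT andP (conj (v0 _ r20 r21) (vle _ r20 (ltW lr2)))).
have [b [ab b1 bE]] : exists b, [/\ a <= b, b <= 1 &
    (b = 1 /\ r1 <= l) \/ b ^+ r = v r1].
  have [r1l|lr1] := leP r1 l; first by exists 1; split=> //; left.
  have [b /andP[b0 b1] bE] := root_exists rgt0 (introT andP (conj (v0 _ r10 r11) (vle _ r10 (ltW lr1)))).
  exists b; split=> //; last by right.
  rewrite -(ler_pXn2r rgt0) ?nnegrE ?(ltW a00) ?(ltW b0) // aE bE /v.
  rewrite ler_pdivrMr ?mulr_gt0 // mulrAC ler_pdivlMr ?mulr_gt0 //.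
  rewrite -subr_ge0.
  have -> : l * (1 - r1) * (r2 * (1 - l)) - l * (1 - r2) * (r1 * (1 - l)) =
     (l * (1 - l)) * (r2 - r1) by ring.
  by rewrite mulr_ge0 ?subr_ge0 ?(ltW r12) // mulr_ge0 // ltW.
have b0 := lt_le_trans a00 ab.
exists a, b; split=> //; split.
- by move=> x x0 xa; rewrite qform_lam // mulr_ge0 // Qhigh // (lamge _ _ _ r20 x0 aE xa).
- move=> x /ltW ax /ltW xb; have x0 := lt_le_trans a00 ax.
  rewrite qform_lam // mulr_ge0_le0 // Qmid // ?(lamle _ _ _ r20 a00 aE ax) //.
  case: bE => [[bE r1l]|bE]; last exact: lamge xb.
  rewrite lam_ge //; apply: (@le_trans _ _ (r1 * (1 - l) * 1)).
    rewrite ler_wpM2l // ?mulr_ge0 ?(ltW l1') ?(ltW r10) //.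
    by rewrite exprn_ile1 ?(ltW x0) // (le_trans xb).
  by rewrite -subr_ge0; (have -> : l * (1 - r1) - r1 * (1 - l) * 1 = l - r1 by ring); rewrite subr_ge0.
- move=> x bx x1; have x0 := lt_trans b0 bx.
  rewrite qform_lam // mulr_ge0 // Qlow //.
  case: bE => [[bE r1l]|bE]; last exact: lamle (ltW bx).
  by move: bx; rewrite bE ltNge (ltW x1).
Qed.

Lemma pmass_gt_slope (t : R) : 0 <= t <= 1 ->
  1 < slope1 p s t * pmass (slope2 p s t / slope1 p s t - 1).
Proof.
move=> t01; have A3 := slope1_ge3 hp hps t01; have B2 := slope2_ge hp hps t01.
have := psi_lt0 hp hps t01 cond; rewrite PsiAB_pmass; [|lra|lra].
have A0 : slope1 p s t != 0 by lra.
have y1 : 1 <= slope2 p s t / slope1 p s t - 1.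
  by rewrite lerBrDr ler_pdivlMr; lra.
rewrite pmulr_llt0 ?subr_lt0 //.
apply: divr_gt0; first by apply: exprn_gt0; lra.
by apply: mulr_gt0; [lra|apply: divr_gt0; lra].
Qed.

Let is_derive_xi x : is_derive x 1 xi (x * w x).
Proof.
apply: (is_derive_eq (is_derive_mixture p s l x)); rewrite /w /X /Y -/P -/S /dmixture.
have -> : p.-1 = m.+1 by rewrite /m; lia.
have -> : s.-1 = n.+1 by rewrite /n; lia.
by rewrite !exprS; move: (x ^+ m) (x ^+ n) => u v; ring.
Qed.

Let xi_den x : xi x = den x * x ^+ 2 * x ^+ m.
Proof.
rewrite /xi /mixture /den -mulrA -exprD.
have -> : (2 + m)%N = p by rewrite /m; lia.
have rp : (r + p)%N = s by rewrite /r; lia.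
by rewrite [RHS]mulrDl -mulrA -exprD rp.
Qed.

(** The value of z solves A * pmass z = 1, which has a solution since A * pmass y > 1
    and [pmass] tends to 0.  The inequality is [line_comparison] for f: the line
    L is (1 + z (1 - x)) / A, and b is the point where the concave part of f ends.  The
    tangent of f at b plays for the mixture rescaled by b the part that the slope
    y = B / A - 1 plays in [PsiAB_pmass]; thus Psi < 0 at [lam b] is the
    hypothesis ET b <= 0. *)
Lemma one_step_certificate : exists2 z, 0 < z & A * pmass z = 1 /\
  forall u, 0 <= u <= 1 -> xi u <= A * (pprim z u - pprim z 0).
Proof.
have A3 : 3 <= A := slope1_ge3 hp hps l01.
have B2 : 2 * A <= slope2 p s l := slope2_ge hp hps l01.
have A0 : 0 < A by lra. have An : A != 0 by lra.
have y0 : 0 < slope2 p s l / A - 1.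
  by rewrite subr_gt0 ltr_pdivlMr //; lra.
have [z z0 Az] := pmass_onto A0 y0 (pmass_gt_slope l01).
exists z => //; split => // u u01; rewrite -subr_le0.
have zn : z != 0 by rewrite gt_eqF.
have [a [b [[a0 ab b1] [q1 q2 q3]]]] := inflection_points.
have b0 := lt_le_trans a0 ab; have bn : b != 0 by rewrite gt_eqF.
have wb := w_gt0 b0; have wbn : w b != 0 by rewrite gt_eqF.
have lb := lam01 b0; have db := den_pos b0.
have A3' := slope1_ge3 hp hps lb; have B2' := slope2_ge hp hps lb.
have wbE : w b = den b * b ^+ m * slope1 p s (lam b).
  by rewrite /w XE // YE // /slope1 -/P -/S; ring.
have VbE : V b = den b * b ^+ m * (slope2 p s (lam b) - slope1 p s (lam b)).
  by rewrite /V XE // YE // /slope1 /slope2 -/P -/S; ring.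
pose y := V b / w b.
have c0 : den b * b ^+ m != 0 by rewrite mulf_neq0 ?expf_neq0 // gt_eqF.
have yE : y = slope2 p s (lam b) / slope1 p s (lam b) - 1.
  have A'n : slope1 p s (lam b) != 0 by lra.
  by rewrite /y wbE VbE; move: c0 A'n; move: (slope1 _ _ _) (slope2 _ _ _) (_ * _) => *;
    field; apply/andP.
have yp : 0 < y by rewrite yE subr_gt0 ltr_pdivlMr; lra.
have yn : y != 0 by rewrite gt_eqF.
pose EL (x : R) : R := xi x - A * (pprim z x - pprim z 0).
pose ET (x : R) : R := xi x - b ^+ 2 * w b * (pprim y (x / b) - pprim y 0).
have dEL x : x <= 1 -> is_derive x 1 EL (x * w x - A * (x / (1 + z * (1 - x)))).
  move=> x1; have h : 0 < 1 + z * (1 - x) by rewrite ltr_wpDr // mulr_ge0 ?(ltW z0) // subr_ge0.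
  have d := is_deriveB (is_derive_xi x)
    (is_deriveZ A (is_deriveB (is_derive_pprim zn h) (is_derive_cst (pprim z 0) x 1))).
  by apply: (is_derive_eq d); rewrite subr0.
have dET x : x <= b -> is_derive x 1 ET
    (x * w x - b ^+ 2 * w b * ((x / b) / (1 + y * (1 - x / b)) * b^-1)).
  move=> xb; have h : 0 < 1 + y * (1 - x / b).
    by rewrite ltr_wpDr // mulr_ge0 ?(ltW yp) // subr_ge0 ler_pdivrMr // mul1r.
  have dl := is_derive_affine 0 b^-1 x.
  have xE : 0 + b^-1 * x = x / b by rewrite add0r mulrC.
  have dp : is_derive (0 + b^-1 * x) 1 (pprim y) ((x / b) / (1 + y * (1 - x / b))).
    by rewrite xE; exact: is_derive_pprim.
  have dc := @is_derive1_comp _ (pprim y) (fun v => 0 + b^-1 * v) x _ _ dp dl.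
  have d := is_deriveB (is_derive_xi x)
    (is_deriveZ (b ^+ 2 * w b) (is_deriveB dc (is_derive_cst (pprim y 0) x 1))).
  have -> : ET = xi - (b ^+ 2 * w b) \*: ((pprim y \o (fun v => 0 + b^-1 * v)) - cst (pprim y 0)).
    apply/funext => v.
    change (ET v = xi v - (b ^+ 2 * w b) * (pprim y (0 + b^-1 * v) - pprim y 0)).
    by rewrite add0r mulrC [b^-1 * v]mulrC mulrC.
  by apply: (is_derive_eq d); rewrite subr0.
have w1 : w 1 = A by rewrite /w /X /Y !expr1n !mulr1.
have xi0 : xi 0 = 0 := mixture0 l (p_gt0 hp) (s_gt0 hp hps).
have xi1 : xi 1 = 1 := mixture1 p s l.
apply: (@line_comparison _ f df EL ET a b (z / A)) => //.
- by move=> x x0; rewrite /f invr_gt0 w_gt0.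
- move=> x v x0 xv va; apply: df_ndecr => // t /andP[xt tv].
  by apply: q1; [exact: lt_trans xt|exact: le_trans (ltW tv) va].
- move=> x v ax xv vb; apply: df_nincr => //; first exact: lt_le_trans ax.
  move=> t /andP[xt tv]; apply: q2; [exact: le_lt_trans xt|exact: lt_le_trans vb].
- move=> x v bx xv v1; apply: df_ndecr => //; first exact: lt_le_trans bx.
  move=> t /andP[xt tv]; apply: q3; [exact: le_lt_trans xt|exact: lt_le_trans v1].
- by rewrite divr_ge0 // ltW.
- rewrite /df mulNr oppr_le0 divr_ge0 ?exprn_ge0 ?(ltW wb) //.
  by rewrite divr_ge0 ?V_ge0 // ltW.
- move=> x /andP[x0 x1]; apply: is_derive_eq (dEL x (ltW x1)) _.
  have h : 0 < 1 + z * (1 - x) by rewrite ltr_wpDr // mulr_ge0 ?(ltW z0) // subr_ge0 ltW.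
  rewrite /f invrK w1; congr (_ - _).
  have -> : A^-1 + z / A * (1 - x) = (1 + z * (1 - x)) / A by field.
  by rewrite invfM invrK; move: ((1 + _)^-1) => q; ring.
- apply: derivable_within_continuous => x; rewrite in_itv /= => /andP[_ x1].
  by case: (dEL x x1).
- by rewrite /EL xi0 subrr mulr0 subrr.
- by rewrite /EL xi1 pprim_pmass // Az subrr.
- move=> x /andP[x0 xb]; apply: is_derive_eq (dET x (ltW xb)) _.
  rewrite /f invrK; congr (_ - _).
  have h : 0 < 1 + y * (1 - x / b).
    by rewrite ltr_wpDr // mulr_ge0 ?(ltW yp) // subr_ge0 ler_pdivrMr // mul1r ltW.
  have -> : (w b)^-1 + df b * (x - b) = (1 + y * (1 - x / b)) / w b.
    by rewrite /df /y; move: (V b) (w b) wbn => v' w' w'n; field; rewrite w'n bn.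
  rewrite [RHS](_ : _ = x * w b * (1 + y * (1 - x / b))^-1); last first.
    by rewrite invfM invrK mulrA mulrAC.
  by move: (1 + _) h => t' t0; field; rewrite bn gt_eqF.
- apply: derivable_within_continuous => x; rewrite in_itv /= => /andP[_ x1].
  by case: (dET x x1).
- by rewrite /ET xi0 mul0r subrr mulr0 subrr.
- rewrite /ET divff // pprim_pmass // yE wbE.
  rewrite xi_den.
  have := pmass_gt_slope lb; move: (pmass _) => F hF.
  have -> : den b * b ^+ 2 * b ^+ m - b ^+ 2 * (den b * b ^+ m * slope1 p s (lam b)) * F =
    (den b * b ^+ m * b ^+ 2) * (1 - slope1 p s (lam b) * F) by ring.
  rewrite mulr_ge0_le0 // ?subr_le0 ?(ltW hF) //.
  by rewrite !mulr_ge0 ?exprn_ge0 ?(ltW b0) ?(ltW db).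
Qed.

End Certificate.

(** * Psi does not vanish at a root of Q *)

Section QuadraticField.
Context {R : realType} (D : int) (r : R).
Hypothesis rD : r * r = D%:~R.

(** The field Q(r), as fractions of elements of Z[r] with integer denominators. *)
Definition in_quadf (x : R) : Prop :=
  exists (d : nat) (t t' : R), [/\ (0 < d)%N, zconj r t t' & x = t / d%:R].

Lemma in_quadf_int (c : int) : in_quadf c%:~R.
Proof. by exists 1%N, c%:~R, c%:~R; rewrite divr1; split=> //; exact: zconj_int. Qed.

Lemma in_quadf_nat (c : nat) : in_quadf c%:R.
Proof. by rewrite pmulrn; exact: in_quadf_int. Qed.

Lemma in_quadf_gen : in_quadf r.
Proof.
exists 1%N, r, (- r); split; rewrite ?divr1 //.
by exists 0, 1; rewrite add0r sub0r mul1r.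
Qed.

Lemma in_quadfD x y : in_quadf x -> in_quadf y -> in_quadf (x + y).
Proof.
move=> [d [t [t' [d0 tt' ->]]]] [e [u [u' [e0 uu' ->]]]].
exists (d * e)%N, (t * e%:~R + u * d%:~R), (t' * e%:~R + u' * d%:~R); split.
- by rewrite muln_gt0 d0.
- by apply: zconjD; apply: (zconjM rD) => //; exact: zconj_int.
- have d1 : (d%:R : R) != 0 by rewrite pnatr_eq0 -lt0n.
  have e1 : (e%:R : R) != 0 by rewrite pnatr_eq0 -lt0n.
  by rewrite natrM -!pmulrn; field; rewrite d1 e1.
Qed.

Lemma in_quadfM x y : in_quadf x -> in_quadf y -> in_quadf (x * y).
Proof.
move=> [d [t [t' [d0 tt' ->]]]] [e [u [u' [e0 uu' ->]]]].
exists (d * e)%N, (t * u), (t' * u'); split; [by rewrite muln_gt0 d0|exact: (zconjM rD)|].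
by rewrite natrM invfM mulrACA.
Qed.

Lemma in_quadfN x : in_quadf x -> in_quadf (- x).
Proof. by rewrite -mulN1r; apply: in_quadfM; exact: (in_quadf_int (-1)). Qed.

Lemma in_quadfB x y : in_quadf x -> in_quadf y -> in_quadf (x - y).
Proof. by move=> hx hy; apply: in_quadfD => //; exact: in_quadfN. Qed.

Lemma in_quadfV_int (c : int) : in_quadf (c%:~R)^-1.
Proof.
have pos (k : nat) : in_quadf (k%:R)^-1.
  case: k => [|k]; first by rewrite invr0; exact: (in_quadf_nat 0).
  by exists k.+1, 1, 1; split; [by []|exact: (@zconj_int R r 1)|rewrite div1r].
case: c => k; first by rewrite -pmulrn.
by rewrite NegzE intrN invrN -pmulrn; exact/in_quadfN.
Qed.

Lemma in_quadfV x : in_quadf x -> in_quadf x^-1.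
Proof.
move=> [d [t [t' [d0 [u [v [tE t'E]]] ->]]]].
rewrite invfM invrK; apply: in_quadfM; last exact: in_quadf_nat.
have qt : in_quadf (u%:~R - v%:~R * r).
  by apply: in_quadfB; [|apply: in_quadfM; last exact: in_quadf_gen]; exact: in_quadf_int.
have [t0|tn0] := eqVneq t 0; first by rewrite t0 invr0; exact: (in_quadf_nat 0).
have [t'0|t'n0] := eqVneq t' 0.
  have -> : t = (u * 2)%:~R by rewrite intrM; move: t'0; rewrite t'E tE => h; lra.
  exact: in_quadfV_int.
have tt' : t * t' = (u * u - v * v * D)%:~R by rewrite intrB !intrM -rD tE t'E; ring.
have -> : t^-1 = t' * ((u * u - v * v * D)%:~R)^-1.
  by rewrite -tt' invfM mulrCA divff // mulr1.
by apply: in_quadfM; [rewrite t'E|exact: in_quadfV_int].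
Qed.

Lemma expR_quadf_neq x y : 0 < x -> in_quadf x -> in_quadf y -> expR x != y.
Proof.
move=> x0 [d [t [t' [d0 tt' xE]]]] [e [u [u' [e0 uu' yE]]]].
have d1 : 0 < (d%:R : R) by rewrite ltr0n.
have e1 : 0 < (e%:R : R) by rewrite ltr0n.
have t0 : 0 < t by move: x0; rewrite xE pmulr_lgt0 // invr_gt0.
have := @expR_quadratic_irrational _ _ _ rD (d * e) (t * (e * 2)%N%:~R) (t' * (e * 2)%N%:~R)
   (u * d%:~R) (u' * d%:~R).
rewrite muln_gt0 d0 e0 => /(_ isT).
have -> : 0 < t * (e * 2)%N%:~R by rewrite mulr_gt0 // ltr0z; lia.
have c1 : zconj r (t * (e * 2)%N%:~R) (t' * (e * 2)%N%:~R).
  by apply: (zconjM rD) => //; exact: zconj_int.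
have c2 : zconj r (u * d%:~R) (u' * d%:~R) by apply: (zconjM rD) => //; exact: zconj_int.
move=> /(_ isT c1 c2); rewrite -!pmulrn !natrM.
have -> : t * (e%:R * 2) / (d%:R * e%:R) / 2 = x.
  by rewrite xE; field; rewrite !gt_eqF.
by have -> : u * d%:R / (d%:R * e%:R) = y by rewrite yE; field; rewrite !gt_eqF.
Qed.
End QuadraticField.

Ltac quadf rD := repeat first [assumption | exact: in_quadf_nat
  | apply: (in_quadfV rD) | apply: (in_quadfM rD) | apply: (in_quadfB rD)
  | apply: (in_quadfN rD) | apply: (in_quadfD rD)].

Section PsiRoot.
Context {R : realType}.
Variables (p s : nat) (hp : (2 < p)%N) (hps : (p <= s)%N).
Let P : R := p%:R.
Let S : R := s%:R.

(** A root of [Qpoly] lies in the field of the square root of Delta, hence so do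
    A = xi'(1), B = xi''(1) and, if [Psi] vanished there, ln (B / A).  Then the
    exponential of ln (B / A) > 0 would be in that field, which is excluded.
    The minimality of a one-step measure only yields Psi <= 0; the strict
    inequality comes from here. *)
Lemma Psi_neq0_at_root (l : R) : 0 < Delta R p s -> Qpoly p s l = 0 -> Psi p s l != 0.
Proof.
move=> D0 Ql; have l01 := root_in01 hp hps D0 Ql.
have {}l01 : 0 <= l <= 1 by case/andP: l01 => ? ?; rewrite !ltW.
have p3 : 3 <= P := p_ge3 hp; have PS : P < S := Delta_gt0_lt hp hps D0.
have a0 : 0 < lead_Q p s := lead_Q_gt0 hp hps PS.
pose c := S * (S - P) * (2 * S ^+ 2 - 6 * S + 4 - P ^+ 2 + 3 * P * S - 3 * P).
pose e := S * P * (S - P).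
have e0 : e != 0 by rewrite !mulf_neq0 //; lra.
pose r := (2 * lead_Q p s * l - c) / e.
pose D : int := (s%:Z ^+ 2 - 6 * (p%:Z - 1) * s%:Z + (p%:Z - 1) * (p%:Z + 7)).
have DE : Delta R p s = D%:~R.
  by rewrite /D /Delta !(intrD, intrB, intrM, intrN, rmorphXn) /= -!pmulrn; ring.
have rD : r * r = D%:~R.
  have := Qpoly_discr p s l; rewrite Ql mulr0 -/c -/e => /esym/eqP.
  rewrite subr_eq0 => /eqP E; rewrite -DE.
  apply: (mulfI (expf_neq0 2 e0)); rewrite -E /r -/P -/S -/c.
  by field.
have qn (k : nat) : in_quadf r k%:R := in_quadf_nat r k.
have [qP qS q1 qr] := And4 (qn p) (qn s) (qn 1%N) (in_quadf_gen r).
have ql : in_quadf r l.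
  have -> : l = (c + r * e) / (2 * lead_Q p s) by rewrite /r; field; rewrite gt_eqF.
  by rewrite /c /e /lead_Q !expr2 -/P -/S; quadf rD.
have qs1 : in_quadf r (slope1 p s l).
  by rewrite /slope1; quadf rD.
have qs2 : in_quadf r (slope2 p s l).
  by rewrite /slope2; quadf rD.
have A3 := slope1_ge3 hp hps l01; have B2 := slope2_ge hp hps l01.
have BA : 1 < slope2 p s l / slope1 p s l by rewrite ltr_pdivlMr; lra.
apply/eqP; rewrite PsiE ?(p_gt0 hp) ?(s_gt0 hp hps) //; rewrite /PsiAB => E.
have lnE : ln (slope2 p s l / slope1 p s l) = - ((slope1 p s l - 1) / slope2 p s l)
   + 1 - 2 / slope1 p s l + slope2 p s l / slope1 p s l ^+ 2.
  by move: E; move: (ln _) (_ / slope2 p s l) (2 / _) (_ / _ ^+ 2) => *; lra.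
have qq : in_quadf r (slope2 p s l / slope1 p s l) by quadf rD.
have := @expR_quadf_neq R D r rD _ (slope2 p s l / slope1 p s l) (ln_gt0 BA) _ qq.
rewrite lnK ?posrE ?(lt_trans ltr01 BA) // eqxx => H; suff : false by []; apply: H.
by rewrite lnE expr2; quadf rD.
Qed.
End PsiRoot.

(** * Integration against a measure with a density and an atom at 1 *)

Section Density.
Context {R : realType}.
Notation mu := (@lebesgue_measure R).
Variables (nu : {measure set (measurableTypeR R) -> \bar R}) (g : R -> R) (D : R).
Hypothesis g0 : {in `[0, 1[, forall x, 0 <= g x}.
Hypothesis mg : measurable_fun (`[0%R, 1%R[%classic : set R) g.
Hypothesis D0 : 0 <= D.
Hypothesis nuE : forall A : set R, measurable (A : set (measurableTypeR R)) ->
  nu A = (\int[mu]_(x in A `&` `[0%R, 1%R[) (g x)%:E + D%:E * \d_(1%R : R) A)%E.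

Local Open Scope ereal_scope.
Import HBNNSimple.

Let g0' x : `[0%R, 1%R[%classic x -> 0 <= (g x)%:E.
Proof. by move=> xI; rewrite lee_fin g0. Qed.

Lemma density_indic (E : set R) : measurable E ->
  \int[nu]_x (\1_E x)%:E =
  \int[mu]_(x in `[0%R, 1%R[) ((\1_E x)%:E * (g x)%:E) + D%:E * (\1_E (1%R : R))%:E.
Proof.
move=> mE; rewrite integral_indic // setIT nuE //; congr (_ + _ * _).
rewrite setIC integral_mkcondr; apply: eq_integral => x _.
by rewrite patchE indicE; case: (x \in E); rewrite ?mul1e ?mul0e.
Qed.

Lemma density_nnsfun (h : {nnsfun (measurableTypeR R) >-> R}) :
  \int[nu]_x (h x)%:E =
  \int[mu]_(x in `[0%R, 1%R[) ((h x)%:E * (g x)%:E) + D%:E * (h (1%R : R))%:E.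
Proof.
have mh r : measurable (h @^-1` [set r]) by [].
under [LHS]eq_integral do rewrite fimfunE -fsumEFin//.
rewrite [LHS]ge0_integral_fsum//; last 2 first.
  - by move=> r; exact/measurable_EFinP/measurableT_comp.
  - by move=> n x _; rewrite EFinM nnfun_muleindic_ge0.
under [X in _ = X + _]eq_integral.
  move=> x xD; rewrite fimfunE -fsumEFin// ge0_mule_fsuml; last first.
    by move=> r; rewrite EFinM nnfun_muleindic_ge0.
  over.
rewrite [X in _ = X + _]ge0_integral_fsum//; last 2 first.
  - move=> r; apply: emeasurable_funM; last exact/measurable_EFinP.
    apply: measurable_funTS.
    by apply/measurable_EFinP; do 2 apply/measurableT_comp => //.
  - move=> n x xD; rewrite EFinM mule_ge0//; last exact: g0'.
    by rewrite nnfun_muleindic_ge0.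
have -> : D%:E * (h (1%R : R))%:E = \sum_(y \in range h)
    (D%:E * (y * \1_(h @^-1` [set y]) (1%R : R))%:E).
  rewrite [in LHS]fimfunE -fsumEFin// ge0_mule_fsumr // => r.
  by rewrite EFinM nnfun_muleindic_ge0.
rewrite -fsbig_split //=; apply: eq_fsbigr => r _.
rewrite integralZl_indic_nnsfun//= density_indic //.
have [r0|r0] := leP 0%R r; last first.
  rewrite preimage_nnfun0 // indic0 /= mulr0 mule0.
  by rewrite !integral0_eq ?adde0 ?mule0 // => x _; rewrite ?mulr0 mul0e.
rewrite ge0_muleDr; last 2 first.
  - by apply: integral_ge0 => x xD; rewrite mule_ge0 ?g0' ?lee_fin.
  - by rewrite mule_ge0 ?lee_fin.
congr (_ + _); last by rewrite EFinM muleCA.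
rewrite -ge0_integralZl //.
- by apply: eq_integral => x _; rewrite EFinM muleA.
- apply: emeasurable_funM; last exact/measurable_EFinP.
  by apply/measurable_EFinP/measurable_funTS.
- by move=> x xD; rewrite mule_ge0 ?g0' ?lee_fin.
exact: mh.
Qed.

Lemma density_integral (f : measurableTypeR R -> \bar R) : measurable_fun setT f ->
  (forall x, 0 <= f x) ->
  \int[nu]_x f x =
  \int[mu]_(x in `[0%R, 1%R[) (f x * (g x)%:E) + D%:E * f (1%R : R).
Proof.
move=> mf f0; pose f_ := nnsfun_approx measurableT mf.
have f_cvg x : (f_ n x)%:E @[n --> \oo] --> f x by exact: cvg_nnsfun_approx.
transitivity (limn (fun n => \int[nu]_x (f_ n x)%:E)).
  rewrite -monotone_convergence//=.
  - by apply: eq_integral => x _; apply/esym/cvg_lim.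
  - by move=> n; exact/measurable_EFinP/measurable_funTS.
  - by move=> n x _; rewrite lee_fin.
  - by move=> x _ a b ab; rewrite lee_fin; exact/lefP/nd_nnsfun_approx.
have E1 : \int[mu]_(x in `[0%R, 1%R[) ((f_ n x)%:E * (g x)%:E) @[n --> \oo] -->
    \int[mu]_(x in `[0%R, 1%R[) (f x * (g x)%:E).
  have -> : \int[mu]_(x in `[0%R, 1%R[) (f x * (g x)%:E) =
     \int[mu]_(x in `[0%R, 1%R[) limn (fun n => (f_ n x)%:E * (g x)%:E).
    by apply: eq_integral => x _; apply/esym/cvg_lim => //; apply: cvgeZr.
  apply: cvg_monotone_convergence => //.
  - move=> n; apply: emeasurable_funM; last exact/measurable_EFinP.
    by apply/measurable_EFinP/measurable_funTS.
  - by move=> n x xD; rewrite mule_ge0 ?g0' ?lee_fin.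
  - move=> x xD a b ab; rewrite lee_wpmul2r ?g0' // lee_fin.
    exact/lefP/nd_nnsfun_approx.
have E2 : D%:E * (f_ n (1%R : R))%:E @[n --> \oo] --> D%:E * f (1%R : R).
  by apply: cvgeZl.
apply/cvg_lim => //.
under eq_fun do rewrite density_nnsfun.
apply: cvgeD => //.
rewrite ge0_adde_def // inE.
  by apply: integral_ge0 => x xD; rewrite mule_ge0 // ?g0'.
by rewrite mule_ge0 // lee_fin.
Qed.

Lemma density_integral01 (f : measurableTypeR R -> \bar R) :
  measurable_fun (`[0%R, 1%R]%classic : set R) f -> (forall x, x \in `[0%R, 1%R] -> 0 <= f x) ->
  \int[nu]_(x in `[0%R, 1%R]) f x =
  \int[mu]_(x in `[0%R, 1%R[) (f x * (g x)%:E) + D%:E * f (1%R : R).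
Proof.
move=> mf f0; rewrite integral_mkcond density_integral; last 2 first.
- exact/(measurable_restrictT _ _).1.
- move=> x; rewrite patchE; case: ifPn => // xI; apply: f0.
  by move: xI; rewrite inE.
congr (_ + _ * _); last by rewrite patchE ifT // inE /= in_itv /= ler01 lexx.
apply: eq_integral => x; rewrite inE /= in_itv /= => /andP[x0 x1].
by rewrite patchE ifT // inE /= in_itv /= x0 ltW.
Qed.

End Density.

(** * Tonelli, layer cake, and exchange of tails *)

Section Tonelli.
Context {R : realType}.
Notation mu := (@lebesgue_measure R).
Notation plane := (measurableTypeR R * measurableTypeR R)%type.

Lemma monotone_measurable_itv (i : interval R) (f : R -> R) :
  {in i &, {homo f : x y / x <= y}} -> measurable_fun ([set` i] : set R) f.
Proof.
move=> f_nd; apply: (measurability (@RGenCInfty.G R)) => [|/= _ [_] [r] -> <-].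
  exact: RGenCInfty.measurableE.
apply: is_interval_measurable => s t /= [si fs] [ti ft] x /andP[sx xt].
have xi : x \in i by apply: (interval_is_interval si ti); rewrite sx xt.
split=> //; move: fs; rewrite !in_itv /= !andbT => rs.
exact: le_trans rs (f_nd _ _ si xi sx).
Qed.

Local Open Scope ereal_scope.

(** Tonelli for the product u v restricted to a planar set, written with its
    sections. *)
Lemma tonelli_set (A : set (R * R)) (u v : R -> \bar R) :
  measurable (A : set plane) ->
  measurable_fun setT u -> measurable_fun setT v ->
  (forall x, 0 <= u x) -> (forall x, 0 <= v x) ->
  measurable_fun setT (fun x => \int[mu]_(t in [set t | A (x, t)]) v t) /\
  \int[mu]_x (u x * \int[mu]_(t in [set t | A (x, t)]) v t) =
  \int[mu]_t (v t * \int[mu]_(x in [set x | A (x, t)]) u x).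
Proof.
move=> mA mu' mv u0 v0.
have mAi : measurable_fun setT (fun z : plane => (\1_A z)%:E : \bar R).
  exact/measurable_EFinP/measurable_indic.
have mvs : measurable_fun setT (fun z : plane => v z.2).
  exact: measurableT_comp mv measurable_snd.
have mus : measurable_fun setT (fun z : plane => u z.1).
  exact: measurableT_comp mu' measurable_fst.
have i0 (z : R * R) : 0 <= (\1_A z)%:E :> \bar R by rewrite lee_fin.
have sec (w : R -> \bar R) (B : set R) (F : R -> \bar R) :
   (forall t, F t = w t * (\1_B t)%:E) -> \int[mu]_t F t = \int[mu]_(t in B) w t.
  move=> FE; rewrite [RHS]integral_mkcond; apply: eq_integral => t _.
  by rewrite FE patchE indicE; case: (t \in B); rewrite ?mule1 ?mule0.
have sA (x t : R) : (\1_A (x, t))%:E = (\1_[set t | A (x, t)] t)%:E :> \bar R.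
  rewrite !indicE; have -> // : ((x, t) \in A) = (t \in [set t | A (x, t)]).
  by apply/idP/idP; rewrite !inE.
have sB (x t : R) : (\1_A (x, t))%:E = (\1_[set x | A (x, t)] x)%:E :> \bar R.
  rewrite !indicE; have -> // : ((x, t) \in A) = (x \in [set x | A (x, t)]).
  by apply/idP/idP; rewrite !inE.
split.
  pose f (z : plane) := v z.2 * (\1_A z)%:E.
  have mf : measurable_fun setT f by exact: emeasurable_funM.
  have := @measurable_fun_fubini_tonelli_F _ _ _ _ R mu f mf (fun z => mule_ge0 (v0 _) (i0 _)).
  congr (measurable_fun _ _); apply/funext => x; rewrite /fubini_F.
  by apply: sec => t; rewrite /f /= sA.
pose f (z : plane) := u z.1 * (v z.2 * (\1_A z)%:E).
have mf : measurable_fun setT f.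
  by apply: emeasurable_funM => //; exact: emeasurable_funM.
have f0 z : 0 <= f z by rewrite /f !mule_ge0.
have := @fubini_tonelli _ _ _ _ R mu mu f mf f0.
have mAx (x : R) : measurable_fun setT (fun t : measurableTypeR R => (\1_A (x, t))%:E : \bar R).
  apply: (measurableT_comp mAi); exact: measurable_pair1.
have mAt (t : R) : measurable_fun setT (fun x : measurableTypeR R => (\1_A (x, t))%:E : \bar R).
  apply: (measurableT_comp mAi); exact: measurable_pair2.
have E1 x : \int[mu]_t f (x, t) = u x * \int[mu]_(t in [set t | A (x, t)]) v t.
  rewrite -(sec v [set t | A (x, t)] (fun t => v t * (\1_A (x, t))%:E)) => [|t]; last by rewrite sA.
  exact: (@ge0_integralZl _ (measurableTypeR R) R mu setT measurableT
    (fun t => v t * (\1_A (x, t))%:E) (emeasurable_funM mv (mAx x)) (u x)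
    (fun t _ => mule_ge0 (v0 t) (i0 (x, t))) (u0 x)).
have E2 t : \int[mu]_x f (x, t) = v t * \int[mu]_(x in [set x | A (x, t)]) u x.
  rewrite -(sec u [set x | A (x, t)] (fun x => u x * (\1_A (x, t))%:E)) => [|x]; last by rewrite sB.
  have := (@ge0_integralZl _ (measurableTypeR R) R mu setT measurableT
    (fun x => u x * (\1_A (x, t))%:E) (emeasurable_funM mu' (mAt t)) (v t)
    (fun x _ => mule_ge0 (u0 x) (i0 (x, t))) (v0 t)) => <-.
  by apply: eq_integral => x _; rewrite /f /= muleCA.
move=> H; under eq_integral do rewrite -E1.
by rewrite H; apply: eq_integral => t _; rewrite E2.
Qed.

End Tonelli.

Section LayerCake.
Context {R : realType}.
Notation mu := (@lebesgue_measure R).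
Notation plane := (measurableTypeR R * measurableTypeR R)%type.
Notation I01 := (`[0%R, 1%R[%classic : set R).

Lemma upper_set_itv (U : set R) : U `<=` I01 ->
  (forall x y, U x -> x <= y -> y < 1 -> U y) ->
  U = set0 \/ exists c, 0 <= c <= 1 /\ (U = `[c, 1[%classic \/ U = `]c, 1[%classic).
Proof.
move=> UI up; have [->|/set0P[x0 Ux0]] := eqVneq U set0; first by left.
right; have lb : lbound U 0 by move=> x /UI /=; rewrite in_itv /= => /andP[].
have hU : has_inf U by split; [exists x0|exists 0].
have cl x : U x -> inf U <= x by move=> Ux; apply: ge_inf => //; exists 0.
exists (inf U); split.
  rewrite (lb_le_inf _ lb) /=; last by exists x0.
  apply: (le_trans (cl _ Ux0)); move: (UI _ Ux0); rewrite /= in_itv /= => /andP[_].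
  exact: ltW.
have gt x : inf U < x -> x < 1 -> U x.
  move=> ix x1; have [y Uy yx] := inf_lt hU.1 ix.
  exact: up Uy (ltW yx) x1.
have lt1 x : U x -> x < 1 by move=> /UI /=; rewrite in_itv /= => /andP[].
have [Ui|nUi] := pselect (U (inf U)); [left|right]; apply/seteqP; split=> x.
- by move=> Ux; rewrite /= in_itv /= cl ?lt1.
- rewrite /= in_itv /= le_eqVlt => /andP[/orP[/eqP<- //|]]; exact: gt.
- move=> Ux; rewrite /= in_itv /= lt1 // andbT lt_neqAle cl // andbT.
  by apply/eqP => E; apply: nUi; rewrite E.
- by rewrite /= in_itv /= => /andP[]; exact: gt.
Qed.

Local Open Scope ereal_scope.

(** A nondecreasing g is a superposition of indicators of its superlevel sets, which
    are intervals ending at 1. *)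
Lemma layer_cake_le (g : R -> R) (f1 f2 : R -> \bar R) :
  {in `[0%R, 1%R[, forall x, (0 <= g x)%R} ->
  {in `[0%R, 1%R[ &, {homo g : x y / (x <= y)%R}} ->
  measurable_fun setT f1 -> measurable_fun setT f2 ->
  (forall x, 0 <= f1 x) -> (forall x, 0 <= f2 x) ->
  (forall u : R, (0 <= u <= 1)%R ->
    \int[mu]_(x in `[u, 1%R[) f1 x <= \int[mu]_(x in `[u, 1%R[) f2 x) ->
  \int[mu]_(x in I01) (f1 x * (g x)%:E) <= \int[mu]_(x in I01) (f2 x * (g x)%:E).
Proof.
move=> g0 gm mf1 mf2 f10 f20 f12.
have mg : measurable_fun I01 g by exact: monotone_measurable_itv.
have mI : measurable I01 by [].
pose G : R -> R := g \_ I01.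
have mG : measurable_fun setT G by exact/(measurable_restrictT _ _).1.
have GE x : I01 x -> G x = g x by move=> xI; rewrite /G patchE mem_set.
pose A : set (R * R) := [set z | [/\ I01 z.1, (0 <= z.2)%R & (z.2 < G z.1)%R]].
have mA : measurable (A : set plane).
  have -> : A = ((fst @^-1` I01) `&` (snd @^-1` `[0%R, +oo[%classic)) `&`
     ((fun z : plane => (z.2 < G z.1)%R) @^-1` [set true]).
    apply/seteqP; split => [[x t] [/= xI t0 tG]|[x t] /= [[xI]]].
      by split=> //; split=> //=; rewrite in_itv /= t0.
    by rewrite in_itv /= andbT => t0 tG; split.
  apply: measurableI.
    apply: measurableI; rewrite -[X in measurable X]setTI.
      exact: (@measurable_fst _ _ (measurableTypeR R) (measurableTypeR R) measurableT).
    exact: (@measurable_snd _ _ (measurableTypeR R) (measurableTypeR R) measurableT).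
  rewrite -[X in measurable X]setTI.
  have mGf : measurable_fun setT (fun z : plane => G z.1).
    exact: measurableT_comp mG measurable_fst.
  exact: (measurable_fun_ltr measurable_snd mGf).
have sec f : measurable_fun setT f -> (forall x, 0 <= f x) ->
    \int[mu]_(x in I01) (f x * (g x)%:E) =
    \int[mu]_t \int[mu]_(x in [set x | A (x, t)]) f x.
  move=> mf f0.
  have [_] := tonelli_set mA mf (@measurable_cst _ _ (measurableTypeR R) _ setT (1 : \bar R)) f0 (fun=> lee01).
  under [in RHS]eq_integral do rewrite mul1e.
  move=> <-; rewrite [LHS]integral_mkcond; apply: eq_integral => x _.
  rewrite patchE; case: ifPn => xI.
    rewrite inE in xI; congr (_ * _).
    have -> : [set t | A (x, t)] = `[0%R, g x[%classic.
      apply/seteqP; split => t; rewrite /A /= GE //.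
        by case=> _ t0 tg; rewrite in_itv /= t0.
      by move=> tI; have /andP[t0 tg] : (0 <= t < g x)%R by move: tI; rewrite in_itv.
    rewrite integral_cst // mul1e /= lebesgue_measure_itv /= lte_fin.
    case: ltP => [_|g0']; first by rewrite oppr0 adde0.
    by congr (_%:E); apply/eqP; rewrite eq_le g0' g0.
  rewrite (_ : [set t | A (x, t)] = set0) ?integral_set0 ?mule0 //.
  by apply/seteqP; split => // t [/= xI' _ _]; move: xI; rewrite notin_setE.
have secm f : measurable_fun setT f -> (forall x, 0 <= f x) ->
    measurable_fun setT (fun t => \int[mu]_(x in [set x | A (x, t)]) f x).
  move=> mf f0; pose A' : set (R * R) := [set z | A (z.2, z.1)].
  have mA' : measurable (A' : set plane).
    rewrite -[X in measurable X]setTI.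
    exact: (@measurable_swap _ _ (measurableTypeR R) (measurableTypeR R) measurableT).
  by have [] := tonelli_set mA' (@measurable_cst _ _ (measurableTypeR R) _ setT (1 : \bar R)) mf (fun=> lee01) f0.
rewrite !sec //; apply: ge0_le_integral => //.
- by move=> t _; exact: integral_ge0.
- exact: secm.
- exact: secm.
move=> t _; have [t0|t0] := ltP t 0%R.
  rewrite (_ : [set x | A (x, t)] = set0) ?integral_set0 //.
  by apply/seteqP; split => // x [/= _]; rewrite leNgt t0.
have US : [set x | A (x, t)] `<=` I01 by move=> x [].
have [|->|[c [c01 [->|->]]]] := upper_set_itv US.
- move=> x y [/= xI _ tx] xy y1.
  have yI : I01 y.
    by move: xI; rewrite /= !in_itv /= y1 andbT => /andP[x0 _]; exact: le_trans xy.
  split=> //=; move: tx; rewrite !GE // => /lt_le_trans; apply.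
  exact: gm.
- by rewrite !integral_set0.
- exact: f12.
- rewrite !integral_itv_obnd_cbnd; [exact: f12|exact: measurable_funTS|exact: measurable_funTS].
Qed.

Lemma tail_exchange (k v : R -> \bar R) :
  measurable_fun setT k -> measurable_fun setT v ->
  (forall x, 0 <= k x) -> (forall x, 0 <= v x) ->
  measurable_fun I01 (fun x => \int[mu]_(t in `]x, 1%R[) v t) /\
  \int[mu]_(x in I01) (k x * \int[mu]_(t in `]x, 1%R[) v t) =
  \int[mu]_(t in I01) (v t * \int[mu]_(x in `[0%R, t[) k x).
Proof.
move=> mk mv k0 v0.
pose A : set (R * R) := [set z | [/\ (0 <= z.1)%R, (z.1 < z.2)%R & (z.2 < 1)%R]].
have mA : measurable (A : set plane).
  have -> : A = ((fst @^-1` `[0%R, +oo[%classic) `&` (snd @^-1` `]-oo, 1%R[%classic)) `&`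
     ((fun z : plane => (z.1 < z.2)%R) @^-1` [set true]).
    apply/seteqP; split => [[x t] [/= x0 xt t1]|[x t] /= [[]]].
      by split=> //; split=> //=; rewrite in_itv /= ?x0.
    by rewrite !in_itv /= andbT => x0 t1 xt; split.
  apply: measurableI.
    apply: measurableI; rewrite -[X in measurable X]setTI.
      exact: (@measurable_fst _ _ (measurableTypeR R) (measurableTypeR R) measurableT).
    exact: (@measurable_snd _ _ (measurableTypeR R) (measurableTypeR R) measurableT).
  rewrite -[X in measurable X]setTI.
  exact: (measurable_fun_ltr measurable_fst measurable_snd).
have [ms E] := tonelli_set mA mk mv k0 v0.
have A1 x : I01 x -> [set t | A (x, t)] = `]x, 1%R[%classic.
  rewrite /= in_itv /= => /andP[x0 x1]; apply/seteqP; split => t; rewrite /A /= in_itv /=.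
    by case=> _ xt t1; rewrite xt.
  by case/andP=> xt t1; split.
have A2 t : I01 t -> [set x | A (x, t)] = `[0%R, t[%classic.
  rewrite /= in_itv /= => /andP[x0 x1]; apply/seteqP; split => x; rewrite /A /= in_itv /=.
    by case=> x0' xt _; rewrite x0'.
  by case/andP=> x0' xt; split.
split.
  apply: (eq_measurable_fun (fun x => \int[mu]_(t in [set t | A (x, t)]) v t)).
    by move=> x; rewrite inE => xI; rewrite A1.
  exact: measurable_funTS.
transitivity (\int[mu]_x (k x * \int[mu]_(t in [set t | A (x, t)]) v t)).
  rewrite [LHS]integral_mkcond; apply: eq_integral => x _; rewrite patchE.
  case: ifPn => xI; first by rewrite inE in xI; rewrite A1.
  rewrite (_ : [set t | A (x, t)] = set0) ?integral_set0 ?mule0 //.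
  apply/seteqP; split => // t [/= x0 xt t1]; move: xI; rewrite notin_setE /= in_itv /=.
  by rewrite x0 (lt_trans xt t1).
rewrite E [RHS]integral_mkcond; apply: eq_integral => t _; rewrite patchE.
case: ifPn => tI; first by rewrite inE in tI; rewrite A2.
rewrite (_ : [set x | A (x, t)] = set0) ?integral_set0 ?mule0 //.
apply/seteqP; split => // x [/= x0 xt t1]; move: tI; rewrite notin_setE /= in_itv /=.
by rewrite t1 (le_trans x0 (ltW xt)).
Qed.

End LayerCake.

(** * The functional and a sufficient condition for minimality *)

Section ClassK.
Context {R : realType}.
Notation mu := (@lebesgue_measure R).
Notation I01 := (`[0%R, 1%R[%classic : set R).
Notation C01 := (`[0%R, 1%R]%classic : set R).
Notation measureR := ({measure set (measurableTypeR R) -> \bar R}).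

Local Open Scope ereal_scope.

Section Decomposed.
Variables (nu : measureR) (g : R -> R) (D : R) (dec : decomposes nu g D).

Lemma dec_ge0 : {in `[0%R, 1%R[, forall x, (0 <= g x)%R}. Proof. by case: dec => -[]. Qed.
Lemma dec_homo : {in `[0%R, 1%R[ &, {homo g : x y / (x <= y)%R}}. Proof. by case: dec => -[]. Qed.
Lemma dec_gt0 : (0 < D)%R. Proof. by case: dec. Qed.
Lemma dec_meas : measurable_fun I01 g.
Proof. by apply: monotone_measurable_itv; exact: dec_homo. Qed.

Let G (x : R) : \bar R := (g \_ I01 x)%:E.
Let mG : measurable_fun setT G.
Proof. by apply/measurable_EFinP/(measurable_restrictT _ _).1 => //; exact: dec_meas. Qed.
Let G0 x : 0 <= G x.
Proof.
rewrite /G patchE; case: ifPn => xI; rewrite lee_fin //.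
by apply: dec_ge0; move: xI; rewrite inE.
Qed.
Let GE x : I01 x -> G x = (g x)%:E.
Proof. by move=> xI; rewrite /G patchE mem_set. Qed.

Lemma tailE x : I01 x -> nu `]x, 1%R]%classic = \int[mu]_(t in `]x, 1%R[) G t + D%:E.
Proof.
move=> xI; case: dec => _ _ ->; last by [].
rewrite diracE mem_set; last by move: xI; rewrite /= !in_itv /= lexx andbT => /andP[_ ->].
rewrite mule1; congr (_ + _).
have -> : `]x, 1%R] `&` `[0%R, 1%R[ = `]x, 1%R[%classic :> set R.
  apply/seteqP; split => t /=; rewrite !in_itv /=.
    by move=> [/andP[-> _] /andP[_ ->]].
  move: xI; rewrite /= in_itv /= => /andP[x0 x1] /andP[xt t1].
  by rewrite xt t1 (ltW t1) (le_trans x0 (ltW xt)).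
apply: eq_integral => t; rewrite inE /= in_itv /= => /andP[xt t1]; rewrite GE //=.
by move: xI; rewrite /= !in_itv /= t1 andbT => /andP[x0 _]; exact: le_trans (ltW xt).
Qed.

Lemma tail_ge x : I01 x -> D%:E <= nu `]x, 1%R]%classic.
Proof. by move=> xI; rewrite tailE // leeDr // integral_ge0. Qed.

Lemma tail_measurable : measurable_fun I01 (fun x => nu `]x, 1%R]%classic).
Proof.
have [m _] := tail_exchange (@measurable_cst _ _ (measurableTypeR R) _ setT (0 : \bar R)) mG
   (fun=> lexx _) G0.
apply: (eq_measurable_fun (fun x : R => (\int[mu]_(t in `]x, 1%R[) G t + D%:E)%E)).
  by move=> x; rewrite inE => xI; rewrite -tailE.
exact: emeasurable_funD.
Qed.

Lemma tail_inv_fin x : I01 x -> (nu `]x, 1%R]%classic)^-1 \is a fin_num.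
Proof.
move=> /tail_ge; have := dec_gt0; case: (nu _) => [r| |] D0 //=.
by rewrite lee_fin => Dr; rewrite inver gt_eqF // (lt_le_trans D0).
Qed.

Lemma tail_inv_measurable : measurable_fun I01 (fun x => (nu `]x, 1%R]%classic)^-1).
Proof.
apply: (eq_measurable_fun (fun x : R => (fine ((nu `]x, 1%R]%classic)^-1)%E)%:E)).
  by move=> x; rewrite inE => xI; rewrite fineK // tail_inv_fin.
apply/measurable_EFinP; apply: monotone_measurable_itv => x y xI yI xy.
have le : nu `]y, 1%R]%classic <= nu `]x, 1%R]%classic.
  apply: le_measure; rewrite ?inE // => t /=; rewrite !in_itv /= => /andP[yt ->].
  by rewrite (le_lt_trans xy yt).
have := tail_ge yI; have := dec_gt0; move: le.
case: (nu `]y, _]%classic) => [b| |] //; case: (nu `]x, _]%classic) => [a| |] //.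
  rewrite !lee_fin => ba D0 Db; rewrite !inver !gt_eqF ?(lt_le_trans D0) ?(le_trans Db) //=.
  by rewrite lef_pV2 // posrE (lt_le_trans D0) // (le_trans Db).
move=> _ D0; rewrite lee_fin => Db; rewrite inver gt_eqF /= ?(lt_le_trans D0) //.
by rewrite invr_ge0 ltW // (lt_le_trans D0).
Qed.

(** K being a primitive of k, both sides integrate k over the pairs of a point x and
    a point t > x, weighted by nu in t. *)
Lemma integral_exchange (k : R -> \bar R) (K : R -> R) :
  measurable_fun setT k -> (forall x, 0 <= k x) ->
  measurable_fun C01 K ->
  (forall t, (0 <= t <= 1)%R -> (0 <= K t)%R) ->
  (forall t, (0 <= t <= 1)%R -> \int[mu]_(x in `[0%R, t[) k x = (K t)%:E) ->
  \int[nu]_(x in `[0%R, 1%R]) (K x)%:E = \int[mu]_(x in I01) (k x * nu `]x, 1%R]%classic).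
Proof.
move=> mk k0 mK K0 kK; have D0 := dec_gt0; have [_ _ nuE] := dec.
rewrite (density_integral01 dec_ge0 dec_meas (ltW D0) nuE); last 2 first.
- exact/measurable_EFinP.
- by move=> x xI; rewrite lee_fin K0 //; move: xI; rewrite in_itv.
have [m E] := tail_exchange mk mG k0 G0.
have T0 x : 0 <= \int[mu]_(t in `]x, 1%R[) G t by exact: integral_ge0.
transitivity (\int[mu]_(x in I01) (k x * \int[mu]_(t in `]x, 1%R[) G t + k x * D%:E)).
  rewrite ge0_integralD //; last 4 first.
  - by move=> x _; rewrite mule_ge0.
  - by apply: emeasurable_funM => //; exact: measurable_funTS.
  - by move=> x _; rewrite mule_ge0 // lee_fin ltW.
  - by apply: emeasurable_funM => //; exact: measurable_funTS.
  rewrite E; congr (_ + _).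
    apply: eq_integral => t; rewrite inE => tI; rewrite GE // kK 1?muleC //.
    by move: tI; rewrite /= in_itv /= => /andP[-> /ltW].
  rewrite ge0_integralZr //; last 2 first.
  - exact: measurable_funTS.
  - by rewrite lee_fin ltW.
  by rewrite kK ?ler01 ?lexx // muleC.
apply: eq_integral => x; rewrite inE => xI.
by rewrite tailE // [RHS]ge0_muleDr // lee_fin ltW.
Qed.

End Decomposed.

Lemma Qfun_half (xi xp : R -> R) (nu : measureR) (g : R -> R) (D : R) :
  decomposes nu g D -> derive1 xi =1 xp ->
  Qfun xi nu = (2^-1)%:E * (\int[nu]_(x in `[0%R, 1%R]) (xp x)%:E +
     \int[mu]_(x in I01) (nu `]x, 1%R]%classic)^-1).
Proof.
move=> dec dxi; rewrite /Qfun; congr (_ * (_ + _)).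
  by apply: eq_integral => x _; rewrite dxi.
rewrite -integral_itv_bndo_bndc //; exact: tail_inv_measurable dec.
Qed.

Lemma amgm_ereal (h : R) (H : \bar R) : (0 < h)%R -> 0 < H ->
  (2 / h)%:E <= (h ^- 2)%:E * H + H^-1.
Proof.
move=> h0; case: H => [H| |] //; last first.
  by move=> _; rewrite gt0_muley ?lte_fin ?invr_gt0 ?exprn_gt0 // addye // leey.
rewrite lte_fin => H0; rewrite inver gt_eqF // -EFinM -EFinD lee_fin -subr_ge0.
have -> : (h ^- 2 * H + H^-1 - 2 / h = (H - h) ^+ 2 / (h ^+ 2 * H))%R.
  by field; rewrite !gt_eqF.
by rewrite divr_ge0 ?sqr_ge0 // mulr_ge0 ?sqr_ge0 // ltW.
Qed.

(** Convex duality.  Let h be the tail of nu and K the primitive of h^-2.  For any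
    competitor of tail H, 1 / H >= 2 / h - H / h^2, so the functional at the
    competitor is at least half of the integral of xi' - K against it plus the
    integral of 1 / h; the first term is nonnegative by hypothesis, and there is
    equality for nu itself. *)
Lemma optimality (xi xp h k K : R -> R) (nu : measureR) (g0 : R -> R) (D0 : R) :
  derive1 xi =1 xp -> decomposes nu g0 D0 ->
  (forall x, I01 x -> nu `]x, 1%R]%classic = (h x)%:E) ->
  (forall x, I01 x -> (0 < h x)%R) ->
  measurable_fun setT k -> (forall x, (0 <= k x)%R) ->
  (forall x, I01 x -> k x = (h x ^- 2)%R) ->
  measurable_fun C01 K ->
  (forall t, (0 <= t <= 1)%R -> (0 <= K t)%R) ->
  (forall t, (0 <= t <= 1)%R -> \int[mu]_(x in `[0%R, t[) (k x)%:E = (K t)%:E) ->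
  \int[nu]_(x in `[0%R, 1%R]) (xp x)%:E = \int[nu]_(x in `[0%R, 1%R]) (K x)%:E ->
  (forall (m : measureR) g D, decomposes m g D ->
    \int[m]_(x in `[0%R, 1%R]) (K x)%:E <= \int[m]_(x in `[0%R, 1%R]) (xp x)%:E) ->
  is_parisi_measure xi nu.
Proof.
move=> dxi dec nuh h0 mk k0 kh mK K0 kK eqK leK; split; first by exists g0, D0.
move=> m [g [D decm]]; rewrite (Qfun_half dec dxi) (Qfun_half decm dxi).
have mkE : measurable_fun setT (fun x => (k x)%:E) by exact/measurable_EFinP.
have k0E x : 0 <= (k x)%:E by rewrite lee_fin.
have hinv : \int[mu]_(x in I01) (nu `]x, 1%R]%classic)^-1 = \int[mu]_(x in I01) ((h x)^-1)%:E.
  by apply: eq_integral => x; rewrite inE => xI; rewrite nuh // inver gt_eqF // h0.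
have mhinv : measurable_fun I01 (fun x => ((h x)^-1)%:E).
  apply: (eq_measurable_fun (fun x : R => ((nu `]x, 1%R]%classic)^-1)%E)).
    by move=> x; rewrite inE => xI; rewrite nuh // inver gt_eqF // h0.
  exact: tail_inv_measurable dec.
apply: lee_wpmul2l; first by rewrite lee_fin.
rewrite eqK (integral_exchange dec mkE k0E mK K0 kK) hinv.
have -> : \int[mu]_(x in I01) ((k x)%:E * nu `]x, 1%R]%classic) =
    \int[mu]_(x in I01) ((h x)^-1)%:E.
  apply: eq_integral => x; rewrite inE => xI; rewrite nuh // kh // -EFinM.
  by congr (_%:E); have := h0 x xI => hx; field; rewrite gt_eqF.
apply: (@le_trans _ _ (\int[m]_(x in `[0%R, 1%R]) (K x)%:E +
    \int[mu]_(x in I01) (m `]x, 1%R]%classic)^-1)); last by rewrite leeD2r // (leK _ _ _ decm).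
rewrite (integral_exchange decm mkE k0E mK K0 kK).
have Hpos x : I01 x -> 0 < m `]x, 1%R]%classic.
  by move=> xI; apply: lt_le_trans (tail_ge decm xI); rewrite lte_fin (dec_gt0 decm).
rewrite -ge0_integralD //; last 2 first.
- by move=> x xI; rewrite lee_fin invr_ge0 ltW // h0.
- by move=> x xI; rewrite lee_fin invr_ge0 ltW // h0.
rewrite -ge0_integralD //; last 4 first.
- by move=> x xI; rewrite mule_ge0 // ltW // Hpos.
- by apply: emeasurable_funM; [exact: measurable_funTS|exact: tail_measurable decm].
- by move=> x xI; rewrite inve_ge0 ltW // Hpos.
- exact: tail_inv_measurable decm.
apply: ge0_le_integral => //.
- by move=> x xI; rewrite -EFinD lee_fin addr_ge0 // invr_ge0 ltW // h0.
- exact: emeasurable_funD.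
- apply: emeasurable_funD; last exact: tail_inv_measurable decm.
  by apply: emeasurable_funM; [exact: measurable_funTS|exact: tail_measurable decm].
move=> x xI; rewrite kh //; apply: le_trans (amgm_ereal (h0 _ xI) (Hpos _ xI)).
by rewrite -EFinD lee_fin mulrDl mul1r.
Qed.

End ClassK.

(** * Integrals of derivatives on subintervals of [0, 1] *)

Section IntegralDerivative.
Context {R : realType}.
Notation mu := (@lebesgue_measure R).
Notation I01 := (`[0%R, 1%R[%classic : set R).
Notation C01 := (`[0%R, 1%R]%classic : set R).
Notation measureR := ({measure set (measurableTypeR R) -> \bar R}).

Lemma integral_derivative (F f : R -> R) (a b : R) : a <= b ->
  (forall x, a <= x <= b -> is_derive x 1 F (f x)) ->
  {within `[a, b], continuous f} ->
  (\int[mu]_(x in `[a, b[) (f x)%:E = (F b - F a)%:E)%E.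
Proof.
rewrite le_eqVlt => /orP[/eqP-> _ _|ab dF cf].
  by rewrite set_itvco0 integral_set0 subrr.
have cF x : a <= x <= b -> {for x, continuous F}.
  by move=> xab; apply/differentiable_continuous/derivable1_diffP; case: (dF x xab).
have mf : measurable_fun `[a, b[ (EFin \o f).
  apply/measurable_EFinP; apply: (measurable_funS (E := `[a, b])) => //.
    by apply: subset_itvl; rewrite bnd_simp.
  exact: subspace_continuous_measurable_fun.
rewrite integral_itv_bndo_bndc // EFinB; apply: continuous_FTC2 => //.
  split.
  - move=> x; rewrite in_itv /= => /andP[ax xb].
    by case: (dF x); rewrite ?(ltW ax) ?(ltW xb).
  - by apply: cvg_at_right_filter; apply: cF; rewrite lexx ltW.
  - by apply: cvg_at_left_filter; apply: cF; rewrite lexx ltW.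
move=> x; rewrite in_itv /= => /andP[ax xb]; rewrite derive1E.
by case: (dF x); rewrite ?(ltW ax) ?(ltW xb).
Qed.

Lemma measurable_of_derive (F f : R -> R) :
  (forall x : R, 0 <= x <= 1 -> is_derive x 1 F (f x)) ->
  measurable_fun C01 F.
Proof.
by move=> dF; apply: subspace_continuous_measurable_fun => //; exact: within_of_derive dF.
Qed.

Lemma measurable_halfopen (f : R -> R) :
  measurable_fun C01 f -> measurable_fun I01 f.
Proof.
by apply: measurable_funS => //; apply: subset_itvl; rewrite bnd_simp.
Qed.

Lemma integral_split (f : R -> \bar R) (a c b : R) : a <= c -> c <= b ->
  measurable_fun (`[a, b[%classic : set R) f -> (forall x, (a <= x < b)%R -> (0 <= f x)%E) ->
  (\int[mu]_(x in `[a, b[) f x = \int[mu]_(x in `[a, c[) f x + \int[mu]_(x in `[c, b[) f x)%E.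
Proof.
move=> ac cb mf f0.
have E : (`[a, b[%classic : set R) = `[a, c[ `|` `[c, b[.
  by rewrite -itv_bndbnd_setU // bnd_simp.
rewrite E ge0_integral_setU //.
- by rewrite -E.
- by move=> x; rewrite -E /= in_itv; exact: f0.
rewrite disj_set2E; apply/eqP/seteqP; split => // x /=; rewrite !in_itv /=.
by move=> [/andP[_ xc] /andP[cx _]]; move: (lt_le_trans xc cx); rewrite ltxx.
Qed.

Lemma integral_le_const (f : R -> \bar R) (M a b : R) : a <= b -> 0 <= M ->
  measurable_fun (`[a, b[%classic : set R) f ->
  (forall x, (a <= x < b)%R -> (0 <= f x <= M%:E)%E) ->
  (\int[mu]_(x in `[a, b[) f x <= (M * (b - a))%:E)%E.
Proof.
move=> ab M0 mf fM.
apply: (@le_trans _ _ (\int[mu]_(x in `[a, b[) M%:E)%E).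
  apply: ge0_le_integral => //.
  - by move=> x; rewrite /= in_itv /= => /fM /andP[].
  - by move=> x; rewrite /= in_itv /= => /fM /andP[].
rewrite integral_cst //= lebesgue_measure_itv /= lte_fin.
case: ifPn => // nab; rewrite mule0 lee_fin mulr_ge0 // subr_ge0 //.
Qed.

Lemma mu_itv_oo1 (x : R) : 0 <= x < 1 -> mu `]x, 1%R[%classic = (1 - x)%:E.
Proof.
move=> /andP[x0 x1].
by rewrite lebesgue_measure_itv /= lte_fin x1.
Qed.

End IntegralDerivative.

(** * Measures whose density is a combination of two steps *)

Section StepMeasures.
Context {R : realType}.
Notation mu := (@lebesgue_measure R).
Notation I01 := (`[0%R, 1%R[%classic : set R).
Notation C01 := (`[0%R, 1%R]%classic : set R).
Notation measureR := ({measure set (measurableTypeR R) -> \bar R}).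

Definition two_step (x0 u m a x : R) : R := m * (x0 <= x)%R%:R + a * (u <= x)%R%:R.
(** The length of the part of (x, 1) that lies above u, so the tail contributed by
    the step at u. *)
Definition ramp (u x : R) : R := 1 - Num.max x u.

Lemma measurable_step (A : set R) (u c : R) :
  measurable_fun (A : set (measurableTypeR R)) (fun x : R => c * (u <= x)%R%:R).
Proof.
apply: measurable_funM => //.
rewrite (_ : (fun _ => _) = \1_(`[u, +oo[%classic : set R)); last first.
  by apply/funext => x; rewrite indicE mem_setE in_itv /= andbT.
exact: measurable_funTS (measurable_indic _).
Qed.

Lemma integral_step (f : R -> \bar R) (A : set R) (u c : R) :
  measurable (A : set (measurableTypeR R)) -> measurable_fun A f ->
  (forall x, A x -> (0 <= f x)%E) -> 0 <= c ->
  (\int[mu]_(x in A) (f x * (c * (u <= x)%R%:R)%:E) =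
   c%:E * \int[mu]_(x in A `&` `[u, +oo[) f x)%E.
Proof.
move=> mA mf f0 c0.
rewrite integral_mkcondr -ge0_integralZl //; last 2 first.
- by apply/(measurable_restrict _ _ _).1 => //; exact: measurable_funS mf.
- by move=> x Ax; rewrite patchE; case: ifPn => // _; exact: f0.
apply: eq_integral => x; rewrite inE => Ax; rewrite patchE.
have [ux|ux] := boolP (u <= x)%R.
  by rewrite mem_set /= ?in_itv /= ?ux // mulr1 muleC.
by rewrite memNset /= ?in_itv /= ?(negbTE ux) // mulr0 !mule0.
Qed.

Lemma setI_itv_ge (u : R) : 0 <= u ->
  I01 `&` `[u, +oo[ = `[u, 1%R[%classic.
Proof.
move=> u0; apply/seteqP; split => t /=; rewrite !in_itv /= ?andbT.
  by move=> [/andP[_ ->] ->].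
by move=> /andP[ut ->]; rewrite ut (le_trans u0 ut).
Qed.

Lemma measure_tail_step (x u : R) : 0 <= x < 1 -> 0 <= u < 1 ->
  mu (`]x, 1%R[ `&` `[u, +oo[) = (ramp u x)%:E.
Proof.
move=> /andP[x0 x1] /andP[u0 u1]; rewrite /ramp.
case: (leP x u) => xu.
  have [<-|xu'] := eqVneq x u.
    have -> : `]x, 1%R[ `&` `[x, +oo[ = `]x, 1%R[%classic :> set R.
      apply/seteqP; split => t /=; rewrite !in_itv /= ?andbT; first by case.
      by move=> /andP[xt ->]; rewrite xt ltW.
    by rewrite mu_itv_oo1 // x0.
  have {}xu : x < u by rewrite lt_neqAle xu' xu.
  have -> : `]x, 1%R[ `&` `[u, +oo[ = `[u, 1%R[%classic :> set R.
    apply/seteqP; split => t /=; rewrite !in_itv /= ?andbT.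
      by move=> [/andP[_ ->] ->].
    by move=> /andP[ut ->]; rewrite ut (lt_le_trans xu ut).
  by rewrite lebesgue_measure_itv /= lte_fin u1.
have -> : `]x, 1%R[ `&` `[u, +oo[ = `]x, 1%R[%classic :> set R.
  apply/seteqP; split => t /=; rewrite !in_itv /= ?andbT; first by case.
  by move=> /andP[xt ->]; rewrite xt (ltW (lt_trans xu xt)).
by rewrite mu_itv_oo1 // x0.
Qed.

Section WithDensity.
Variables (nu : measureR) (g : R -> R) (D x0 u m a : R).
Hypotheses (dec : decomposes nu g D) (x01 : 0 <= x0 < 1) (u01 : 0 <= u < 1)
  (m0 : 0 <= m) (a0 : 0 <= a) (gE : forall x, I01 x -> g x = two_step x0 u m a x).

Let two_step_integral (f : R -> \bar R) (A : set R) :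
  measurable (A : set (measurableTypeR R)) -> A `<=` I01 -> measurable_fun A f ->
  (forall x, A x -> (0 <= f x)%E) ->
  (\int[mu]_(x in A) (f x * (g x)%:E) =
   m%:E * \int[mu]_(x in A `&` `[x0, +oo[) f x +
   a%:E * \int[mu]_(x in A `&` `[u, +oo[) f x)%E.
Proof.
move=> mA AI mf f0.
rewrite -!integral_step // -ge0_integralD //.
- apply: eq_integral => x; rewrite inE => Ax; rewrite gE; last exact: AI.
  by rewrite /two_step EFinD ge0_muleDr // lee_fin mulr_ge0.
- by move=> x Ax; rewrite mule_ge0 ?f0 // lee_fin mulr_ge0.
- by apply: emeasurable_funM => //; apply/measurable_EFinP; exact: measurable_step.
- by move=> x Ax; rewrite mule_ge0 ?f0 // lee_fin mulr_ge0.
- by apply: emeasurable_funM => //; apply/measurable_EFinP; exact: measurable_step.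
Qed.

Lemma two_step_tail x : I01 x ->
  nu `]x, 1%R]%classic = (D + m * ramp x0 x + a * ramp u x)%:E.
Proof.
move=> xI; rewrite (tailE dec xI).
have xI' : 0 <= x < 1 by move: xI; rewrite /= in_itv.
have sub : `]x, 1%R[ `<=` I01.
  move=> t; rewrite /= !in_itv /= => /andP[xt ->]; rewrite andbT.
  by case/andP: xI' => x00 _; exact: le_trans x00 (ltW xt).
transitivity (\int[mu]_(t in `]x, 1%R[) (1 * (g t)%:E) + D%:E)%E.
  congr (_ + _)%E; apply: eq_integral => t; rewrite inE => tx; rewrite mul1e patchE mem_set //.
  exact: sub.
rewrite (two_step_integral (f := cst 1%E)) //.
rewrite !integral_cst /=; [|exact: measurableI|exact: measurableI].
rewrite !mul1e !measure_tail_step // -!EFinM -!EFinD; congr (_%:E); ring.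
Qed.

Lemma two_step_integral01 (f : R -> R) :
  measurable_fun C01 f -> (forall x, 0 <= x <= 1 -> 0 <= f x) ->
  (\int[nu]_(x in `[0%R, 1%R]) (f x)%:E = m%:E * \int[mu]_(x in `[x0, 1%R[) (f x)%:E +
    a%:E * \int[mu]_(x in `[u, 1%R[) (f x)%:E + D%:E * (f 1)%:E)%E.
Proof.
move=> mf f0; have [_ _ nuE] := dec; have D0 := dec_gt0 dec.
have mfE : measurable_fun C01 (EFin \o f : measurableTypeR R -> \bar R).
  exact/measurable_EFinP.
rewrite (density_integral01 (dec_ge0 dec) (dec_meas dec) (ltW D0) nuE mfE); last first.
  by move=> x xI; rewrite lee_fin f0 //; move: xI; rewrite in_itv.
congr (_ + _)%E; rewrite two_step_integral //.
- by rewrite !setI_itv_ge //; [case/andP: u01|case/andP: x01].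
- by apply/measurable_EFinP; exact: measurable_halfopen mf.
- by move=> x; rewrite /= in_itv /= => /andP[x00 /ltW x1]; rewrite lee_fin f0 // x00.
Qed.

End WithDensity.

Lemma two_step_decomposes (x0 u m a D : R) :
  0 <= m -> 0 <= a -> 0 < D ->
  exists nu : measureR, decomposes nu (two_step x0 u m a) D.
Proof.
move=> m0 a0 D0.
pose step (v c : R) (c0 : 0 <= c) : measureR :=
  mscale (NngNum c0) (mrestr mu (measurableI _ _ (measurable_itv `[0%R, 1%R[) (measurable_itv `[v, +oo[))).
pose nu : measureR := measure_add (measure_add (step x0 m m0) (step u a a0))
    (mscale (NngNum (ltW D0)) (dirac (1 : measurableTypeR R))).
exists nu; split=> //.
  have cts (v x : R) : ((v <= y)%R%:R : R) @[y --> x^'+] --> ((v <= x)%R%:R : R).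
    apply: cvg_near_cst; case: (leP v x) => vx.
      near=> y; suff -> : v <= y by [].
      by apply: (le_trans vx); near: y; exact: nbhs_right_ge.
    near=> y; suff /negbTE-> : ~~ (v <= y) by [].
    by rewrite -ltNge; near: y; exact: nbhs_right_lt.
  split.
  - by move=> x _; rewrite addr_ge0 // mulr_ge0.
  - move=> x y _ _ xy; apply: lerD; apply: ler_wpM2l => //; rewrite ler_nat;
      by case: (leP _ x) => // /le_trans->.
  - by move=> x _; apply: cvgD; apply: cvgMr; exact: cts.
move=> A mA.
have mAI : measurable (A `&` `[0%R, 1%R[ : set (measurableTypeR R)) by exact: measurableI.
have stepE v c (c0 : 0 <= c) : step v c c0 A =
    (c%:E * \int[mu]_(x in (A `&` `[0%R, 1%R[) `&` `[v, +oo[) 1)%E.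
  rewrite integral_cst /= ?mul1e; last exact: measurableI.
  by rewrite /step /mscale /= /mrestr setIA.
transitivity (step x0 m m0 A + step u a a0 A + mscale (NngNum (ltW D0))
   (dirac (1%R : measurableTypeR R)) A)%E.
  transitivity (measure_add (step x0 m m0) (step u a a0) A + mscale (NngNum (ltW D0))
   (dirac (1%R : measurableTypeR R)) A)%E; first exact: measure_addE.
  congr (_ + _)%E; exact: measure_addE.
congr (_ + _)%E; rewrite !stepE.
rewrite -(integral_step (f := cst 1%E) x0 mAI) // -(integral_step (f := cst 1%E) u mAI) //.
rewrite -ge0_integralD //.
- by apply: eq_integral => x _; rewrite !mul1e.
- by move=> x _; rewrite mul1e lee_fin mulr_ge0.
- by apply: emeasurable_funM => //; apply/measurable_EFinP; exact: measurable_step.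
- by move=> x _; rewrite mul1e lee_fin mulr_ge0.
- by apply: emeasurable_funM => //; apply/measurable_EFinP; exact: measurable_step.
Unshelve. all: by end_near. Qed.

End StepMeasures.

(** * Optimality of a one-step measure *)

Section ClassOrder.
Context {R : realType}.
Notation mu := (@lebesgue_measure R).
Notation I01 := (`[0%R, 1%R[%classic : set R).
Notation C01 := (`[0%R, 1%R]%classic : set R).
Notation measureR := ({measure set (measurableTypeR R) -> \bar R}).

Lemma tail_order (f1 f2 : R -> R) (nu : measureR) g D : decomposes nu g D ->
  measurable_fun C01 f1 ->
  measurable_fun C01 f2 ->
  (forall x, 0 <= x <= 1 -> 0 <= f1 x) -> (forall x, 0 <= x <= 1 -> 0 <= f2 x) ->
  f1 1 <= f2 1 ->
  (forall u, 0 <= u <= 1 ->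
    (\int[mu]_(x in `[u, 1%R[) (f1 x)%:E <= \int[mu]_(x in `[u, 1%R[) (f2 x)%:E)%E) ->
  (\int[nu]_(x in `[0%R, 1%R]) (f1 x)%:E <= \int[nu]_(x in `[0%R, 1%R]) (f2 x)%:E)%E.
Proof.
move=> dec m1 m2 f10 f20 f11 f12.
have D0 := dec_gt0 dec; have [_ _ nuE] := dec.
have mE (f : R -> R) : measurable_fun C01 f ->
  measurable_fun C01 (EFin \o f : measurableTypeR R -> \bar R) by move=> ?; exact/measurable_EFinP.
rewrite (density_integral01 (dec_ge0 dec) (dec_meas dec) (ltW D0) nuE (mE _ m1)); last first.
  by move=> x xI; rewrite lee_fin f10 //; move: xI; rewrite in_itv.
rewrite (density_integral01 (dec_ge0 dec) (dec_meas dec) (ltW D0) nuE (mE _ m2)); last first.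
  by move=> x xI; rewrite lee_fin f20 //; move: xI; rewrite in_itv.
have patchI (f : R -> R) x : I01 x -> ((f \_ `[0%R, 1%R]) x)%:E = (f x)%:E :> \bar R.
  by move=> xI; rewrite patchE mem_set //; move: xI; rewrite /= !in_itv /= => /andP[-> /ltW].
have int_patch (f : R -> R) u : 0 <= u -> (\int[mu]_(x in `[u, 1%R[) ((f \_ `[0%R, 1%R]) x)%:E =
    \int[mu]_(x in `[u, 1%R[) (f x)%:E)%E.
  move=> u0; apply: eq_integral => x; rewrite inE => xI; rewrite patchI //.
  by move: xI; rewrite /= !in_itv /= => /andP[ux ->]; rewrite (le_trans u0 ux).
apply: leeD; last by rewrite lee_pmul2l ?lte_fin // lee_fin.
have mp (f : R -> R) : measurable_fun C01 f ->
    measurable_fun setT (fun x => ((f \_ `[0%R, 1%R]) x)%:E).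
  by move=> mf; apply/measurable_EFinP/(measurable_restrictT _ _).1.
have p0 (f : R -> R) : (forall x, 0 <= x <= 1 -> 0 <= f x) ->
    forall x, (0 <= ((f \_ `[0%R, 1%R]) x)%:E)%E.
  move=> f0 x; rewrite patchE; case: ifPn => xI; rewrite lee_fin //.
  by apply: f0; move: xI; rewrite inE /= in_itv.
have := @layer_cake_le R g _ _ (dec_ge0 dec) (dec_homo dec) (mp _ m1) (mp _ m2) (p0 _ f10) (p0 _ f20).
have E (f : R -> R) : (\int[mu]_(x in I01) (((f \_ `[0%R, 1%R]) x)%:E * (g x)%:E) =
  \int[mu]_(x in I01) ((f x)%:E * (g x)%:E))%E.
  by apply: eq_integral => x; rewrite inE => xI; rewrite patchI.
rewrite !E; apply => u /andP[u0 u1]; rewrite !int_patch //; apply: f12.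
by rewrite u0.
Qed.

End ClassOrder.

Section Profile.
Context {R : realType}.
Implicit Types z A x : R.

(** With the tail D (1 + z (1 - x)) and A = 1 / (D^2 (1 + z)), the tail to the power -2
    is [dprofile]. *)
Definition profile A z x : R := A * (x / (1 + z * (1 - x))).
Definition dprofile A z x : R := A * (1 + z) / (1 + z * (1 - x)) ^+ 2.

Lemma is_derive_den z x : is_derive x 1 (fun y : R => 1 + z * (1 - y)) (- z).
Proof.
have -> : (fun y : R => 1 + z * (1 - y)) = (fun y => (1 + z) + (- z) * y).
  by apply/funext => y; ring.
exact: is_derive_affine.
Qed.

Lemma is_derive_profile A z x : 1 + z * (1 - x) != 0 ->
  is_derive x 1 (profile A z) (dprofile A z x).
Proof.
move=> h; have d := is_deriveZ A (is_deriveM (is_derive_id x 1)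
  (@is_deriveV R (fun y : R => 1 + z * (1 - y)) x _ 1 h (is_derive_den z x))).
apply: (is_derive_eq d); rewrite /dprofile /GRing.scale /=; move: h => h.
by field.
Qed.

Lemma derivable_dprofile A z x : 1 + z * (1 - x) != 0 ->
  derivable (dprofile A z) x 1.
Proof.
move=> h.
have h2 : (1 + z * (1 - x)) * (1 + z * (1 - x)) != 0 by rewrite mulf_neq0.
have d := is_deriveZ (A * (1 + z)) (@is_deriveV R ((fun y : R => 1 + z * (1 - y)) * (fun y : R => 1 + z * (1 - y))) x _ 1 h2
  (is_deriveM (is_derive_den z x) (is_derive_den z x))).
by case: d.
Qed.

Lemma profile_ge0 A z x : 0 <= A -> 0 <= z -> 0 <= x <= 1 -> 0 <= profile A z x.
Proof.
move=> A0 z0 x01; have h := den_gt0 z0 x01; case/andP: x01 => x0 _.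
by rewrite mulr_ge0 // divr_ge0 // ltW.
Qed.

End Profile.

Section Sufficiency.
Context {R : realType}.
Notation mu := (@lebesgue_measure R).
Notation I01 := (`[0%R, 1%R[%classic : set R).
Notation C01 := (`[0%R, 1%R]%classic : set R).
Notation measureR := ({measure set (measurableTypeR R) -> \bar R}).

Lemma integral_dmixture p s (l a b : R) : a <= b ->
  (\int[mu]_(x in `[a, b[) (dmixture p s l x)%:E = (mixture p s l b - mixture p s l a)%:E)%E.
Proof.
move=> ab; apply: integral_derivative => // [x _|]; first exact: is_derive_mixture.
by apply: within_of_derive => x _; exact: is_derive_dmixture.
Qed.

Lemma measurable_dmixture p s (l : R) :
  measurable_fun C01 (dmixture p s l).
Proof.
by apply: measurable_of_derive => x _; exact: is_derive_dmixture.
Qed.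

Lemma integral_profile (A z a b : R) : 0 < z -> 0 <= a -> a <= b -> b <= 1 ->
  (\int[mu]_(x in `[a, b[) (profile A z x)%:E = (A * pprim z b - A * pprim z a)%:E)%E.
Proof.
move=> z0 a0 ab b1.
have ab01 x : a <= x <= b -> 1 + z * (1 - x) != 0.
  move=> /andP[ax xb]; rewrite gt_eqF //; apply: den_gt0; first exact: ltW.
  by rewrite (le_trans a0 ax) (le_trans xb b1).
have cont : {within `[a, b], continuous (profile A z)}.
  by apply: (within_of_derive (df := dprofile A z)) => x /ab01; exact: is_derive_profile.
have der (x : R) : a <= x <= b -> is_derive x 1 (A \*: pprim z) (profile A z x).
  move=> /andP[ax xb].
  have x01 : 0 <= x <= 1 by rewrite (le_trans a0 ax) (le_trans xb b1).
  have d := @is_derive_pprim R z x (lt0r_neq0 z0) (den_gt0 (ltW z0) x01).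
  exact: (is_deriveZ A d).
exact: (integral_derivative ab der cont).
Qed.

Lemma integral_dprofile (A z t : R) : 0 < z -> 0 <= t <= 1 ->
  (\int[mu]_(x in `[0%R, t[) (dprofile A z x)%:E = (profile A z t)%:E)%E.
Proof.
move=> z0 /andP[t0 t1].
have ab01 x : 0 <= x <= t -> 1 + z * (1 - x) != 0.
  move=> /andP[ax xb]; rewrite gt_eqF //; apply: den_gt0; first exact: ltW.
  by rewrite ax (le_trans xb t1).
have cont : {within `[0, t], continuous (dprofile A z)}.
  apply: derivable_within_continuous => x; rewrite in_itv /= => xt.
  by apply: derivable_dprofile; exact: ab01.
have der (x : R) : 0 <= x <= t -> is_derive x 1 (profile A z) (dprofile A z x).
  by move=> xt; apply: is_derive_profile; exact: ab01.
rewrite (integral_derivative t0 der cont).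
by rewrite [X in _ - X]/profile mul0r mulr0 subr0.
Qed.

(** For a constant density m the jump measure rho is m times the Dirac mass at 0. *)
Lemma kRSB1_of_constant_density (xi : R -> R) (nu : measureR) (g : R -> R) (D m : R) :
  0 < m -> is_parisi_measure xi nu -> decomposes nu g D ->
  (forall x, I01 x -> g x = m) -> is_kRSB xi 1.
Proof.
move=> m0 par dec gE.
pose rho : measureR := mscale (NngNum (ltW m0)) (dirac (0 : measurableTypeR R)).
have rhoE (A : set R) : rho A = (m%:E * ((0%R \in A)%:R)%:E)%E by [].
exists nu, g, D, rho; split=> //.
- split.
    by rewrite rhoE memNset ?mule0 //= in_itv /= lexx ltr01; apply.
  move=> x; rewrite in_itv /= => x01; rewrite rhoE gE /= ?in_itv //.
  by rewrite mem_set ?mule1 //= in_itv /= lexx; case/andP: x01.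
- rewrite (_ : support01 _ = [set 0]) ?card_set1 //.
  apply/seteqP; split => x.
    move=> [x01 /(_ (~` [set 0])) H]; apply: contrapT => x0.
    have : (0 < rho (~` [set 0%R]))%E.
      apply: H => //; apply: closed_openC; exact: closed_eq.
    by rewrite rhoE memNset ?mule0 ?ltxx //; apply.
  move=> ->; split; first by rewrite in_itv /= lexx ltr01.
  by move=> U _ U0; rewrite rhoE mem_set // mule1 lte_fin.
Qed.

(** The minimizer has the constant density z D and the atom D, with D chosen so that
    its tail to the power -2 is the derivative of the profile A x / (1 + z (1 - x)).
    The equation A * pmass z = 1 says that xi' and the profile have the same
    integral against it, and the inequality that the profile has smaller integrals
    over the intervals [u, 1). *)
Lemma kRSB1_of_certificate p s (l z : R) : 0 <= l <= 1 -> 0 < z -> 0 < slope1 p s l ->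
  mixture p s l 0 = 0 -> slope1 p s l * pmass z = 1 ->
  (forall u, 0 <= u <= 1 -> mixture p s l u <= slope1 p s l * (pprim z u - pprim z 0)) ->
  is_kRSB (mixture p s l) 1.
Proof.
set A := slope1 p s l => l01 z0 A0 xi0 Az cert.
have Az0 : 0 < A * (1 + z) by rewrite mulr_gt0 // addr_gt0.
pose D : R := Num.sqrt (A * (1 + z))^-1.
have D0 : 0 < D by rewrite sqrtr_gt0 invr_gt0.
have D2 : D ^+ 2 = (A * (1 + z))^-1 by rewrite sqr_sqrtr // invr_ge0 ltW.
have m0 : 0 < z * D by rewrite mulr_gt0.
have i0 : 0 <= (0 : R) < 1 by rewrite lexx ltr01.
have [nu dec] := @two_step_decomposes R 0 0 (z * D) 0 D (ltW m0) (lexx 0) D0.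
apply: (kRSB1_of_constant_density m0 _ dec) => [|x]; last first.
  by rewrite /= in_itv /= /two_step => /andP[-> _]; rewrite mulr1 mul0r addr0.
have den0 x : 0 <= x <= 1 -> 0 < 1 + z * (1 - x) by apply: den_gt0; exact: ltW.
have tailA u : 0 <= u <= 1 ->
    (\int[mu]_(x in `[u, 1%R[) (profile A z x)%:E = (A * pprim z 1 - A * pprim z u)%:E)%E.
  by move=> /andP[u0 u1]; rewrite integral_profile.
have pprim01 : A * pprim z 1 - A * pprim z 0 = 1.
  by rewrite -mulrBr pprim_pmass ?gt_eqF.
have mprof : measurable_fun C01 (profile A z).
  apply: (measurable_of_derive (f := dprofile A z)) => x xI.
  by apply: is_derive_profile; rewrite gt_eqF // den0.
have profile1 : profile A z 1 = A by rewrite /profile subrr mulr0 addr0 divr1 mulr1.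
have prof0 x : 0 <= x <= 1 -> 0 <= profile A z x by move=> xI; rewrite profile_ge0 // ltW.
have dmix0 x : 0 <= x <= 1 -> 0 <= dmixture p s l x.
  by move=> /andP[x0 _]; rewrite dmixture_ge0.
apply: (@optimality _ _ (dmixture p s l) (fun x => D * (1 + z * (1 - x)))
  (dprofile A z \_ `[0%R, 1%R]) (profile A z) _ _ _ _ dec) => //.
- exact: derive1_mixture.
- move=> x xI; rewrite (two_step_tail dec i0 i0 (ltW m0) (lexx 0) (fun _ _ => erefl) xI).
  rewrite mul0r addr0 /ramp max_l; last by move: xI; rewrite /= in_itv /= => /andP[].
  by congr (_%:E); ring.
- move=> x; rewrite /= in_itv /= => /andP[x0 x1].
  by rewrite mulr_gt0 // den0 // x0 ltW.
- apply/(measurable_restrictT _ _).1 => //; apply: subspace_continuous_measurable_fun => //.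
  apply: derivable_within_continuous => x; rewrite in_itv /= => xt.
  by apply: derivable_dprofile; rewrite gt_eqF // den0.
- move=> x; rewrite patchE; case: ifPn => // _.
  by rewrite divr_ge0 ?sqr_ge0 // ltW.
- move=> x xI; rewrite patchE mem_set; last first.
    by move: xI; rewrite /= !in_itv /= => /andP[-> /ltW].
  by rewrite exprMn D2 invfM invrK.
- move=> t t01; rewrite -(integral_dprofile A z0 t01); apply: eq_integral => x.
  rewrite inE /= in_itv /= => /andP[x0 xt]; rewrite patchE mem_set //=.
  by rewrite in_itv /= x0 (le_trans (ltW xt)) //; case/andP: t01.
- have I f := @two_step_integral01 _ nu _ D 0 0 (z * D) 0 dec i0 i0 (ltW m0) (lexx 0)
    (fun _ _ => erefl) f.
  rewrite (I _ (@measurable_dmixture p s l) dmix0) (I _ mprof prof0).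
  rewrite integral_dmixture ?ler01 // tailA ?lexx ?ler01 //.
  by rewrite mixture1 xi0 subr0 pprim01 profile1 dmixture1.
- move=> m'' g D'' dec''; apply: (tail_order dec'') => //.
  + exact: measurable_dmixture.
  + by rewrite profile1 dmixture1.
  + move=> u u01; rewrite tailA // integral_dmixture; last by case/andP: u01.
    rewrite lee_fin mixture1; have := cert u u01; rewrite mulrBr; move: pprim01; lra.
Qed.

End Sufficiency.

(** * Stationarity conditions for a minimizer with a single jump *)

Section Stationarity.
Context {R : realType}.
Notation mu := (@lebesgue_measure R).
Notation I01 := (`[0%R, 1%R[%classic : set R).
Notation measureR := ({measure set (measurableTypeR R) -> \bar R}).

Lemma bounded_integral01 (f : R -> R) (M : R) : measurable_fun I01 f ->
  (forall x, I01 x -> 0 <= f x <= M) ->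
  exists r, (\int[mu]_(x in I01) (f x)%:E = r%:E)%E.
Proof.
move=> mf f0.
have mfE : measurable_fun I01 (fun x => (f x)%:E) by exact/measurable_EFinP.
have f0E x : I01 x -> (0 <= (f x)%:E)%E by move=> /f0 /andP[]; rewrite lee_fin.
have le : (\int[mu]_(x in I01) (f x)%:E <= (M * (1 - 0))%:E)%E.
  apply: integral_le_const => //.
    have := f0 0; rewrite /= in_itv /= lexx ltr01 => /(_ isT) /andP[]; exact: le_trans.
have ge : (0 <= \int[mu]_(x in I01) (f x)%:E)%E by exact: integral_ge0.
move: le ge; case: (\int[mu]_(x in I01) (f x)%:E)%E => [r| |] // _ _; by exists r.
Qed.

Lemma ramp_ge0 (u x : R) : u < 1 -> I01 x -> 0 <= ramp u x.
Proof. by move=> u1; rewrite /= in_itv /= => /andP[_ x1]; rewrite subr_ge0 ge_max !ltW. Qed.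

Lemma ramp_le1 (u x : R) : I01 x -> ramp u x <= 1.
Proof. by rewrite /= in_itv /= => /andP[x0 _]; rewrite lerBlDr lerDl le_max x0. Qed.

Lemma ramp_anti (u x y : R) : x <= y -> ramp u y <= ramp u x.
Proof. by move=> xy; rewrite lerB // ge_max !le_max xy lexx orbT. Qed.

Lemma measurable_ramp (u : R) : measurable_fun I01 (ramp u).
Proof.
have m : measurable_fun I01 (fun x => - ramp u x).
  by apply: monotone_measurable_itv => x y _ _ xy; rewrite lerN2 ramp_anti.
rewrite (_ : ramp u = fun x => - - ramp u x); first exact: measurableT_comp.
by apply/funext => x; rewrite opprK.
Qed.

(** The mass of (x, 1] in [two_step_tail]. *)
Definition tail2 (D m x0 a u x : R) : R := D + m * ramp x0 x + a * ramp u x.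

Lemma tail2_ge (D m x0 a u x : R) : 0 <= m -> 0 <= a -> x0 < 1 -> u < 1 -> I01 x ->
  D <= tail2 D m x0 a u x.
Proof. by move=> m0 a0 x01 u1 xI; rewrite /tail2 -addrA lerDl addr_ge0 // mulr_ge0 // ramp_ge0. Qed.

Lemma measurable_tail2V (D m x0 a u : R) : 0 < D -> 0 <= m -> 0 <= a -> x0 < 1 -> u < 1 ->
  measurable_fun I01 (fun x => (tail2 D m x0 a u x)^-1).
Proof.
move=> D0 m0 a0 x01 u1; apply: monotone_measurable_itv => x y xI yI xy.
have pos z : I01 z -> 0 < tail2 D m x0 a u z by move=> zI; rewrite (lt_le_trans D0) // tail2_ge.
rewrite lef_pV2 ?posrE; [|exact: pos|exact: pos].
by rewrite /tail2 lerD ?lerD2l // ler_wpM2l // ramp_anti.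
Qed.

Lemma tail2V_integral (D m x0 a u : R) : 0 < D -> 0 <= m -> 0 <= a -> x0 < 1 -> u < 1 ->
  exists J, (\int[mu]_(x in I01) ((tail2 D m x0 a u x)^-1)%:E = J%:E)%E.
Proof.
move=> D0 m0 a0 x01 u1; apply: (bounded_integral01 (M := D^-1)); first exact: measurable_tail2V.
move=> x xI; have h := tail2_ge D m0 a0 x01 u1 xI; have h0 := lt_le_trans D0 h.
by rewrite invr_ge0 ltW //= lef_pV2.
Qed.

Variables (p s : nat) (l : R).
Hypotheses (hp : (2 < p)%N) (hps : (p <= s)%N) (l01 : 0 <= l <= 1).
Notation xi := (mixture p s l).

Lemma mixture_le1 x : 0 <= x < 1 -> xi x <= 1.
Proof.
move=> /andP[x0 x1]; case/andP: l01 => l0 l1; rewrite /mixture.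
have := @exprn_ile1 _ p x x0 (ltW x1); have := @exprn_ile1 _ s x x0 (ltW x1).
move: (x ^+ p) (x ^+ s) => P S S1 P1.
apply: (@le_trans _ _ (l * 1 + (1 - l) * 1)); last by rewrite !mulr1 addrC subrK.
by apply: lerD; apply: ler_wpM2l => //; rewrite subr_ge0.
Qed.

Lemma Qfun_two_step (nu : measureR) g (D m x0 a u J : R) : decomposes nu g D ->
  0 <= x0 < 1 -> 0 <= u < 1 -> 0 <= m -> 0 <= a ->
  (forall x, I01 x -> g x = two_step x0 u m a x) ->
  (\int[mu]_(x in I01) ((tail2 D m x0 a u x)^-1)%:E = J%:E)%E ->
  Qfun xi nu = (2^-1 * (m * (1 - xi x0) + a * (1 - xi u) + D * slope1 p s l + J))%:E.
Proof.
move=> dec x01 u01 m0 a0 gE JE; have D0 := dec_gt0 dec.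
rewrite (Qfun_half dec (derive1_mixture p s l)) EFinM; congr (_ * _)%E.
rewrite (two_step_integral01 dec x01 u01 m0 a0 gE (@measurable_dmixture _ p s l)); last first.
  by move=> x /andP[x00 _]; exact: dmixture_ge0.
rewrite !integral_dmixture; [|by case/andP: u01 => _ /ltW|by case/andP: x01 => _ /ltW].
rewrite mixture1 dmixture1 -!EFinM -!EFinD [RHS]EFinD; congr (_ + _)%E; rewrite -JE.
apply: eq_integral => x; rewrite inE => xI.
rewrite (two_step_tail dec x01 u01 m0 a0 gE xI) inver gt_eqF //.
apply: lt_le_trans D0 _; apply: tail2_ge => //; [by case/andP: x01|by case/andP: u01].
Qed.

(** First order expansion of the inverse: 1 / (h + t eta) = 1 / h - t eta / h^2 + R with
    R = t^2 eta^2 / (h^2 (h + t eta)). *)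
Lemma inverse_expansion (D h t eta M : R) : 0 < D -> D <= h -> 0 <= t -> 0 <= eta -> eta <= M ->
  (h + t * eta)^-1 + t * (eta / h ^+ 2) <= h^-1 + t ^+ 2 * (M ^+ 2 / D ^+ 3).
Proof.
move=> D0 Dh t0 e0 eM; have h0 := lt_le_trans D0 Dh.
have ht : h <= h + t * eta by rewrite lerDl mulr_ge0.
have ht0 := lt_le_trans h0 ht.
have -> : (h + t * eta)^-1 + t * (eta / h ^+ 2) =
    h^-1 + t ^+ 2 * (eta ^+ 2 / (h ^+ 2 * (h + t * eta))).
  by field; rewrite !gt_eqF.
rewrite lerD2l ler_wpM2l ?sqr_ge0 //; apply: ler_pM; rewrite ?sqr_ge0 //.
- by rewrite invr_ge0 mulr_ge0 ?sqr_ge0 // ltW.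
- by rewrite lerXn2r // nnegrE (le_trans e0).
rewrite lef_pV2 ?posrE ?mulr_gt0 ?exprn_gt0 // exprSr.
apply: ler_pM; rewrite ?sqr_ge0 ?(ltW D0) //; last exact: le_trans ht.
by rewrite lerXn2r ?nnegrE ?(ltW D0) ?(ltW h0).
Qed.

Section Minimizer.
Variables (nu : measureR) (g : R -> R) (D m x0 : R).
Hypotheses (par : is_parisi_measure xi nu) (dec : decomposes nu g D) (x01 : 0 <= x0 < 1)
  (m0 : 0 < m) (gE : forall x, I01 x -> g x = m * (x0 <= x)%R%:R).

Definition tail1 (D m x0 x : R) : R := D + m * ramp x0 x.
Let h := tail1 D m x0.
Let D0 : 0 < D := dec_gt0 dec.
Let x0lt1 : x0 < 1. Proof. by case/andP: x01. Qed.

Let hE x : h x = tail2 D m x0 0 x0 x.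
Proof. by rewrite /h /tail1 /tail2 mul0r addr0. Qed.

Lemma tail1_ge x : I01 x -> D <= h x.
Proof. by move=> xI; rewrite hE tail2_ge // ltW. Qed.

Lemma tail1_gt0 x : I01 x -> 0 < h x.
Proof. by move=> /tail1_ge; exact: lt_le_trans. Qed.

Let J : R := sval (cid (tail2V_integral D0 (ltW m0) (lexx 0) x0lt1 x0lt1)).
Let JE : (\int[mu]_(x in I01) ((tail2 D m x0 0 x0 x)^-1)%:E = J%:E)%E.
Proof. by rewrite /J; case: cid. Qed.

Let QJ : Qfun xi nu = (2^-1 * (m * (1 - xi x0) + D * slope1 p s l + J))%:E.
Proof.
rewrite (@Qfun_two_step _ _ _ m x0 0 x0 J dec) //; last 2 first.
- exact: ltW.
- by move=> x xI; rewrite gE // /two_step mul0r addr0.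
by rewrite mul0r addr0.
Qed.

Let measurable_hV : measurable_fun I01 (fun x => (h x)^-1).
Proof.
rewrite (_ : (fun x => (h x)^-1) = fun x => (tail2 D m x0 0 x0 x)^-1).
  by apply: measurable_tail2V => //; exact: ltW.
by apply/funext => x; rewrite hE.
Qed.

Let competitor (D' m' a u J' : R) : 0 < D' -> 0 <= m' -> 0 <= a -> 0 <= u < 1 ->
  (\int[mu]_(x in I01) ((tail2 D' m' x0 a u x)^-1)%:E = J'%:E)%E ->
  m * (1 - xi x0) + D * slope1 p s l + J <=
  m' * (1 - xi x0) + a * (1 - xi u) + D' * slope1 p s l + J'.
Proof.
move=> D'0 m'0 a0 u01 J'E.
have [nu' dec'] := @two_step_decomposes R x0 u m' a D' m'0 a0 D'0.
have /(_ nu') := par.2; rewrite QJ (Qfun_two_step dec' x01 u01 m'0 a0 _ J'E) //.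
move=> /(_ (ex_intro _ _ (ex_intro _ _ dec'))); rewrite lee_fin.
by rewrite ler_pM2l // invr_gt0.
Qed.

(** Comparison with r nu gives S + J <= r S + J / r for all r > 0, S and J being the
    two integrals in the functional at nu.  At r = sqrt (J / S) the right-hand
    side is 2 sqrt (S J). *)
Lemma scaling_stationary : m * (1 - xi x0) + D * slope1 p s l = J.
Proof.
set S := m * _ + _.
have main r : 0 < r -> S + J <= r * S + r^-1 * J.
  move=> r0.
  have := @competitor (r * D) (r * m) 0 x0 (r^-1 * J); rewrite mul0r addr0 -!mulrA -mulrDr.
  apply => //.
  - by rewrite mulr_gt0.
  - by rewrite mulr_ge0 ?ltW.
  rewrite EFinM -JE -ge0_integralZl //; last 3 first.
  - apply/measurable_EFinP; apply: measurable_tail2V => //; exact: ltW.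
  - by move=> x xI; rewrite lee_fin invr_ge0 -hE ltW // tail1_gt0.
  - by rewrite lee_fin invr_ge0 ltW.
  apply: eq_integral => x _; rewrite -EFinM; congr (_%:E).
  by rewrite -invfM; congr (_^-1); rewrite /tail2; ring.
have S0 : 0 < S.
  rewrite ltr_wpDl // ?mulr_gt0 //; last first.
    by apply: lt_le_trans (slope1_ge3 hp hps l01).
  by rewrite mulr_ge0 ?(ltW m0) // subr_ge0 mixture_le1.
have J0 : 0 < J.
  rewrite lt_neqAle; apply/andP; split; last first.
    rewrite -lee_fin -JE; apply: integral_ge0 => x xI.
    by rewrite lee_fin invr_ge0 -hE ltW // tail1_gt0.
  apply/negP => /eqP J0; have := main 2^-1; rewrite -J0 mulr0 !addr0 invr_gt0.
  by move=> /(_ (ltr0n _ 2)); rewrite ler_pMl // leNgt invf_lt1 ?ltr1n ?ltr0n.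
have sqrt_pos (r : R) : 0 < r -> exists2 q, 0 < q & r = q ^+ 2.
  by move=> r0; exists (Num.sqrt r); rewrite ?sqrtr_gt0 // sqr_sqrtr // ltW.
have [a a0 Sa] := sqrt_pos S S0; have [b b0 Jb] := sqrt_pos J J0.
have := main _ (divr_gt0 b0 a0); rewrite invf_div Sa Jb.
have -> : b / a * a ^+ 2 = a * b by field; rewrite gt_eqF.
have -> : a / b * b ^+ 2 = a * b by field; rewrite gt_eqF.
move=> H; have : (a - b) ^+ 2 <= 0 by rewrite sqrrB -mulr_natr; lra.
by rewrite real_exprn_even_le0 ?num_real //= subr_eq0 => /eqP->.
Qed.

(** Adding to nu the multiple t of a measure, here a times the Lebesgue measure of
    [u, 1) plus b times the Dirac mass at 1, costs t times the right-hand side and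
    gains t times the left-hand side, up to O(t^2). *)
Lemma first_variation (u a b : R) : 0 <= u < 1 -> 0 <= a -> 0 <= b ->
  (\int[mu]_(x in I01) ((a * ramp u x + b) / h x ^+ 2)%:E <=
   (a * (1 - xi u) + b * slope1 p s l)%:E)%E.
Proof.
move=> u01 a0 b0; have u1 : u < 1 by case/andP: u01.
set c := a * _ + _.
pose eta x := a * ramp u x + b.
have eta0 x : I01 x -> 0 <= eta x by move=> xI; rewrite addr_ge0 // mulr_ge0 // ramp_ge0.
have etab x : I01 x -> eta x <= a + b.
  by move=> xI; rewrite lerD2r (ler_piMr a0 (ramp_le1 u xI)).
have meta : measurable_fun I01 eta.
  by apply: measurable_funD => //; apply: measurable_funM => //; exact: measurable_ramp.
have mhV := measurable_hV.
have mT : measurable_fun I01 (fun x => eta x / h x ^+ 2).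
  rewrite (_ : (fun x => eta x / h x ^+ 2) = fun x => eta x * ((h x)^-1 * (h x)^-1)).
    by apply: measurable_funM => //; exact: measurable_funM.
  by apply/funext => x; rewrite expr2 invfM.
have T0 x : I01 x -> 0 <= eta x / h x ^+ 2.
  by move=> xI; rewrite divr_ge0 ?eta0 // sqr_ge0.
have [T TE] : exists T, (\int[mu]_(x in I01) (eta x / h x ^+ 2)%:E = T%:E)%E.
  apply: (bounded_integral01 (M := (a + b) / D ^+ 2)) => // x xI; rewrite T0 //=.
  apply: ler_pM; rewrite ?eta0 ?etab ?invr_ge0 ?sqr_ge0 //.
  have hx := tail1_ge xI; have hx0 := tail1_gt0 xI.
  by rewrite lef_pV2 ?posrE ?exprn_gt0 // lerXn2r ?nnegrE ?(ltW D0) ?(ltW hx0).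
rewrite -/(eta _) TE lee_fin; apply/ler_addgt0Pr => e e0.
pose C := (a + b) ^+ 2 / D ^+ 3.
have C0 : 0 <= C by rewrite divr_ge0 ?sqr_ge0 // exprn_ge0 // ltW.
pose t := e / (C + 1).
have t0 : 0 < t by rewrite divr_gt0 // ltr_wpDl.
have tC : t * C <= e.
  rewrite /t mulrAC ler_pdivrMr ?ltr_wpDl // ler_wpM2l ?lerDl //; exact: ltW.
have D'0 : 0 < D + t * b by rewrite ltr_wpDr // mulr_ge0 // ltW.
have ta0 : 0 <= t * a by rewrite mulr_ge0 // ltW.
have [J' J'E] := tail2V_integral D'0 (ltW m0) ta0 x0lt1 u1.
have := competitor D'0 (ltW m0) ta0 u01 J'E.
have tailE' x : tail2 (D + t * b) m x0 (t * a) u x = h x + t * eta x.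
  by rewrite /tail2 /h /tail1 /eta; ring.
have ht0 x : I01 x -> 0 < h x + t * eta x.
  by move=> xI; rewrite ltr_wpDr ?tail1_gt0 // mulr_ge0 ?eta0 // ltW.
have : J' + t * T <= J + t ^+ 2 * C.
  have cI r : (\int[mu]_(x in I01) r%:E = r%:E)%E.
    by rewrite integral_cst //= lebesgue_measure_itv /= lte_fin ltr01 oppr0 adde0 mule1.
  have mtT : measurable_fun I01 (fun x => (t * (eta x / h x ^+ 2))%:E).
    by apply/measurable_EFinP; apply: measurable_funM.
  have mJ' := measurable_tail2V D'0 (ltW m0) ta0 x0lt1 u1.
  have tTE : (\int[mu]_(x in I01) (t * (eta x / h x ^+ 2))%:E = (t * T)%:E)%E.
    rewrite EFinM -TE -ge0_integralZl //.
    - exact/measurable_EFinP.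
    - by rewrite lee_fin ltW.
  rewrite -lee_fin !EFinD -J'E -tTE -(cI (t ^+ 2 * C)) -JE.
  have mJ'E : measurable_fun I01 (fun x => ((tail2 (D + t * b) m x0 (t * a) u x)^-1)%:E).
    exact/measurable_EFinP.
  have mJE : measurable_fun I01 (fun x => ((tail2 D m x0 0 x0 x)^-1)%:E).
    by apply/measurable_EFinP; apply: measurable_tail2V => //; exact: ltW.
  have J'0 x : I01 x -> (0 <= ((tail2 (D + t * b) m x0 (t * a) u x)^-1)%:E)%E.
    by move=> xI; rewrite lee_fin tailE' invr_ge0 ltW // ht0.
  have Jx0 x : I01 x -> (0 <= ((tail2 D m x0 0 x0 x)^-1)%:E)%E.
    by move=> xI; rewrite lee_fin -hE invr_ge0 ltW // tail1_gt0.
  have tT0 x : I01 x -> (0 <= (t * (eta x / h x ^+ 2))%:E)%E.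
    by move=> xI; rewrite lee_fin mulr_ge0 ?T0 // ltW.
  have t2C0 : (0 <= (t ^+ 2 * C)%:E)%E by rewrite lee_fin mulr_ge0 // sqr_ge0.
  rewrite -!ge0_integralD //.
  apply: ge0_le_integral => //.
  - by move=> x xI; rewrite adde_ge0 ?J'0 ?tT0.
  - exact: emeasurable_funD.
  - exact: emeasurable_funD.
  move=> x xI; rewrite -!EFinD lee_fin tailE' -hE.
  exact: inverse_expansion D0 (tail1_ge xI) (ltW t0) (eta0 _ xI) (etab _ xI).
have t2 : t ^+ 2 * C <= t * e by rewrite expr2 -mulrA ler_pM2l.
move=> H1 H2; rewrite -(ler_pM2l t0) /c; move: t2 H1 H2.
move: (t ^+ 2 * C) (xi u) (xi x0) => q v w.
lra.
Qed.

Lemma measurable_hV2 : measurable_fun I01 (fun x => h x ^- 2).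
Proof.
rewrite (_ : (fun x => h x ^- 2) = fun x => ((h x)^-1 * (h x)^-1)).
  exact: measurable_funM.
by apply/funext => x; rewrite expr2 invfM.
Qed.

Lemma measurable_rampV2 u : measurable_fun I01 (fun x => ramp u x / h x ^+ 2).
Proof. by apply: measurable_funM; [exact: measurable_ramp|exact: measurable_hV2]. Qed.

Lemma ramp_variation u : 0 <= u < 1 ->
  (\int[mu]_(x in I01) (ramp u x / h x ^+ 2)%:E <= (1 - xi u)%:E)%E.
Proof.
move=> u01; have := first_variation u01 ler01 (lexx 0).
by under eq_integral do rewrite mul1r addr0; rewrite mul0r addr0 mul1r.
Qed.

(** Both equalities hold as inequalities by [first_variation]; weighted by m and D
    these add up to [scaling_stationary], which is an equality. *)
Lemma stationary :
  (\int[mu]_(x in I01) (ramp x0 x / h x ^+ 2)%:E = (1 - xi x0)%:E)%E /\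
  (\int[mu]_(x in I01) (h x ^- 2)%:E = (slope1 p s l)%:E)%E.
Proof.
have v1 := ramp_variation x01.
have v2 := first_variation x01 (lexx 0) ler01.
have {}v2 : (\int[mu]_(x in I01) (h x ^- 2)%:E <= (slope1 p s l)%:E)%E.
  move: v2; under eq_integral do rewrite mul0r add0r mul1r.
  by rewrite mul0r add0r mul1r.
have p1 x : I01 x -> (0 <= (ramp x0 x / h x ^+ 2)%:E)%E.
  by move=> xI; rewrite lee_fin divr_ge0 ?sqr_ge0 // ramp_ge0.
have p2 x : I01 x -> (0 <= (h x ^- 2)%:E)%E.
  by move=> xI; rewrite lee_fin invr_ge0 sqr_ge0.
have m1 : measurable_fun I01 (fun x => (ramp x0 x / h x ^+ 2)%:E).
  by apply/measurable_EFinP; exact: measurable_rampV2.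
have m2 : measurable_fun I01 (fun x => (h x ^- 2)%:E).
  by apply/measurable_EFinP; exact: measurable_hV2.
have E : (m%:E * \int[mu]_(x in I01) (ramp x0 x / h x ^+ 2)%:E +
    D%:E * \int[mu]_(x in I01) (h x ^- 2)%:E = J%:E)%E.
  rewrite -JE -!ge0_integralZl //; [|by rewrite lee_fin ltW|by rewrite lee_fin ltW].
  rewrite -ge0_integralD //; last 4 first.
  - by move=> x xI; rewrite mule_ge0 ?p1 // lee_fin ltW.
  - by apply: emeasurable_funM.
  - by move=> x xI; rewrite mule_ge0 ?p2 // lee_fin ltW.
  - by apply: emeasurable_funM.
  apply: eq_integral => x; rewrite inE => xI; rewrite -hE -!EFinM -EFinD; congr (_%:E).
  have hx := tail1_gt0 xI; rewrite [RHS](_ : _ = h x / h x ^+ 2); last by field; rewrite gt_eqF.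
  by rewrite /h /tail1; ring.
have g1 : (0 <= \int[mu]_(x in I01) (ramp x0 x / h x ^+ 2)%:E)%E by exact: integral_ge0.
have g2 : (0 <= \int[mu]_(x in I01) (h x ^- 2)%:E)%E by exact: integral_ge0.
move: E v1 v2 g1 g2.
case: (\int[mu]_(x in I01) (ramp x0 x / h x ^+ 2)%:E)%E => [t1| |] //.
case: (\int[mu]_(x in I01) (h x ^- 2)%:E)%E => [t2| |] //.
rewrite -!EFinM -EFinD -scaling_stationary => -[E]; rewrite !lee_fin => v1 v2 _ _.
have w1 : m * t1 <= m * (1 - xi x0) by rewrite ler_pM2l.
have w2 : D * t2 <= D * slope1 p s l by rewrite ler_pM2l.
split; congr (_%:E).
  by apply/(mulfI (lt0r_neq0 m0))/eqP; rewrite eq_le w1 /=; move: E w2; lra.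
by apply/(mulfI (lt0r_neq0 D0))/eqP; rewrite eq_le w2 /=; move: E w1; lra.
Qed.

End Minimizer.
End Stationarity.

(** * The jump of a single-jump minimizer is at 0 *)

Section SingleJump.
Context {R : realType}.
Notation mu := (@lebesgue_measure R).
Notation I01 := (`[0%R, 1%R[%classic : set R).
Notation measureR := ({measure set (measurableTypeR R) -> \bar R}).

Lemma dmixture_ndecr p s (l x y : R) : 0 <= l <= 1 -> 0 <= x -> x <= y ->
  dmixture p s l x <= dmixture p s l y.
Proof.
move=> /andP[l0 l1] x0 xy; have y0 := le_trans x0 xy.
by apply: lerD; apply: ler_wpM2l; rewrite ?subr_ge0 //; apply: ler_wpM2l => //;
  apply: lerXn2r; rewrite ?nnegrE.
Qed.

(** Euler's identity for the two monomials, whose degrees exceed 2. *)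
Lemma mixture_euler p s (l x : R) : (2 < p)%N -> (p <= s)%N -> 0 <= l <= 1 -> 0 < x ->
  2 * mixture p s l x < x * dmixture p s l x.
Proof.
move=> hp hps /andP[l0 l1] x0.
have S3 : (2 < s)%N by exact: leq_trans hps.
have E n : (0 < n)%N -> x * (n%:R * x ^+ n.-1) = n%:R * x ^+ n.
  by move=> n0; rewrite mulrCA -exprS prednK.
have e1 := E p (ltn_trans (isT : 0 < 2)%N hp); have e2 := E s (ltn_trans (isT : 0 < 2)%N S3).
rewrite /mixture /dmixture (mulrDr x) (mulrCA x l) (mulrCA x (1 - l)) e1 e2.
have P3 : 3 <= p%:R :> R by rewrite ler_nat.
have S3' : 3 <= s%:R :> R by rewrite ler_nat.
have xp : 0 < x ^+ p by rewrite exprn_gt0.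
have xs : 0 < x ^+ s by rewrite exprn_gt0.
move: (x ^+ p) (x ^+ s) (p%:R) (s%:R) P3 S3' xp xs => X Y P S P3 S3' X0 Y0.
have a1 : 3 * X <= P * X by rewrite ler_pM2r.
have a2 : 3 * Y <= S * Y by rewrite ler_pM2r.
have b1 : l * (3 * X) <= l * (P * X) by rewrite ler_wpM2l.
have b2 : (1 - l) * (3 * Y) <= (1 - l) * (S * Y) by rewrite ler_wpM2l // subr_ge0.
have pos : 0 < l * X + (1 - l) * Y.
  case: (eqVneq l 0) => [->|ln]; first by rewrite mul0r add0r subr0 mul1r.
  have lp : 0 < l by rewrite lt0r ln.
  by apply: ltr_pwDl; [rewrite mulr_gt0|rewrite mulr_ge0 ?subr_ge0 // ltW].
by move: b1 b2 pos; rewrite !mulrDr; lra.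
Qed.

Section Minimizer.
Variables (p s : nat) (l : R).
Hypotheses (hp : (2 < p)%N) (hps : (p <= s)%N) (l01 : 0 <= l <= 1).
Notation xi := (mixture p s l).
Variables (nu : measureR) (g : R -> R) (D m x0 : R).
Hypotheses (par : is_parisi_measure xi nu) (dec : decomposes nu g D) (x01 : 0 <= x0 < 1)
  (m0 : 0 < m) (gE : forall x, I01 x -> g x = m * (x0 <= x)%R%:R).
Let D0 : 0 < D := dec_gt0 dec.
Notation h := (tail1 D m x0).
Let c := D + m * (1 - x0).

Let h_left x : x <= x0 -> h x = c.
Proof. by move=> xx0; rewrite /tail1 /ramp max_r. Qed.

Let c0 : 0 < c.
Proof. by rewrite ltr_wpDr // mulr_ge0 ?(ltW m0) // subr_ge0 ltW //; case/andP: x01. Qed.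

Let rampD (u v x : R) : u <= v -> ramp u x / h x ^+ 2 =
  ramp v x / h x ^+ 2 + (Num.max x v - Num.max x u) / h x ^+ 2.
Proof. by move=> uv; rewrite -mulrDl; congr (_ / _); rewrite /ramp; ring. Qed.

Let max_mono (u v x : R) : u <= v -> 0 <= Num.max x v - Num.max x u.
Proof. by move=> uv; rewrite subr_ge0 ge_max !le_max lexx uv orbT. Qed.

Let diff_meas (u v : R) : u <= v ->
  measurable_fun I01 (fun x => ((Num.max x v - Num.max x u) / h x ^+ 2)%:E).
Proof.
move=> uv; apply/measurable_EFinP.
rewrite (_ : (fun x => (Num.max x v - Num.max x u) / h x ^+ 2) =
  fun x => ramp u x / h x ^+ 2 - ramp v x / h x ^+ 2).
  by apply: measurable_funB; exact: (measurable_rampV2 dec x01 m0).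
by apply/funext => x; rewrite (rampD x uv); ring.
Qed.

Let integral_rampD (u v : R) : u <= v -> u < 1 -> v < 1 ->
  (\int[mu]_(x in I01) (ramp u x / h x ^+ 2)%:E =
   \int[mu]_(x in I01) (ramp v x / h x ^+ 2)%:E +
   \int[mu]_(x in I01) ((Num.max x v - Num.max x u) / h x ^+ 2)%:E)%E.
Proof.
move=> uv u1 v1; rewrite -ge0_integralD //.
- by apply: eq_integral => x _; rewrite -EFinD -rampD.
- by move=> x xI; rewrite lee_fin divr_ge0 ?sqr_ge0 // ramp_ge0.
- by apply/measurable_EFinP; exact: (measurable_rampV2 dec x01 m0).
- by move=> x xI; rewrite lee_fin divr_ge0 ?sqr_ge0 // max_mono.
- exact: diff_meas.
Qed.

Let TE : (\int[mu]_(x in I01) (ramp x0 x / h x ^+ 2)%:E = (1 - xi x0)%:E)%E.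
Proof. by have [] := stationary hp hps l01 par dec x01 m0 gE. Qed.

(** The tail is the constant c on [0, x0].  The variations at 0 and at x0, the second
    one being an equality, differ by the integral of (x0 - x) / c^2 over
    [0, x0]. *)
Lemma mass_below_jump : x0 ^+ 2 / (2 * c ^+ 2) <= xi x0.
Proof.
have [x00 x01'] := andP x01.
have v0 := ramp_variation l01 par dec x01 m0 gE (u := 0); rewrite lexx ltr01 in v0.
have {}v0 := v0 isT.
have xi0 : xi 0 = 0 := mixture0 l (p_gt0 hp) (s_gt0 hp hps).
rewrite (integral_rampD x00 ltr01 x01') TE xi0 subr0 in v0.
have : ((x0 ^+ 2 / (2 * c ^+ 2))%:E <=
   \int[mu]_(x in I01) ((Num.max x x0 - Num.max x 0) / h x ^+ 2)%:E)%E.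
  have d (x : R) : is_derive x 1 ((fun y : R => x0 / c ^+ 2 * y ^+ 1) +
      (fun y : R => (- (2 * c ^+ 2)^-1) * y ^+ 2)) ((x0 - x) / c ^+ 2).
    apply: (is_derive_eq (is_deriveD (is_derive_monomial (x0 / c ^+ 2) 1 x)
      (is_derive_monomial (- (2 * c ^+ 2)^-1) 2 x))).
    by rewrite /= expr0 expr1; field; rewrite gt_eqF.
  have cont : {within `[0, x0], continuous (fun x : R => (x0 - x) / c ^+ 2)}.
    apply: derivable_within_continuous => x _.
    have -> : (fun x : R => (x0 - x) / c ^+ 2) = fun y => x0 / c ^+ 2 + (- c ^- 2) * y.
      by apply/funext => y; ring.
    by case: (is_derive_affine (x0 / c ^+ 2) (- c ^- 2) x).
  have I := integral_derivative x00 (fun x _ => d x) cont.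
  apply: (@le_trans _ _ (\int[mu]_(x in `[0%R, x0[) ((x0 - x) / c ^+ 2)%:E)%E).
    rewrite I lee_fin -subr_ge0.
    change (0 <= (x0 / c ^+ 2 * x0 ^+ 1 + - (2 * c ^+ 2)^-1 * x0 ^+ 2) -
       (x0 / c ^+ 2 * 0 ^+ 1 + - (2 * c ^+ 2)^-1 * 0 ^+ 2) - x0 ^+ 2 / (2 * c ^+ 2)).
    by rewrite le_eqVlt; apply/orP; left; apply/eqP; field; rewrite gt_eqF.
  have -> : (\int[mu]_(x in `[0%R, x0[) ((x0 - x) / c ^+ 2)%:E =
      \int[mu]_(x in `[0%R, x0[) ((Num.max x x0 - Num.max x 0) / h x ^+ 2)%:E)%E.
    apply: eq_integral => x; rewrite inE /= in_itv /= => /andP[xx0 xx1].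
    by rewrite h_left ?(ltW xx1) // (max_r (ltW xx1)) (max_l xx0).
  apply: ge0_subset_integral => //.
  - exact: diff_meas.
  - by move=> x xI; rewrite lee_fin divr_ge0 ?sqr_ge0 // max_mono.
  - by apply: subset_itvl; rewrite bnd_simp ltW.
move: v0; case: (\int[mu]_(x in I01) ((Num.max x x0 - Num.max x 0) / h x ^+ 2)%:E)%E => [r| |] //.
rewrite -EFinD !lee_fin; lra.
Qed.

(** The variations at u > x0 and at x0 give xi u - xi x0 <= (u - x0) x0 / c^2 + O((u - x0)^2);
    convexity of xi turns this into a bound for its derivative at x0. *)
Lemma slope_at_jump : dmixture p s l x0 <= x0 / c ^+ 2.
Proof.
have [x00 x01'] := andP x01.
have step (u : R) : x0 < u < 1 -> xi u - xi x0 <= (u - x0) / c ^+ 2 * x0 + (u - x0) / D ^+ 2 * (u - x0).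
  move=> /andP[x0u u1]; have u0 := le_lt_trans x00 x0u.
  have vu := ramp_variation l01 par dec x01 m0 gE (u := u); rewrite (ltW u0) u1 in vu.
  have {}vu := vu isT.
  have E := integral_rampD (ltW x0u) x01' u1; rewrite TE in E.
  have mdiff := diff_meas (ltW x0u).
  have e0 x : (0 <= ((Num.max x u - Num.max x x0) / h x ^+ 2)%:E)%E.
    by rewrite lee_fin divr_ge0 ?sqr_ge0 // max_mono // ltW.
  have mrest (a b : R) : 0 <= a -> b <= 1 -> measurable_fun (`[a, b[%classic : set R)
      (fun x => ((Num.max x u - Num.max x x0) / h x ^+ 2)%:E).
    move=> a0 b1; apply: measurable_funS mdiff => //.
    by apply: subset_itv; rewrite bnd_simp.
  have : (\int[mu]_(x in I01) ((Num.max x u - Num.max x x0) / h x ^+ 2)%:E <=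
      ((u - x0) / c ^+ 2 * (x0 - 0) + (u - x0) / D ^+ 2 * (u - x0) + 0 * (1 - u))%:E)%E.
    rewrite (integral_split (ltW u0) (ltW u1) mdiff (fun x _ => e0 x)).
    rewrite (integral_split x00 (ltW x0u) (mrest 0 u (lexx 0) (ltW u1)) (fun x _ => e0 x)).
    rewrite !EFinD; apply: leeD; [apply: leeD|];
      apply: integral_le_const; rewrite ?(ltW x0u) ?(ltW u1) //.
    - by rewrite divr_ge0 ?sqr_ge0 // subr_ge0 ltW.
    - by apply: mrest => //; exact: ltW.
    - move=> x /andP[xx0 xx1]; rewrite e0 lee_fin (h_left (ltW xx1)).
      by rewrite (max_r (ltW (lt_trans xx1 x0u))) (max_r (ltW xx1)) lexx.
    - by rewrite divr_ge0 ?sqr_ge0 // subr_ge0 ltW.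
    - by apply: mrest => //; exact: ltW.
    - move=> x /andP[xx0 xx1]; rewrite e0 lee_fin.
      rewrite (max_r (ltW xx1)) (max_l xx0) /=.
      have xI : I01 x by rewrite /= in_itv /= (le_trans x00 xx0) (lt_trans xx1 u1).
      have hx := tail1_ge D x01 m0 xI.
      apply: ler_pM; rewrite ?subr_ge0 ?(ltW xx1) ?invr_ge0 ?sqr_ge0 //.
        by rewrite lerD2l lerN2.
      rewrite lef_pV2 ?posrE ?exprn_gt0 // ?(lt_le_trans D0) //.
      by rewrite lerXn2r ?nnegrE ?(ltW D0) ?(le_trans (ltW D0)).
    - by apply: mrest => //; exact: ltW.
    - move=> x /andP[xx0 xx1]; rewrite e0 lee_fin.
      by rewrite (max_l xx0) (max_l (le_trans (ltW x0u) xx0)) subrr mul0r lexx.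
  move: E vu.
  case: (\int[mu]_(x in I01) (ramp u x / h x ^+ 2)%:E)%E => [t| |] //.
  case: (\int[mu]_(x in I01) ((Num.max x u - Num.max x x0) / h x ^+ 2)%:E)%E => [r| |] //.
  rewrite -EFinD => -[E]; rewrite !lee_fin; move: E.
  rewrite subr0 mul0r addr0.
  move: (_ / c ^+ 2 * _) (_ / D ^+ 2 * _) => q1 q2.
  lra.
have conv (u : R) : x0 < u < 1 -> dmixture p s l x0 <= x0 / c ^+ 2 + (u - x0) / D ^+ 2.
  move=> u01; have := step u u01; case/andP: u01 => x0u u1.
  have d0 : 0 < u - x0 by rewrite subr_gt0.
  have := @tangent_below R xi (dmixture p s l) 0 1 x0 u; rewrite x00 (ltW x01') (ltW u1).
  rewrite (le_trans x00 (ltW x0u)) => /(_ isT isT (fun y _ => is_derive_mixture p s l y)).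
  move=> /(_ (fun y z y0 yz _ => dmixture_ndecr p s l01 y0 yz)) T S.
  have {T S} : dmixture p s l x0 * (u - x0) <=
      (u - x0) / c ^+ 2 * x0 + (u - x0) / D ^+ 2 * (u - x0) by move: T S; lra.
  have -> : (u - x0) / c ^+ 2 * x0 + (u - x0) / D ^+ 2 * (u - x0) =
      (x0 / c ^+ 2 + (u - x0) / D ^+ 2) * (u - x0) by ring.
  by rewrite ler_pM2r.
apply/ler_addgt0Pr => e e0.
pose t := Num.min (e * D ^+ 2) ((1 - x0) / 2).
have D20 : 0 < D ^+ 2 by rewrite exprn_gt0.
have t0 : 0 < t by rewrite lt_min mulr_gt0 //= divr_gt0 // subr_gt0.
have t1 : t <= (1 - x0) / 2 by rewrite ge_min lexx orbT.
have te : t <= e * D ^+ 2 by rewrite ge_min lexx.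
have r : x0 < x0 + t < 1 by rewrite ltrDl t0 /=; move: t1 x01'; lra.
apply: (le_trans (conv _ r)); rewrite lerD2l (addrC x0) addrK.
by rewrite ler_pdivrMr.
Qed.

(** If x0 > 0 then xi x0 >= x0^2 / (2 c^2) >= x0 xi'(x0) / 2 > xi x0. *)
Lemma jump_at0 : x0 = 0.
Proof.
have [x00 x01'] := andP x01.
move: x00; rewrite le_eqVlt => /orP[/eqP //|x00].
have := mass_below_jump; have := slope_at_jump.
have xi0 := mixture_euler hp hps l01 x00.
have c20 : 0 < c ^+ 2 by rewrite exprn_gt0.
rewrite -(ler_pM2l x00) => H1 H2.
have E : x0 ^+ 2 / (2 * c ^+ 2) = x0 * (x0 / c ^+ 2) / 2 by field; rewrite gt_eqF.
by move: H1 H2 xi0; rewrite E; move: (x0 * (x0 / c ^+ 2)) (x0 * dmixture _ _ _ _) (xi x0) => a b w; lra.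
Qed.

End Minimizer.
End SingleJump.

(** * A minimizer jumping at 0 requires Psi <= 0 *)

Section Endpoint.
Context {R : realType}.

Variables (p s : nat) (l : R).
Hypotheses (hp : (2 < p)%N) (hps : (p <= s)%N) (l01 : 0 <= l <= 1).
Notation xi := (mixture p s l).

(** The difference E of the two sides of the hypothesis vanishes at 1 together with its
    derivative, which is the difference of xi' and the profile; if the inequality
    failed, its second derivative there would have the sign that makes E positive
    on the left of 1. *)
Lemma endpoint_curvature (A z : R) : 0 < z -> A = slope1 p s l ->
  (forall u, 0 <= u < 1 -> A * pprim z 1 - A * pprim z u <= 1 - xi u) ->
  slope2 p s l <= A * (1 + z).
Proof.
move=> z0 AE H; rewrite leNgt; apply/negP => Bz.
have den0 (x : R) : 0 <= x <= 1 -> 0 < 1 + z * (1 - x) by apply: den_gt0; exact: ltW.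
pose e : R -> R := dmixture p s l - profile A z.
pose de (x : R) := ddmixture p s l x - dprofile A z x.
have d_e (x : R) : 0 <= x <= 1 -> is_derive x 1 e (de x).
  move=> x01; exact: is_deriveB (is_derive_dmixture p s l x)
    (is_derive_profile A (lt0r_neq0 (den0 _ x01))).
have d_E (x : R) : 0 <= x <= 1 -> is_derive x 1 (A \*: pprim z - xi) (- e x).
  move=> x01; have d := is_deriveB (is_deriveZ A (is_derive_pprim (lt0r_neq0 z0) (den0 _ x01)))
    (is_derive_mixture p s l x).
  apply: (is_derive_eq d); rewrite /e /profile /GRing.scale /=.
  change (A * (x / (1 + z * (1 - x))) - dmixture p s l x =
    - (dmixture p s l x - A * (x / (1 + z * (1 - x))))); by rewrite opprB.
have i1 : 0 <= (1 : R) <= 1 by rewrite ler01 lexx.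
have cde : {for 1, continuous de}.
  apply/differentiable_continuous/derivable1_diffP; apply: derivableB.
    exact: derivable_ddmixture.
  by apply: derivable_dprofile; rewrite gt_eqF // den0.
have de1 : 0 < de 1.
  rewrite /de ddmixture1 ?(p_gt0 hp) ?(s_gt0 hp hps) // /dprofile subrr mulr0 addr0 expr1n divr1 subr_gt0 //.
have [r r0 Hr] : exists2 r, 0 < r & forall x : R, `|1 - x| < r -> 0 < de x.
  have nb : nbhs (1 : R) [set x : R | 0 < de x] 
    by exact: (cvgr_gt (de 1) cde _ de1).
  have [r /= r0 Hr] := (nbhs_ballP (1 : R) [set x : R | 0 < de x]).1 nb.
  by exists r => // x xr; apply: Hr.
pose a : R := Num.max 0 (1 - r / 2).
have a0 : 0 <= a by rewrite le_max lexx.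
have ar : 1 - r / 2 <= a by rewrite le_max lexx orbT.
have a1 : a < 1 by rewrite gt_max ltr01 /=; move: r0; lra.
have de_pos (x : R) : a <= x <= 1 -> 0 < de x.
  move=> /andP[ax x1]; apply: Hr; rewrite ger0_norm ?subr_ge0 //.
  by move: ar ax r0; lra.
have sub (x y : R) : a <= x -> x <= y <= 1 -> 0 <= y <= 1.
  by move=> ax /andP[xy ->]; rewrite andbT (le_trans a0) // (le_trans ax).
have e1 : e 1 = 0.
  change (dmixture p s l 1 - profile A z 1 = 0).
  by rewrite dmixture1 /profile subrr mulr0 addr0 divr1 mulr1 AE subrr.
have e_neg (x : R) : a < x < 1 -> 0 < - e x.
  move=> /andP[ax x1]; rewrite oppr_gt0 -e1; apply: (derive_gt0_lt x1 (df := de)).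
    by move=> y yx; apply: d_e; apply: sub yx; exact: ltW.
  move=> y /andP[xy y1]; apply: de_pos; rewrite (ltW y1) andbT.
  by rewrite ltW // (lt_trans ax).
have := derive_gt0_lt a1 (fun x xa => d_E x (sub a x (lexx a) xa)) e_neg.
change (A * pprim z a - xi a < A * pprim z 1 - xi 1 -> False); rewrite mixture1.
have := H a; rewrite a0 a1 => /(_ isT).
move: (A * pprim z 1) (A * pprim z a) (xi a) => u v w; lra.
Qed.

Lemma Psi_le0_of_curvature (z : R) : 0 < z -> slope1 p s l * pmass z = 1 ->
  slope2 p s l <= slope1 p s l * (1 + z) -> Psi p s l <= 0.
Proof.
move=> z0 Az Bz.
have A3 := slope1_ge3 hp hps l01; have B2 := slope2_ge hp hps l01.
rewrite PsiE ?(p_gt0 hp) ?(s_gt0 hp hps) //; move: A3 B2 Az Bz.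
move: (slope1 p s l) (slope2 p s l) => A B A3 B2 Az Bz.
have A0 : 0 < A by lra. have AB : A < B by lra.
have y0 : 0 < B / A - 1 by rewrite subr_gt0 ltr_pdivlMr // mul1r.
have yz : B / A - 1 <= z by rewrite lerBlDl ler_pdivrMr // mulrC.
rewrite PsiAB_pmass //; apply: mulr_le0_ge0.
  have : A * pmass z <= A * pmass (B / A - 1) by rewrite ler_pM2l // pmass_anti.
  by rewrite Az subr_le0.
by rewrite divr_ge0 ?sqr_ge0 // mulr_ge0 ?(ltW A0) // divr_ge0 ?(ltW A0) // ltW // (lt_trans A0).
Qed.

End Endpoint.

Section SingleJumpPsi.
Context {R : realType}.
Notation mu := (@lebesgue_measure R).
Notation I01 := (`[0%R, 1%R[%classic : set R).
Notation measureR := ({measure set (measurableTypeR R) -> \bar R}).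
Variables (p s : nat) (l : R).
Hypotheses (hp : (2 < p)%N) (hps : (p <= s)%N) (l01 : 0 <= l <= 1).
Notation xi := (mixture p s l).

(** Integration by parts: the left-hand side is the integral of the profile over
    [u, 1). *)
Lemma integral_ramp_dprofile (A z u : R) : 0 < A -> 0 < z -> 0 <= u < 1 ->
  (\int[mu]_(x in I01) (ramp u x * dprofile A z x)%:E = (A * pprim z 1 - A * pprim z u)%:E)%E.
Proof.
move=> A0 z0 /andP[u0 u1].
have den0 (x : R) : 0 <= x <= 1 -> 0 < 1 + z * (1 - x) by apply: den_gt0; exact: ltW.
have k0 (x : R) : 0 <= dprofile A z x.
  by rewrite divr_ge0 ?sqr_ge0 // mulr_ge0 ?(ltW A0) // addr_ge0 // ltW.
have d_k (x : R) : 0 <= x <= 1 -> derivable (dprofile A z) x 1.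
  by move=> x01; apply: derivable_dprofile; rewrite gt_eqF // den0.
have mk : measurable_fun I01 (dprofile A z).
  apply: measurable_halfopen; apply: subspace_continuous_measurable_fun => //.
  by apply: derivable_within_continuous => x; rewrite in_itv; exact: d_k.
have mrk : measurable_fun I01 (fun x => (ramp u x * dprofile A z x)%:E).
  by apply/measurable_EFinP; apply: measurable_funM => //; exact: measurable_ramp.
have rk0 (x : R) : 0 <= x < 1 -> (0 <= (ramp u x * dprofile A z x)%:E)%E.
  by move=> x01; rewrite lee_fin mulr_ge0 // ramp_ge0 //= in_itv.
rewrite (integral_split u0 (ltW u1) mrk rk0).
have -> : (\int[mu]_(x in `[0%R, u[) (ramp u x * dprofile A z x)%:E =
    ((1 - u) * profile A z u)%:E)%E.
  rewrite EFinM -(@integral_dprofile _ A z u z0) ?u0 ?(ltW u1) // -ge0_integralZl //.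
  - apply: eq_integral => x; rewrite inE /= in_itv /= => /andP[x0 xu].
    by rewrite -EFinM /ramp max_r // ltW.
  - apply/measurable_EFinP; apply: measurable_funS mk => //.
    by apply: subset_itvl; rewrite bnd_simp ltW.
  - by move=> x _; rewrite lee_fin.
  - by rewrite lee_fin subr_ge0 ltW.
pose F : R -> R := (fun y : R => 1 + (-1) * y) * profile A z + A \*: pprim z.
have d_F (x : R) : u <= x <= 1 -> is_derive x 1 F ((1 - x) * dprofile A z x).
  move=> /andP[ux x1]; have x01 : 0 <= x <= 1 by rewrite (le_trans u0 ux).
  have dn := lt0r_neq0 (den0 x x01).
  have d := is_deriveD (is_deriveM (is_derive_affine 1 (-1) x) (is_derive_profile A dn))
    (is_deriveZ A (is_derive_pprim (lt0r_neq0 z0) (den0 _ x01))).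
  apply: (is_derive_eq d); rewrite /profile /GRing.scale /=; ring.
have cont : {within `[u, 1], continuous (fun x : R => (1 - x) * dprofile A z x)}.
  apply: derivable_within_continuous => x; rewrite in_itv /= => /andP[ux x1].
  have -> : (fun x : R => (1 - x) * dprofile A z x) = (fun y : R => 1 + (-1) * y) * dprofile A z.
    apply/funext => y; change ((1 - y) * dprofile A z y = (1 + (-1) * y) * dprofile A z y).
    by rewrite mulN1r.
  apply: derivableM; first by case: (is_derive_affine 1 (-1) x).
  by apply: d_k; rewrite (le_trans u0 ux).
have -> : (\int[mu]_(x in `[u, 1%R[) (ramp u x * dprofile A z x)%:E = (F 1 - F u)%:E)%E.
  rewrite -(integral_derivative (ltW u1) d_F cont); apply: eq_integral => x.
  by rewrite inE /= in_itv /= => /andP[ux _]; rewrite /ramp max_l.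
rewrite -EFinD; congr (_%:E).
change ((1 - u) * profile A z u + (((1 + (-1) * 1) * profile A z 1 + A * pprim z 1) -
  ((1 + (-1) * u) * profile A z u + A * pprim z u)) = A * pprim z 1 - A * pprim z u).
ring.
Qed.

(** With z = m / D the tail is that of a one-step measure.  [stationary] gives A = xi'(1)
    and A * pmass z = 1; the variations near 1 give z >= B / A - 1.  As [pmass]
    decreases, A * pmass (B / A - 1) >= 1, that is Psi <= 0. *)
Lemma Psi_le0_of_jump_at0 (nu : measureR) (g : R -> R) (D m : R) :
  is_parisi_measure xi nu -> decomposes nu g D -> 0 < m ->
  (forall x, I01 x -> g x = m * (0 <= x)%R%:R) -> Psi p s l <= 0.
Proof.
move=> par dec m0 gE; have D0 := dec_gt0 dec.
have i0 : 0 <= (0 : R) < 1 by rewrite lexx ltr01.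
have [S1 S2] := stationary hp hps l01 par dec i0 m0 gE.
have V u u01 := @ramp_variation _ _ _ _ l01 _ _ _ _ _ par dec i0 m0 gE u u01.
pose z := m / D; pose A := (D ^+ 2 * (1 + z))^-1.
have z0 : 0 < z by rewrite divr_gt0.
have z1 : 0 < 1 + z by rewrite addr_gt0.
have A0 : 0 < A by rewrite invr_gt0 mulr_gt0 // exprn_gt0.
have hk x : I01 x -> tail1 D m 0 x ^- 2 = dprofile A z x.
  rewrite /= in_itv /= => /andP[x0 x1].
  have dn : 0 < 1 + z * (1 - x) by apply: den_gt0; [exact: ltW|rewrite x0 ltW].
  have -> : tail1 D m 0 x = D * (1 + z * (1 - x)).
    have zD : m = z * D by rewrite divfK // gt_eqF.
    by rewrite /tail1 /ramp max_l // [m in LHS]zD; ring.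
  by rewrite /dprofile /A; field; rewrite !gt_eqF.
have AE : A = slope1 p s l.
  apply/eqP; rewrite -eqe -S2; apply/eqP.
  rewrite [RHS](_ : _ = \int[mu]_(x in I01) (dprofile A z x)%:E)%E; last first.
    by apply: eq_integral => x; rewrite inE => xI; rewrite hk.
  rewrite (@integral_dprofile _ A z 1 z0) ?ler01 ?lexx //.
  by rewrite /profile subrr mulr0 addr0 divr1 mulr1.
have T u : 0 <= u < 1 -> (\int[mu]_(x in I01) (ramp u x / tail1 D m 0 x ^+ 2)%:E =
    (A * pprim z 1 - A * pprim z u)%:E)%E.
  move=> u01; rewrite -(integral_ramp_dprofile A0 z0 u01); apply: eq_integral => x.
  by rewrite inE => xI; rewrite hk.
apply: (Psi_le0_of_curvature hp hps l01 z0).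
  rewrite -AE -pprim_pmass ?gt_eqF // mulrBr; move: S1; rewrite T // mixture0 ?subr0 ?(p_gt0 hp) ?(s_gt0 hp hps) //.
  by case.
rewrite -AE; apply: (endpoint_curvature hp hps z0 AE) => u u01.
by have := V u u01; rewrite T // lee_fin.
Qed.

End SingleJumpPsi.

(** * A density whose jump measure has a one-point support *)

Section SinglePointSupport.
Context {R : realType}.
Notation I01 := (`[0%R, 1%R[%classic : set R).
Notation measureR := ({measure set (measurableTypeR R) -> \bar R}).
Variables (rho : measureR) (g : R -> R).
Hypotheses (gd : density_on01 g) (cdf : has_cdf01 rho g).

Let g_homo (x y : R) : 0 <= x -> x <= y -> y < 1 -> g x <= g y.
Proof.
move=> x0 xy y1; case: gd => _ h _; apply: h => //.
  by rewrite in_itv /= x0 (le_lt_trans xy).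
by rewrite in_itv /= y1 (le_trans x0).
Qed.

Let cdfE (x : R) : 0 <= x < 1 -> rho `[0, x]%classic = (g x)%:E.
Proof. by move=> x01; case: cdf => _ ->. Qed.

Lemma null_ball (x : R) : 0 <= x < 1 -> ~ support01 rho x ->
  exists2 e : R, 0 < e & rho (ball x e) = 0%E.
Proof.
move=> x01 nx.
have [U [oU Ux rU]] : exists U : set R, [/\ open U, U x & ~ (0 < rho U)%E].
  apply: contrapT => H; apply: nx; split; first by rewrite in_itv.
  move=> U oU Ux; apply: contrapT => rU; apply: H.
  by exists U.
have [e e0 eU] := (nbhs_ballP (x : R) U).1 (open_nbhs_nbhs (conj oU Ux)).
exists e => //; apply/eqP; rewrite eq_le measure_ge0 andbT.
apply: (@le_trans _ _ (rho U)).
  by apply: le_measure; rewrite ?inE //; apply: open_measurable => //; exact: ball_open.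
by rewrite leNgt; apply/negP.
Qed.

Lemma cdf_flat (U : set R) (a b : R) : open U -> rho U = 0%E ->
  0 <= a -> a <= b -> b < 1 -> (forall x, a < x <= b -> U x) -> g a = g b.
Proof.
move=> oU rU a0 ab b1 abU; apply/eqP; rewrite eq_le g_homo //=.
have mU : measurable (U : set (measurableTypeR R)) by exact: open_measurable.
rewrite -lee_fin -!cdfE ?a0 ?(le_trans a0 ab) ?(le_lt_trans ab b1) //.
apply: (@le_trans _ _ (rho (`[0, a] `|` U))); last first.
  by rewrite -[leRHS]adde0 -rU; exact: (measureU2 rho (measurable_itv _) mU).
apply: le_measure; rewrite ?inE //; first exact: measurableU.
move=> x /=; rewrite !in_itv /= => /andP[x0 xb]; rewrite x0 /=.
by case: (leP x a) => xa; [left|right; apply: abU; rewrite xa].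
Qed.

Variable x0 : R.
Hypothesis supp : support01 rho = [set x0].

Let x0I : 0 <= x0 < 1.
Proof.
have : support01 rho x0 by rewrite supp.
by case; rewrite in_itv.
Qed.

Let off_support (x : R) : 0 <= x < 1 -> x != x0 -> exists2 e : R, 0 < e & rho (ball x e) = 0%E.
Proof.
by move=> x01 /eqP xx0; apply: null_ball => //; rewrite supp.
Qed.

(** Every point off the support has a ball without mass, on which g is constant; so g
    has a zero derivative. *)
Lemma cdf_constant (a b : R) : 0 <= a -> a <= b -> b < 1 -> x0 < a \/ b < x0 -> g a = g b.
Proof.
move=> a0 ab b1 out.
have ne (y : R) : a <= y <= b -> y != x0.
  move=> /andP[ay yb]; case: out => H.
    by rewrite gt_eqF // (lt_le_trans H).
  by rewrite lt_eqF // (le_lt_trans yb).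
have flat (y : R) : a < y < b -> is_derive y 1 g 0.
  move=> /andP[ay yb].
  have y01 : 0 <= y < 1 by rewrite (le_trans a0 (ltW ay)) (lt_trans yb).
  have [e e0 re] : exists2 e : R, 0 < e & rho (ball y e) = 0%E.
    by apply: off_support => //; apply: ne; rewrite !ltW.
  apply: (near_eq_is_derive _ (is_derive_cst (g y) y 1)); near=> t.
  have ty : `|y - t| < e by near: t; exact: nbhsx_ballx.
  have at' : a < t by near: t; exact: lt_nbhsr.
  have tb : t < b by near: t; exact: lt_nbhsl.
  have oB : open (ball y e) by exact: ball_open.
  case: (leP t y) => ty'.
    rewrite (cdf_flat oB re (le_trans a0 (ltW at')) ty' (lt_trans yb b1)) // => x /andP[tx xy].
    rewrite /ball /= ger0_norm ?subr_ge0 //; move: ty; rewrite ger0_norm ?subr_ge0 //.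
    by move=> yt; lra.
  rewrite -(cdf_flat oB re (le_trans a0 (ltW ay)) (ltW ty') (lt_trans tb b1)) // => x /andP[tx xy].
  rewrite /ball /= ltr0_norm ?subr_lt0 //; move: ty; rewrite ltr0_norm ?subr_lt0 //.
  by move=> yt; lra.
have abI : 0 <= b < 1 by rewrite b1 (le_trans a0).
have aI : 0 <= a < 1 by rewrite a0 (le_lt_trans ab).
have [ea ea0 ra] := off_support aI (ne a (introT andP (conj (lexx a) ab))).
have [eb eb0 rb] := off_support abI (ne b (introT andP (conj ab (lexx b)))).
move: ab; rewrite le_eqVlt => /orP[/eqP-> //|ab].
pose a' := Num.min (a + ea / 2) ((a + b) / 2).
pose b' := Num.max (b - eb / 2) ((a + b) / 2).
have aa' : a < a' by rewrite lt_min; apply/andP; split; lra.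
have b'b : b' < b by rewrite gt_max; apply/andP; split; lra.
have a'b' : a' <= b'.
  by apply: (@le_trans _ _ ((a + b) / 2)); [rewrite ge_min lexx orbT|rewrite le_max lexx orbT].
have a'ea : a' <= a + ea / 2 by rewrite ge_min lexx.
have b'eb : b - eb / 2 <= b' by rewrite le_max lexx.
have oB x e : open (ball (x : R) e) by exact: ball_open.
have a'1 : a' < 1 by rewrite (le_lt_trans a'b') // (lt_trans b'b).
have b'0 : 0 <= b' by rewrite (le_trans _ a'b') // (le_trans a0) // ltW.
rewrite (cdf_flat (oB a ea) ra a0 (ltW aa') a'1); last first.
  move=> x /andP[ax xa']; rewrite /ball /= ltr0_norm ?subr_lt0 //.
  by move: (le_trans xa' a'ea); lra.
rewrite -(cdf_flat (oB b eb) rb b'0 (ltW b'b) b1); last first.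
  move=> x /andP[ax xa']; rewrite /ball /= ger0_norm ?subr_ge0 //.
  by move: (le_lt_trans b'eb ax); lra.
have d y : a' <= y <= b' -> is_derive y 1 g 0.
  by move=> /andP[ay yb]; apply: flat; rewrite (lt_le_trans aa') // (le_lt_trans yb).
apply/eqP; rewrite eq_le g_homo ?(le_trans a0 (ltW aa')) ?(lt_trans b'b) //=.
have dN y : a' <= y <= b' -> is_derive y 1 (- g) (- 0) by move=> yI; exact: is_deriveN (d y yI).
rewrite -lerN2; apply: (derive_ge0_le a'b' (f := - g) (df := fun=> - 0)).
- by move=> y /andP[ay yb]; apply: dN; rewrite !ltW.
- by move=> y _; rewrite oppr0.
- exact: within_of_derive dN.
Unshelve. all: by end_near. Qed.

Lemma step_of_support : exists2 m, 0 < m & forall x, I01 x -> g x = m * (x0 <= x)%R%:R.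
Proof.
have [x00 x01] := andP x0I.
pose c := (x0 + 1) / 2.
have x0c : x0 < c by rewrite /c; lra.
have c1 : c < 1 by rewrite /c; lra.
have above x : x0 < x < 1 -> g x = g c.
  move=> /andP[x0x x1]; case: (leP x c) => xc.
    by apply: cdf_constant => //; [exact: le_trans (ltW x0x)|left].
  by apply/esym; apply: cdf_constant => //; [exact: le_trans (ltW x0c)|exact: ltW|left].
have at0 : g x0 = g c.
  have x0R : x0 \in `[0, 1[ by rewrite in_itv.
  case: gd => _ _ /(_ _ x0R) cv.
  have cv' : g y @[y --> x0^'+] --> g c.
    apply: cvg_near_cst; near=> y; apply: above.
    by apply/andP; split; near: y; [exact: nbhs_right_gt|exact: nbhs_right_lt].
  exact: (cvg_unique _ cv cv').
have below x : 0 <= x < x0 -> g x = 0.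
  move=> /andP[xp xx0]; have x1 := lt_trans xx0 x01.
  have i0 : 0 <= (0 : R) < 1 by rewrite lexx ltr01.
  have [e e0 re] := off_support i0 (negbT (lt_eqF (le_lt_trans xp xx0))).
  pose a := Num.min (e / 2) x.
  have a0 : 0 <= a by rewrite le_min xp andbT ltW // divr_gt0.
  have ax : a <= x by rewrite ge_min lexx orbT.
  have ae : a < e by rewrite gt_min; apply/orP; left; lra.
  rewrite -(cdf_constant a0 ax x1 (or_intror xx0)).
  have a1 : 0 <= a < 1 by rewrite a0 (le_lt_trans ax).
  have E := cdfE a1; suff : rho `[0, a]%classic = 0%E by rewrite E; case.
  apply/eqP; rewrite eq_le measure_ge0 andbT.
  apply: (@le_trans _ _ (rho (ball 0 e))); last by rewrite re.
  apply: le_measure; rewrite ?inE //; first by apply: open_measurable; exact: ball_open.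
  move=> t; rewrite /= in_itv /= /ball /= => /andP[t0 ta].
  by rewrite sub0r normrN ger0_norm // (le_lt_trans ta).
have c0 : 0 <= c by rewrite (le_trans x00) // ltW.
have m0 : 0 < g c.
  have gc0 : 0 <= g c by case: gd => + _ _; apply; rewrite in_itv /= c0.
  rewrite lt_neqAle gc0 andbT; apply/eqP => gc.
  have [_ pos] : support01 rho x0 by rewrite supp.
  have oC : open (`]-oo, c[%classic : set R) by apply: interval_open.
  have : (0 < rho `]-oo, c[%classic)%E by apply: pos => //; rewrite /= in_itv /= x0c.
  apply/negP; rewrite -leNgt.
  apply: (@le_trans _ _ (rho (~` `[0, 1[ `|` `[0, c]))).
    apply: le_measure; rewrite ?inE //.
      by apply: measurableU => //; exact: measurableC.
    move=> t /=; rewrite !in_itv /= => tc; case: (leP 0 t) => t0 /=; last by left; apply/negP.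
    by right; rewrite ltW.
  have r0 : rho (~` `[0, 1[) = 0%E by case: cdf.
  have rc : rho `[0, c]%classic = 0%E by rewrite cdfE ?c0 // -gc.
  apply: (@le_trans _ _ (rho (~` `[0%R, 1%R[) + rho `[0%R, c]%classic)%E).
    exact: (measureU2 rho (measurableC (measurable_itv _)) (measurable_itv _)).
  by rewrite r0 rc adde0.
exists (g c) => // x; rewrite /= in_itv /= => /andP[xp x1].
case: (ltgtP x0 x) => xx0.
- by rewrite mulr1 above // xx0.
- by rewrite mulr0 below // xp.
- by rewrite mulr1 -xx0.
Unshelve. all: by end_near. Qed.

End SinglePointSupport.

(** * The characterization *)

Lemma Psi_le0_of_kRSB1 (R : realType) (p s : nat) (l : R) :
  (2 < p)%N -> (p <= s)%N -> 0 <= l <= 1 -> is_kRSB (mixture p s l) 1 -> Psi p s l <= 0.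
Proof.
move=> hp hps l01 [nu [g [D [rho [par dec cdf card1]]]]].
have /eq_cardSP[x0 sx0 rest] := card1.
have supp : support01 rho = [set x0].
  apply/seteqP; split=> [x sx|x -> //]; apply: contrapT => xx0.
  have : (support01 rho `\ x0) x by [].
  by move: rest; rewrite II0 card_eq0 => /eqP->.
have [gd _ _] := dec.
have [m m0 gE] := step_of_support gd cdf supp.
have x01 : 0 <= x0 < 1 by case: sx0; rewrite in_itv.
have x00 := jump_at0 hp hps l01 par dec x01 m0 gE.
by apply: (Psi_le0_of_jump_at0 hp hps l01 par dec m0) => x xI; rewrite gE // x00.
Qed.

Theorem theorem2 (R : realType) (p s : nat) (hp : (2 < p)%N) (hps : (p <= s)%N) :
  (forall lambda : R, 0 <= lambda <= 1 -> is_kRSB (mixture p s lambda) 1)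
  <->
  (Delta R p s <= 0 \/
   (0 < Delta R p s /\
    exists l1 l2 : R, ordered_roots p s l1 l2 /\ Psi p s l1 < 0)).
Proof.
split=> [rsb|cond l l01].
  case: (leP (Delta R p s) 0) => [D0|D0]; [by left|right; split=> //].
  have [l1 [l2 roots]] := exists_ordered_roots hp hps D0.
  have [_ Q1 _] := roots; have /andP[l10 l11] := root_in01 hp hps D0 Q1.
  have l01 : 0 <= l1 <= 1 by rewrite !ltW.
  exists l1, l2; split=> //; rewrite lt_neqAle (Psi_neq0_at_root hp hps D0 Q1) /=.
  exact: Psi_le0_of_kRSB1 (rsb l1 l01).
have [z z0 [Az cert]] := one_step_certificate hp hps l01 cond.
apply: (kRSB1_of_certificate l01 z0 _ _ Az cert); last first.
  by rewrite mixture0 ?(p_gt0 hp) ?(s_gt0 hp hps).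
exact: lt_le_trans (slope1_ge3 hp hps l01).
Qed.
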